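(* Let $H\in(1/2,1)$, let $b\in\mathcal{C}^2_b$ and $\sigma\in\mathcal{C}^3_b$, let $x_0\in\mathbb{R}$, let $X$ be the solution of $$X_t=x_0+\int_0^t\sigma(X_s)\,d^-B_s+\int_0^t b(X_s)\,ds,\qquad t\in[0,1],$$ and let $\overline{X}^n$ be its Euler scheme with step size $1/n$. Then, as $n\to\infty$, $$n^{2H-1}\left[\overline{X}^n_1-X_1\right]\ \longrightarrow\ -\frac12\int_0^1\sigma'(X_s)\,D_sX_1\,ds\qquad\text{almost surely.}$$
   Context: $B=(B_t)_{t\in[0,1]}$ is a fractional Brownian motion with Hurst parameter $H$: a continuous centered Gaussian process with covariance $R_H(s,t)=\frac12(s^{2H}+t^{2H}-|t-s|^{2H})$. $\mathcal{C}^k_b$ denotes the functions $g:\mathbb{R}\to\mathbb{R}$ of class $\mathcal{C}^k$ whose derivatives of orders $1,\dots,k$ are bounded ($g$ itself need not be bounded). The (Russo-Vallois) forward integral $\int_0^tZ_s\,d^-B_s$ of a continuous process $Z$ is the limit, uniformly in $t\in[0,1]$ in probability, of $\varepsilon^{-1}\int_0^tZ_s(B_{s+\varepsilon}-B_s)\,ds$ as $\varepsilon\to0$, when it exists ($B$ being extended continuously beyond time 1). If $Z$ has Hölder paths of order $\alpha>1-H$, it coincides with the pathwise Young integral. Under the stated assumptions the equation has a unique solution $X$ among processes with Hölder continuous paths of order $\alpha>1-H$; ''the solution'' means this process. Euler scheme: $\overline{X}^n_0=x_0$, $\overline{X}^n_{(k+1)/n}=\overline{X}^n_{k/n}+\sigma(\overline{X}^n_{k/n})(B_{(k+1)/n}-B_{k/n})+b(\overline{X}^n_{k/n})\frac1n$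 for $k\in\{0,\dots,n-1\}$, and $\overline{X}^n_t=\overline{X}^n_{[nt]/n}$ for $t\in[0,1]$. $D_sX_t$ is the Malliavin derivative at time $s$ of $X_t$ with respect to $B$; it is known that $X_t\in\mathbb{D}^{1,2}$ for $t\in(0,1]$ and that, for $0\le s\le t\le1$, $t>0$, $$D_sX_t=\sigma(X_s)\exp\left(\int_s^tb'(X_u)\,du+\int_s^t\sigma'(X_u)\,d^-B_u\right),$$ which is the version used here. *)

(* Defs.v *)
From HB Require Import structures.
From mathcomp Require Import all_boot all_order all_algebra.
From mathcomp Require Import all_classical all_reals all_analysis.
Set Implicit Arguments.
Unset Strict Implicit.
Unset Printing Implicit Defensive.
Import Order.TTheory GRing.Theory Num.Theory.
Import numFieldTopology.Exports numFieldNormedType.Exports.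
Local Open Scope classical_set_scope.
Local Open Scope ring_scope.

(** Real processes indexed by the unit interval are represented by families
    indexed by all of [R]; only the times in [`[0, 1]] are ever constrained or
    used. *)

Section regularity.
Context {R : realType}.

(* Class C^k with bounded derivatives of orders 1, ..., k; the function itself
   may be unbounded. *)
Definition Ckb (k : nat) (g : R -> R) : Prop :=
  [/\ forall j x, (j < k)%N -> derivable (derive1n j g) x 1,
      continuous (derive1n k g) &
      forall j, (1 <= j <= k)%N -> exists M, forall x, `|derive1n j g x| <= M].

Definition holder_on01 (alpha : R) (f : R -> R) : Prop :=
  exists C, forall s t, s \in `[0, 1] -> t \in `[0, 1] ->
    `|f t - f s| <= C * `|t - s| `^ alpha.

Definition partial {m : nat} (i : 'I_m) (f : 'rV[R]_m -> R) : 'rV[R]_m -> R :=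
  fun x => 'D_(delta_mx 0 i) f x.

(* C^infty: all iterated partial derivatives, in any order, exist and are
   continuous. *)
Definition smooth {m : nat} (f : 'rV[R]_m -> R) : Prop :=
  forall l : seq 'I_m, let g := foldr partial f l in
    continuous g /\ forall i x, derivable g x (delta_mx 0 i).

Definition compactly_supported {m : nat} (f : 'rV[R]_m -> R) : Prop :=
  exists K, forall x, K < `|x| -> f x = 0.

End regularity.

Section processes.
Context {d : measure_display} {T : measurableType d} {R : realType}.
Variable P : probability T R.

(* Possibly degenerate: the variance-zero case, which [normal_prob] does not
   cover, is a Dirac mass. *)
Definition gaussian_rv (Y : T -> R) : Prop :=
  exists m s : R, forall A : set R, measurable A ->
    P (Y @^-1` A) = if s == 0 then \d_m A else normal_prob m s A.

Definition gaussian_process (B : R -> {RV P >-> R}) : Prop :=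
  forall (m : nat) (t a : 'I_m -> R), (forall i, t i \in `[0, 1]) ->
    gaussian_rv (fun w => \sum_(i < m) a i * B (t i) w).

Definition fbm_cov (H s t : R) : R :=
  (s `^ (2 * H) + t `^ (2 * H) - `|t - s| `^ (2 * H)) / 2.

Record fbm (H : R) (B : R -> {RV P >-> R}) : Prop := Fbm {
  fbm_gaussian : gaussian_process B ;
  fbm_centered : forall t, t \in `[0, 1] -> ('E_P[B t] = 0)%E ;
  fbm_covariance : forall s t, s \in `[0, 1] -> t \in `[0, 1] ->
    covariance P (B s) (B t) = (fbm_cov H s t)%:E ;
  fbm_continuous :
    {ae P, forall w, {within `[0, 1], continuous (fun t => B t w)}} }.

(* The integrator is extended beyond time 1 by its value at time 1. *)
Definition forward_approx (Z : R -> T -> R) (B : R -> {RV P >-> R})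
    (eps t : R) (w : T) : R :=
  eps^-1 * \int[lebesgue_measure]_(s in `[0, t])
             (Z s w * (B (Num.min (s + eps) 1) w - B s w)).

(* [I t] is the forward integral of [Z] against [B] over [0, t]: uniform
   convergence in probability. The outer probability [P^*] agrees with [P] on
   events; it avoids having to know beforehand that the supremum over the
   uncountable set of times is measurable. *)
Definition forward_integral (Z : R -> T -> R) (B I : R -> {RV P >-> R}) : Prop :=
  forall delta : R, 0 < delta ->
    (P^*)%mu [set w | exists2 t, t \in `[0, 1] &
                delta < `|forward_approx Z B eps t w - I t w|]
      @[eps --> 0^'+] --> 0%E.

Definition sde_solution (H : R) (B : R -> {RV P >-> R}) (b sigma : R -> R)
    (x0 : R) (X : R -> {RV P >-> R}) : Prop :=
  (exists2 alpha, 1 - H < alpha &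
     {ae P, forall w, holder_on01 alpha (fun t => X t w)}) /\
  exists2 I : R -> {RV P >-> R},
    forward_integral (fun s w => sigma (X s w)) B I &
    {ae P, forall w, forall t, t \in `[0, 1] ->
      X t w = x0 + I t w + (\int[lebesgue_measure]_(s in `[0, t]) b (X s w))}.

(* Value of the scheme at the grid point k / n. *)
Fixpoint euler_grid (B : R -> {RV P >-> R}) (b sigma : R -> R) (x0 : R)
    (n k : nat) (w : T) : R :=
  if k is j.+1 then
    let y := euler_grid B b sigma x0 n j w in
    y + sigma y * (B (j.+1%:R / n%:R) w - B (j%:R / n%:R) w) + b y * n%:R^-1
  else x0.

Definition euler (B : R -> {RV P >-> R}) (b sigma : R -> R) (x0 : R)
    (n : nat) (t : R) (w : T) : R :=
  euler_grid B b sigma x0 n (Num.truncn (n%:R * t)) w.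

(** The Malliavin derivative with respect to [B]. The Hilbert space of the
    fractional Brownian motion is the completion of the step functions for
    <1_[0,s], 1_[0,t]> = fbm_cov H s t. For H > 1/2 its inner product on
    functions is
      <phi, psi> = H (2 H - 1) \int\int phi(s) psi(u) |s - u|^(2 H - 2) ds du,
    where the integrand is absolutely integrable. *)

Definition fbm_kernel (H : R) (phi : R -> R) (p : R * R) : R :=
  phi p.1 * phi p.2 * `|p.1 - p.2| `^ (2 * H - 2).

Definition fbm_hilbert (H : R) (phi : R -> R) : Prop :=
  measurable_fun (`[0, 1]%classic : set R) phi /\
  (lebesgue_measure \x lebesgue_measure)%E.-integrable (`[0, 1] `*` `[0, 1])
    (EFin \o fbm_kernel H phi).

Definition fbm_sqnorm (H : R) (phi : R -> R) : R :=
  H * (2 * H - 1) *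
  \int[(lebesgue_measure \x lebesgue_measure)%E]_(p in `[0, 1] `*` `[0, 1])
    fbm_kernel H phi p.

(* [F] is a smooth cylindrical functional of [B] with derivative [DF]. *)
Definition cylindrical_derivative (B : R -> {RV P >-> R}) (F : T -> R)
    (DF : R -> T -> R) : Prop :=
  exists (m : nat) (t : 'I_m -> R) (f : 'rV[R]_m -> R),
    [/\ forall i, t i \in `[0, 1], smooth f, compactly_supported f,
        F = (fun w => f (\row_i B (t i) w)) &
        DF = (fun s w => \sum_(i < m)
                partial i f (\row_j B (t j) w) * \1_(`[0, t i]%classic) s)].

(* [F] is in D^{1,2} and [D s w] represents its Malliavin derivative at time
   [s]: [(F, D)] is in the closure of the graph of the derivative of smooth
   cylindrical functionals for the norm E[F^2] + E[||DF||^2]. *)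
Definition malliavin_derivative (H : R) (B : R -> {RV P >-> R})
    (F : {RV P >-> R}) (D : R -> T -> R) : Prop :=
  [/\ measurable_fun ((`[0, 1]%classic : set R) `*` [set: T])
        (fun p : R * T => D p.1 p.2),
      {ae P, forall w, fbm_hilbert H (fun s => D s w)} &
      exists (Fk : nat -> T -> R) (DFk : nat -> R -> T -> R),
        [/\ forall k, cylindrical_derivative B (Fk k) (DFk k),
            ('E_P[fun w => ((Fk k w - F w) ^+ 2)%R] @[k --> \oo] --> 0)%E &
            ('E_P[fun w => fbm_sqnorm H (fun s => DFk k s w - D s w)%R]
               @[k --> \oo] --> 0)%E]].

(* The explicit version of the Malliavin derivative of [X t]; the forward
   integral over [s, t] is the increment between [s] and [t] of the forward
   integral process. *)
Definition malliavin_formula (B : R -> {RV P >-> R}) (b sigma : R -> R)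
    (X : R -> {RV P >-> R}) (t : R) (D : R -> T -> R) : Prop :=
  exists2 J : R -> {RV P >-> R},
    forward_integral (fun u w => derive1 sigma (X u w)) B J &
    {ae P, forall w, forall s, s \in `[0, t] ->
      D s w = sigma (X s w) *
        expR ((\int[lebesgue_measure]_(u in `[s, t]) derive1 b (X u w)) +
              (J t w - J s w))}.

End processes.

(* Main.v *)
Require Import Defs.
From HB Require Import structures.
From mathcomp Require Import all_boot all_order all_algebra.
From mathcomp Require Import all_classical all_reals all_analysis.
From mathcomp Require Import measurable_realfun.
From mathcomp Require Import ring lra zify.
Import Order.TTheory GRing.Theory Num.Theory.
Import numFieldTopology.Exports numFieldNormedType.Exports.
Local Open Scope classical_set_scope.
Local Open Scope ring_scope.
Set Implicit Arguments.
Unset Strict Implicit.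
Unset Printing Implicit Defensive.

(** Divided by the flow of the linearised equation, the error of the scheme is, up
    to smaller terms, a weighted sum of squared increments of B, and such sums
    converge.

    Fix a path and let be < H be close to H. Over one step of length 1 / n the
    solution moves by
      sigma (X_k) dB_k + b (X_k) / n + 1/2 sigma sigma' (X_k) dB_k^2
    up to an error of order 1 + be ([solution_expansion]), and the scheme follows
    the first two terms only. The error d_k = e_k - X_k thus satisfies
      d_(k+1) = d_k (1 + sigma' (X_k) dB_k + b' (X_k) / n)
                - 1/2 sigma sigma' (X_k) dB_k^2 + smaller terms.
    Multiplication by E = exp (- \int b' (X) - \int sigma' (X) dB), the inverse of
    the linearised flow, removes the linear term, and the sum over k telescopes:
      E_1 d_n = - 1/2 \sum_k E_k sigma sigma' (X_k) dB_k^2 + remainder.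
    Multiplied by n^(2 H - 1), the squared increments average any Hölder function
    like Lebesgue measure ([weighted_sums_cvg]), and sigma (X_s) E_s / E_1 is the
    Malliavin derivative D_s X_1; this is [error_limit].

    The remainder is negligible because of two estimates by sewing. An a priori
    bound shows that d is of size n^(1 - 2 be), together with its Hölder
    seminorm of order be on the grid ([young_gronwall]). The second-order Taylor
    term of sigma, which is too large to be summed termwise, is then a discrete
    Young sum ([young_sum]). Sewing also controls the forward integrals
    themselves: their approximations satisfy a Young estimate uniform in the
    width ([forward_approx_bound]), so that each of the two forward integrals,
    obtained almost surely along a sequence of widths ([forward_subsequence]),
    has the increments of a Young integral.

    Two facts on B remain. Its paths are Hölder of every order below H by
    Kolmogorov's criterion ([fbm_holder]). The rescaled quadratic variation over
    [0, q], q rational, converges almost surely to q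
    ([quadratic_variation_ae]): the moments of all orders of the centred sum of squares are bounded by Gaussian
    integration by parts ([quadratic_moments]), as for H > 1/2 the increments
    are nonnegatively correlated with covariances whose row sums are at most
    2 / n. *)

(** * Real powers *)

Section powers.
Context {R : realType}.
Implicit Types (x y a b r : R).

Lemma powR_mono x y r : 0 <= r -> 0 <= x -> x <= y -> x `^ r <= y `^ r.
Proof.
move=> r0 x0 xy; apply: ge0_ler_powR => //; rewrite nnegrE//.
exact: le_trans xy.
Qed.

Lemma powR_anti x a b : 0 <= x <= 1 -> 0 <= b -> b <= a -> x `^ a <= x `^ b.
Proof.
move=> /andP[x0 x1] b0 ba; have [->|xn0] := eqVneq x 0.
  have [->|bn0] := eqVneq b 0; first by rewrite powRr0 /powR eqxx; case: eqP.
  by rewrite !powR0// gt_eqF// (lt_le_trans _ ba)// lt_neqAle eq_sym bn0.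
by apply: ger_powR => //; rewrite x1 andbT lt_neqAle eq_sym xn0.
Qed.

Lemma powRD_ge0 x a b : 0 <= a -> 0 <= b -> x `^ (a + b) = x `^ a * x `^ b.
Proof.
move=> a0 b0; have [->|xn0] := eqVneq x 0; last by rewrite powRD// xn0 implybT.
have [->|an0] := eqVneq a 0; first by rewrite powRr0 add0r mul1r.
rewrite (powR0 an0) mul0r powR0// gt_eqF// ltr_pwDl//.
by rewrite lt_neqAle eq_sym an0.
Qed.

Lemma powR_le1 x r : 0 <= x <= 1 -> 0 <= r -> x `^ r <= 1.
Proof. by move=> x01 r0; rewrite -[leRHS](powRr0 x); exact: powR_anti. Qed.

(** The contraction that makes repeated splitting converge for exponents larger
    than one: two pieces of at most two thirds of the length. *)
Lemma powR_split th x y : 1 < th -> 0 <= x -> 0 <= y ->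
  x <= 2 / 3 * (x + y) -> y <= 2 / 3 * (x + y) ->
  x `^ th + y `^ th <= (2 / 3) `^ (th - 1) * (x + y) `^ th.
Proof.
move=> th1 x0 y0 hx hy; have th0 : 0 < th by lra.
rewrite -(mulr_powRB1 x0 th0) -(mulr_powRB1 y0 th0).
rewrite -(mulr_powRB1 (addr_ge0 x0 y0) th0) mulrCA.
rewrite -powRM; [|lra|lra].
by rewrite mulrDl lerD// ler_wpM2l//; apply: powR_mono => //; lra.
Qed.

Lemma natr_invr_powR (n : nat) r : n%:R^-1 `^ r = n%:R `^ (- r) :> R.
Proof. by rewrite powRN -powR_inv1// -powRrM mulN1r powRN. Qed.

Lemma cvg_natr_powRN a : 0 < a -> n%:R `^ (- a) @[n --> \oo] --> (0 : R).
Proof.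
move=> a0; apply/cvgrPdist_le => e e0.
near=> n; rewrite sub0r normrN ger0_norm ?powR_ge0//.
have n0 : 0 < n%:R :> R by rewrite ltr0n; near: n; exists 1%N.
have hn : e^-1 `^ a^-1 <= n%:R.
  near: n; exists (Num.truncn (e^-1 `^ a^-1)).+1 => // m /= hm.
  apply: le_trans (ltW (truncnS_gt _)) _; by rewrite ler_nat.
rewrite powRN -[leRHS]invrK lef_pV2 ?posrE ?invr_gt0 ?powR_gt0//.
have -> : e^-1 = (e^-1 `^ a^-1) `^ a.
  by rewrite -powRrM mulVf ?gt_eqF// powRr1// invr_ge0 ltW.
by apply: powR_mono => //; rewrite ?powR_ge0 ?ltW.
Unshelve. all: by end_near.
Qed.

End powers.

(** * Sewing *)

Section sewing.
Context {R : realType}.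

Lemma split_thirds (m : nat) : (1 < m)%N -> exists x y : nat,
  [/\ m = (x + y)%N, (0 < x)%N, (0 < y)%N,
      (3 * x <= 2 * (x + y))%N & (3 * y <= 2 * (x + y))%N].
Proof.
move=> m1; exists m./2, (m - m./2)%N.
have := odd_double_half m; rewrite -muln2; move: (m./2) => x.
by case: (odd m) => /= hx; split; lia.
Qed.

Implicit Types (th : R).

(** Splitting [i, k] at its middle index halves both lengths up to rounding, so
    the defects met along the way are summed by a geometric series of ratio
    (2/3)^(th-1); what is left at the bottom is one term per elementary step. *)
Lemma discrete_sewing th : 1 < th -> exists2 c : R, 0 <= c &
  forall (g : nat -> nat -> R) (A h e : R) (lo hi : nat), 0 <= A -> 0 <= h ->
  (forall i j k, (lo <= i)%N -> (i <= j)%N -> (j <= k)%N -> (k <= hi)%N ->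
    `|g i k - g i j - g j k| <= A * ((k - i)%:R * h) `^ th) ->
  (forall k, (lo <= k)%N -> (k < hi)%N -> `|g k k.+1| <= e) ->
  forall i k, (lo <= i)%N -> (i <= k)%N -> (k <= hi)%N ->
    `|g i k| <= c * A * ((k - i)%:R * h) `^ th + (k - i)%:R * e.
Proof.
move=> th1; have th0 : th != 0 by rewrite gt_eqF//; lra.
set q : R := (2 / 3) `^ (th - 1).
have q1 : q < 1.
  have -> : 1 = 1 `^ (th - 1) :> R by rewrite powR1.
  apply: gt0_ltr_powR; rewrite ?nnegrE; lra.
have q0 : 0 <= q by exact: powR_ge0.
have c0 : 0 <= (1 - q)^-1 by rewrite invr_ge0 subr_ge0 ltW.
exists (1 - q)^-1 => // g A h e lo hi A0 h0 gA ge i k loi ik khi.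
have [m] := ubnP (k - i)%N; elim: m i k loi ik khi => // m IH i k loi ik khi hm.
have [/eqP ki0|] := posnP (k - i).
  have {ki0 ik}ki : k = i by move: ki0 => /eqP; lia.
  move: khi (gA i i i loi (leqnn _) (leqnn _)); rewrite ki => hi' /(_ hi').
  by rewrite subnn mul0r powR0// !mulr0 mul0r addr0 subrr sub0r normrN.
have [k1|k2] := leqP (k - i) 1 => k0.
  have -> : k = i.+1 by lia.
  rewrite subSnn !mul1r.
  apply: le_trans (ge i _ _) _ => //; first lia.
  by rewrite lerDr !mulr_ge0// powR_ge0.
have [x [y [xyN x0 y0 x23 y23]]] := split_thirds k2.
pose j := (i + x)%N.
have [xE yE] : (j - i)%N = x /\ (k - j)%N = y by clear -xyN k2; split; rewrite /j; lia.
have [ij jk ij' jk'] : [/\ (i <= j)%N, (j <= k)%N, (j - i < m)%N & (k - j < m)%N].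
  by rewrite xE yE; clear -xyN k2 hm x0 y0; split; rewrite /j; lia.
have H1 := gA i j k loi ij jk khi.
have H2 := IH i j loi ij (leq_trans jk khi) ij'.
have H3 := IH j k (leq_trans loi ij) jk khi jk'.
have xyE : (k - i)%:R = x%:R + y%:R :> R by rewrite xyN natrD.
rewrite xE in H2; rewrite yE in H3.
have tri : `|g i k| <= `|g i k - g i j - g j k| + `|g i j| + `|g j k|.
  have -> : g i k = (g i k - g i j - g j k) + g i j + g j k by ring.
  apply: le_trans (ler_normD _ _) _; rewrite lerD2r; apply: le_trans (ler_normD _ _) _.
  have -> : (g i k - g i j - g j k + g i j + g j k - g i j - g j k) = (g i k - g i j - g j k) by ring.
  by [].
apply: (le_trans tri).
have {}x23 : 3 * x%:R <= 2 * (x%:R + y%:R) :> R.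
  by rewrite -natrD -!natrM ler_nat.
have {}y23 : 3 * y%:R <= 2 * (x%:R + y%:R) :> R.
  by rewrite -natrD -!natrM ler_nat.
have := @powR_split _ th (x%:R * h) (y%:R * h) th1 ltac:(by rewrite mulr_ge0)
  ltac:(by rewrite mulr_ge0).
rewrite -mulrDl.
have e1 (z : R) : 3 * z <= 2 * (x%:R + y%:R) -> z * h <= 2 / 3 * ((x%:R + y%:R) * h).
  move=> hz; rewrite mulrA ler_wpM2r//; lra.
move=> /(_ (e1 _ x23) (e1 _ y23)); rewrite -/q => hsplit.
move: H1 H2 H3; rewrite xyE; set W := (_ * h) `^ th; set X := (x%:R * h) `^ th.
set Y := (y%:R * h) `^ th; move=> H1 H2 H3.
have W0 : 0 <= W by exact: powR_ge0.
have : (1 - q)^-1 * A * (X + Y) <= (1 - q)^-1 * A * (q * W).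
  by rewrite ler_wpM2l// mulr_ge0.
have -> : (1 - q)^-1 * A * (q * W) = (1 - q)^-1 * A * W - A * W.
  by field; rewrite gt_eqF// subr_gt0.
rewrite mulrDr; lra.
Qed.

(** Sewing in continuous time: on a grid of step (t - s) / N the bottom terms
    contribute N ((t - s) / N)^g, which vanishes as the grid is refined. *)
Lemma continuous_sewing th : 1 < th -> exists2 c : R, 0 <= c &
  forall (F : R -> R -> R) (A C g : R), 1 < g -> 0 <= A -> 0 <= C ->
  (forall s u t : R, 0 <= s -> s <= u -> u <= t -> t <= 1 ->
    `|F s t - F s u - F u t| <= A * (t - s) `^ th) ->
  (forall s t : R, 0 <= s -> s <= t -> t <= 1 -> `|F s t| <= C * (t - s) `^ g) ->
  forall s t : R, 0 <= s -> s <= t -> t <= 1 -> `|F s t| <= c * A * (t - s) `^ th.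
Proof.
move=> th1; have [c c0 sew] := discrete_sewing th1; exists c => //.
move=> F A C g g1 A0 C0 FA FC s t s0 st t1.
have key (N : nat) : (0 < N)%N ->
    `|F s t| <= c * A * (t - s) `^ th + C * (t - s) `^ g * N%:R `^ (- (g - 1)).
  move=> N0; set h := (t - s) / N%:R.
  have NR : 0 < N%:R :> R by rewrite ltr0n.
  have h0 : 0 <= h by rewrite divr_ge0// subr_ge0.
  pose p (k : nat) := s + k%:R * h.
  have p0 : p 0%N = s by rewrite /p mul0r addr0.
  have pN : p N = t by rewrite /p /h; field; rewrite gt_eqF.
  have pB i k : (i <= k)%N -> p k - p i = (k - i)%:R * h.
    by move=> ik; rewrite natrB// /p; ring.
  have ple i k : (i <= k)%N -> p i <= p k.
    by move=> ik; rewrite -subr_ge0 pB// mulr_ge0.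
  have := sew (fun i k => F (p i) (p k)) A h (C * h `^ g) 0%N N A0 h0.
  move=> /(_ _ _ 0%N N (leqnn _) (leq0n _) (leqnn _)); rewrite subn0 p0 pN.
  have -> : N%:R * h = t - s by rewrite /h; field; rewrite gt_eqF.
  have -> : N%:R * (C * h `^ g) = C * (t - s) `^ g * N%:R `^ (- (g - 1)).
    rewrite /h powRM ?invr_ge0 ?subr_ge0// natr_invr_powR.
    have -> : - (g - 1) = 1 + - g by ring.
    rewrite powRD; last by rewrite (gt_eqF NR) implybT.
    by rewrite powRr1//; ring.
  apply.
  - move=> i j k _ ij jk kN; rewrite -(pB _ _ (leq_trans ij jk)); apply: FA.
    + by rewrite -p0 in s0; exact: le_trans (ple _ _ (leq0n _)).
    + exact: ple.
    + exact: ple.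
    + by rewrite (le_trans (ple _ _ kN))// pN.
  - move=> k _ kN; have := FC (p k) (p k.+1); rewrite pB// subSnn mul1r; apply.
    + by rewrite -p0 in s0; exact: le_trans (ple _ _ (leq0n _)).
    + exact: ple.
    + by rewrite (le_trans (ple _ _ kN))// pN.
have lim : c * A * (t - s) `^ th + C * (t - s) `^ g * N%:R `^ (- (g - 1))
    @[N --> \oo] --> c * A * (t - s) `^ th + C * (t - s) `^ g * 0.
  by apply: cvgD; [exact: cvg_cst|apply: cvgMr; apply: cvg_natr_powRN; rewrite subr_gt0].
rewrite mulr0 addr0 in lim.
rewrite -(cvg_lim _ lim)//; apply: limr_ge; first by apply/cvg_ex; eexists; exact: lim.
by exists 1%N => // N /= N0; exact: key.
Qed.

End sewing.

(** * Primitives and the mean value theorem *)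

Section primitives.
Context {R : realType}.
Implicit Types (f F : R -> R).

Lemma mean_value F f (a b : R) : a <= b ->
  (forall x : R, a <= x <= b -> is_derive x 1 F (f x)) ->
  exists2 c : R, a <= c <= b & F b - F a = f c * (b - a).
Proof.
move=> ab dF.
have [||c cab E] := @MVT_segment _ F f a b ab.
- by move=> x; rewrite in_itv/= => /andP[ax xb]; apply: dF; rewrite !ltW.
- apply: derivable_within_continuous => x; rewrite in_itv/= => xab.
  by have := dF _ xab; case.
- by exists c.
Qed.

(** The base point -1 only makes the primitive differentiable at 0 too. *)
Lemma primitive_exists f : continuous f -> exists F,
  (forall x : R, 0 <= x -> is_derive x 1 F (f x)) /\
  (forall s t : R, 0 <= s -> s <= t ->
    \int[lebesgue_measure]_(u in `[s, t]) f u = F t - F s).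
Proof.
move=> cf; pose F x := \int[lebesgue_measure]_(u in `[-1, x]) f u.
have fi (u v : R) : lebesgue_measure.-integrable `[u, v] (EFin \o f).
  apply: continuous_compact_integrable; first exact: segment_compact.
  exact: continuous_subspaceT.
exists F; split=> [x x0|s t s0 st].
  have xx1 : x < x + 1 by rewrite ltrDl.
  have [|dF F'] := @continuous_FTC1_closed R f (-1) x (x + 1) xx1 (fi _ _) _ (cf x).
    by apply: lt_le_trans x0; rewrite ltrN10.
  by rewrite -F' derive1E; apply/derivableP.
rewrite /F (@Rintegral_itvB _ f (BLeft (-1)) (BRight t) s)//.
- rewrite Rintegral_itv_obnd_cbnd//.
  apply: integrableS (fi s t) => //; exact: subset_itv_oc_cc.
- by rewrite bnd_simp; apply: le_trans s0; rewrite lerN10.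
Qed.

End primitives.

(** * Hölder functions on the unit interval *)

Section clipping.
Context {R : realType}.
Implicit Types (f : R -> R) (a C : R).

(** Functions on the unit interval are extended to the line by composition with
    the projection onto it, which does not change their Hölder constants. *)
Definition clip01 (x : R) : R := Num.max 0 (Num.min x 1).

Lemma clip01_id x : 0 <= x -> x <= 1 -> clip01 x = x.
Proof. by move=> x0 x1; rewrite /clip01 (min_idPl x1) (max_idPr x0). Qed.

Lemma clip01_itv x : 0 <= clip01 x /\ clip01 x <= 1.
Proof. by rewrite /clip01; split; rewrite ?le_max ?lexx// ge_max ler01/= ge_min lexx orbT. Qed.

Lemma clip01_lip x y : `|clip01 x - clip01 y| <= `|x - y|.
Proof.
rewrite /clip01 /Num.max /Num.min.
case: (ltrP x 1) => ?; case: (ltrP y 1) => ?; rewrite ?ltr01;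
case: (ltrP 0 x) => ?; case: (ltrP 0 y) => ?; rewrite ler_norml; case: (lerP 0 (x - y)) => hh;
rewrite ?(ger0_norm hh) ?(ltr0_norm hh); apply/andP; split; lra.
Qed.

Lemma holder_on01P a f : holder_on01 a f -> exists2 C : R, 0 <= C &
  forall s t : R, 0 <= s -> s <= 1 -> 0 <= t -> t <= 1 ->
    `|f t - f s| <= C * `|t - s| `^ a.
Proof.
move=> [C hC]; exists `|C| => // s t s0 s1 t0 t1.
have := hC s t; rewrite !in_itv/= s0 s1 t0 t1 => /(_ isT isT) h.
by apply: le_trans h _; rewrite ler_wpM2r ?powR_ge0// ler_norm.
Qed.

Lemma holder_clip01 a f : 0 <= a -> holder_on01 a f -> exists2 C : R, 0 <= C &
  forall s t : R, `|f (clip01 t) - f (clip01 s)| <= C * `|t - s| `^ a.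
Proof.
move=> a0 /holder_on01P[C C0 hC]; exists C => // s t.
have [s0 s1] := clip01_itv s; have [t0 t1] := clip01_itv t.
apply: le_trans (hC _ _ s0 s1 t0 t1) _; rewrite ler_wpM2l//.
by apply: powR_mono => //; exact: clip01_lip.
Qed.

Lemma holder_continuous a f C : 0 < a -> 0 <= C ->
  (forall s t : R, `|f t - f s| <= C * `|t - s| `^ a) -> continuous f.
Proof.
move=> a0 C0 hf x; apply/cvgrPdist_le => e e0.
pose d := (e / (C + 1)) `^ a^-1.
have C1 : 0 < C + 1 by lra.
have d0 : 0 < d by rewrite powR_gt0// divr_gt0.
near=> y; rewrite distrC; apply: le_trans (hf _ _) _.
have yd : `|y - x| <= d.
  by rewrite distrC; near: y; apply/nbhs_normP; exists d => //= y /= /ltW.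
apply: (@le_trans _ _ (C * (d `^ a))).
  by rewrite ler_wpM2l//; apply: powR_mono => //; exact: ltW.
rewrite /d -powRrM mulVf ?gt_eqF// powRr1 ?divr_ge0 ?ltW//.
by rewrite mulrA ltr_pdivrMr//; nra.
Unshelve. all: by end_near.
Qed.

Lemma holder_bounded a f : 0 <= a -> holder_on01 a f -> exists2 C : R, 0 <= C &
  forall s : R, 0 <= s -> s <= 1 -> `|f s| <= C.
Proof.
move=> a0 /holder_on01P[C C0 hC]; exists (`|f 0| + C); first by rewrite addr_ge0.
move=> s s0 s1; have := hC 0 s (lexx _) ler01 s0 s1.
rewrite subr0 => h.
have p1 : `|s| `^ a <= 1 by rewrite ger0_norm//; apply: powR_le1; rewrite ?s0.
have : C * `|s| `^ a <= C by rewrite ler_piMr.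
have -> : f s = f 0 + (f s - f 0) by ring.
move=> h2; apply: le_trans (ler_normD _ _) _; rewrite lerD2l; exact: le_trans h h2.
Qed.

End clipping.

(** * The forward integral of Hölder paths *)

Section forward_path.
Context {R : realType}.
Implicit Types (Z B I : R -> R).

(** At scale eps the approximation is a Young integral against the smoothed
    path [m t / eps] below, whose Hölder constant does not depend on eps:
    sewing bounds it uniformly in eps, although the local bound that starts the
    sewing degenerates with eps. *)
Lemma forward_approx_bound (g b : R) Z B : 0 < g -> 0 < b -> 1 < g + b ->
  holder_on01 g Z -> holder_on01 b B -> exists2 C : R, 0 <= C &
  forall eps : R, 0 < eps -> forall s t : R, 0 <= s -> s <= t -> t <= 1 ->
    let A t := eps^-1 * \int[lebesgue_measure]_(u in `[0, t])
                  (Z u * (B (Num.min (u + eps) 1) - B u)) in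
    `|A t - A s - Z s * (B t - B s)| <= C * (t - s) `^ (g + b) + C * eps `^ b.
Proof.
move=> g0 b0 gb1 hZ hB; have [c c0 sew] := continuous_sewing gb1.
have [MZ MZ0 bZ] := holder_bounded (ltW g0) hZ.
have [CZ CZ0 lZ] := holder_clip01 (ltW g0) hZ.
have [CB CB0 lB] := holder_clip01 (ltW b0) hB.
pose Zc := Z \o clip01; pose Bc := B \o clip01.
have cZ : continuous Zc by exact: (holder_continuous g0 CZ0 lZ).
have cB : continuous Bc by exact: (holder_continuous b0 CB0 lB).
exists (c * (CZ * CB) + 2 * MZ * CB).
  by rewrite addr_ge0// !mulr_ge0.
move=> eps e0 s t s0 st t1 /=.
pose A (t : R) := eps^-1 * \int[lebesgue_measure]_(u in `[0, t])
  (Z u * (B (Num.min (u + eps) 1) - B u)).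
rewrite -/(A t) -/(A s).
have cBe : continuous (fun u : R => Bc (u + eps)).
  move=> u; apply: (@continuous_comp _ _ _ (fun u : R => u + eps) Bc); last exact: cB.
  by apply: cvgD; [exact: cvg_id|exact: cvg_cst].
have [F1 [dF1 iF1]] := @primitive_exists _ (fun u : R => Zc u * (Bc (u + eps) - Bc u))
  (fun u => continuousM (cZ u) (continuousB (cBe u) (cB u))).
have [F2 [dF2 _]] := primitive_exists cB.
have dF2s (x u : R) : 0 <= x -> 0 <= u -> is_derive u 1 (fun u : R => F2 (x + u)) (Bc (x + u)).
  move=> x0 u0.
  have H : is_derive (x + u) 1 F2 (Bc (x + u)) by apply: dF2; rewrite addr_ge0.
  have K : is_derive u 1 (fun u : R => x + u) 1.
    have := is_deriveD (is_derive_cst x u 1) (is_derive_id u (1 : R)).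
    by rewrite add0r.
  by have := is_derive1_comp H K; rewrite mulr1.
pose m (u : R) := F2 (u + eps) - F2 u.
have dm (u : R) : 0 <= u -> is_derive u 1 m (Bc (u + eps) - Bc u).
  move=> u0; apply: is_deriveB; last exact: dF2.
  have -> : (fun u : R => F2 (u + eps)) = (fun u : R => F2 (eps + u)).
    by apply/funext => v; rewrite addrC.
  by rewrite addrC; apply: dF2s => //; exact: ltW.
have AE (u : R) : 0 <= u -> u <= 1 -> A u = eps^-1 * (F1 u - F1 0).
  move=> u0 u1; rewrite /A -iF1//; congr (_ * _).
  apply: eq_Rintegral => v; rewrite inE/= in_itv/= => /andP[v0 vu].
  have v1 : v <= 1 by exact: le_trans u1.
  rewrite /Zc /Bc /= !(clip01_id v0 v1).
  by congr (_ * (B _ - _)); rewrite /clip01 max_r// le_min ler01 addr_ge0// ltW.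
pose J (u v : R) := eps^-1 * (F1 v - F1 u - Zc u * (m v - m u)).
(* Of order 1 + g, but with a constant of order eps^(b - 1): this bound only
   starts the sewing and does not enter the result. *)
have J_loc (u v : R) : 0 <= u -> u <= v -> v <= 1 ->
    `|J u v| <= (eps^-1 * CZ * CB * eps `^ b) * (v - u) `^ (1 + g).
  move=> u0 uv v1.
  have dJ (x : R) : u <= x <= v -> is_derive x 1 (fun x : R => F1 x - Zc u * m x)
      ((Zc x - Zc u) * (Bc (x + eps) - Bc x)).
    move=> /andP[ux xv]; have x0 : 0 <= x by exact: le_trans ux.
    rewrite mulrBl; apply: is_deriveB; first exact: dF1.
    have := is_deriveM (is_derive_cst (Zc u) x (1 : R)) (dm x x0).
    by rewrite scaler0 addr0.
  have [x /andP[ux xv] E] := mean_value uv dJ.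
  have -> : J u v = eps^-1 * ((Zc x - Zc u) * (Bc (x + eps) - Bc x) * (v - u)).
    by rewrite /J -E; ring.
  rewrite !normrM (ger0_norm (_ : 0 <= eps^-1)) ?invr_ge0 ?(ltW e0)//.
  rewrite (ger0_norm (_ : 0 <= v - u)) ?subr_ge0//.
  rewrite -!mulrA ler_wpM2l ?invr_ge0 ?(ltW e0)//.
  rewrite powRD_ge0 ?ler01 ?(ltW g0)// powRr1 ?subr_ge0//.
  have h1 : `|Zc x - Zc u| <= CZ * (v - u) `^ g.
    apply: le_trans (lZ _ _) _; rewrite ler_wpM2l//.
    by apply: powR_mono => //; [exact: ltW|rewrite ger0_norm ?subr_ge0// lerD2r].
  have h2 : `|Bc (x + eps) - Bc x| <= CB * eps `^ b.
    by apply: le_trans (lB _ _) _; rewrite addrAC subrr add0r gtr0_norm.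
  have -> : CZ * (CB * (eps `^ b * ((v - u) * (v - u) `^ g))) =
    (CZ * (v - u) `^ g) * ((CB * eps `^ b) * (v - u)) by ring.
  apply: ler_pM => //; first by rewrite mulr_ge0// subr_ge0.
  by rewrite ler_wpM2r// subr_ge0.
(* m v - m u is the integral of B (v + x) - B (u + x) for x in [0, eps]: m / eps
   is as regular as B, uniformly in eps. *)
have m_bd (u v : R) : 0 <= u -> u <= v -> `|eps^-1 * (m v - m u)| <= CB * (v - u) `^ b.
  move=> u0 uv; have v0 : 0 <= v by exact: le_trans uv.
  have dd (x : R) : 0 <= x <= eps -> is_derive x 1 (fun x : R => F2 (v + x) - F2 (u + x))
      (Bc (v + x) - Bc (u + x)).
    by move=> /andP[x0 _]; apply: is_deriveB; exact: dF2s.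
  have [x /andP[x0 xe] E] := mean_value (ltW e0) dd.
  have -> : eps^-1 * (m v - m u) = Bc (v + x) - Bc (u + x).
    have -> : m v - m u = (Bc (v + x) - Bc (u + x)) * (eps - 0).
      by rewrite -E /m !addr0; ring.
    by rewrite subr0 mulrCA mulVf ?mulr1// gt_eqF.
  apply: le_trans (lB _ _) _; rewrite ler_wpM2l//.
  by rewrite (_ : v + x - (u + x) = v - u) ?ger0_norm ?subr_ge0//; ring.
have J_def (u v w : R) : 0 <= u -> u <= v -> v <= w -> w <= 1 ->
    `|J u w - J u v - J v w| <= CZ * CB * (w - u) `^ (g + b).
  move=> u0 uv vw w1; have v0 : 0 <= v by exact: le_trans uv.
  have -> : J u w - J u v - J v w = (Zc v - Zc u) * (eps^-1 * (m w - m v)).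
    by rewrite /J; ring.
  rewrite normrM powRD_ge0 ?(ltW g0) ?(ltW b0)//.
  have -> : CZ * CB * ((w - u) `^ g * (w - u) `^ b) =
    CZ * (w - u) `^ g * (CB * (w - u) `^ b) by ring.
  apply: ler_pM => //.
    apply: le_trans (lZ _ _) _; rewrite ler_wpM2l//.
    by apply: powR_mono => //; [exact: ltW|rewrite ger0_norm ?subr_ge0// lerD2r].
  apply: le_trans (m_bd _ _ v0 vw) _; rewrite ler_wpM2l//.
  by apply: powR_mono; [exact: ltW|rewrite subr_ge0|rewrite lerD2l lerN2].
have m_lim (u : R) : 0 <= u -> `|eps^-1 * m u - Bc u| <= CB * eps `^ b.
  move=> u0.
  have dd (x : R) : 0 <= x <= eps -> is_derive x 1 (fun x : R => F2 (u + x)) (Bc (u + x)).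
    by move=> /andP[x0 _]; exact: dF2s.
  have [x /andP[x0 xe] E] := mean_value (ltW e0) dd.
  have -> : eps^-1 * m u = Bc (u + x).
    have -> : m u = Bc (u + x) * (eps - 0) by rewrite -E /m !addr0.
    by rewrite subr0 mulrCA mulVf ?mulr1// gt_eqF.
  apply: le_trans (lB _ _) _; rewrite ler_wpM2l//.
  by apply: powR_mono => //; [exact: ltW|rewrite addrAC subrr add0r ger0_norm].
have g1 : 1 < 1 + g by rewrite ltrDl.
have := sew J (CZ * CB) _ (1 + g) g1 (mulr_ge0 CZ0 CB0) _ J_def J_loc s t s0 st t1.
rewrite !mulr_ge0 ?invr_ge0 ?(ltW e0) ?powR_ge0// => /(_ isT) hJ.
have t0 : 0 <= t by exact: le_trans st.
have s1 : s <= 1 by exact: le_trans t1.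
have -> : A t - A s - Z s * (B t - B s) =
  J s t + Z s * ((eps^-1 * m t - Bc t) - (eps^-1 * m s - Bc s)).
  by rewrite !AE// /J /Zc /Bc /= !clip01_id//; ring.
apply: le_trans (ler_normD _ _) _; apply: lerD.
  apply: le_trans hJ _; rewrite ler_wpM2r ?powR_ge0// lerDl !mulr_ge0//.
rewrite normrM; apply: (@le_trans _ _ (MZ * (2 * (CB * eps `^ b)))).
  apply: ler_pM => //; first exact: bZ.
  apply: le_trans (ler_normB _ _) _.
  have := m_lim _ t0; have := m_lim _ s0; lra.
rewrite [leRHS]mulrDl.
have -> : MZ * (2 * (CB * eps `^ b)) = 2 * MZ * CB * eps `^ b by ring.
by rewrite lerDr !mulr_ge0 ?powR_ge0.
Qed.

(** The bound on the approximations is uniform in eps and survives the limit: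
    a forward integral is known, up to an order larger than one, from its
    left-point germ. *)
Lemma forward_limit_increment (g b : R) Z B I (e : nat -> R) :
  0 < g -> 0 < b -> 1 < g + b -> holder_on01 g Z -> holder_on01 b B ->
  e k @[k --> \oo] --> 0^'+ ->
  (forall t : R, 0 <= t -> t <= 1 ->
    (e k)^-1 * \int[lebesgue_measure]_(u in `[0, t])
       (Z u * (B (Num.min (u + e k) 1) - B u)) @[k --> \oo] --> I t) ->
  exists2 C : R, 0 <= C & forall s t : R, 0 <= s -> s <= t -> t <= 1 ->
    `|I t - I s - Z s * (B t - B s)| <= C * (t - s) `^ (g + b).
Proof.
move=> g0 b0 gb1 hZ hB he hI.
have [C C0 hC] := forward_approx_bound g0 b0 gb1 hZ hB.
exists C => // s t s0 st t1; have t0 : 0 <= t by exact: le_trans st.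
have s1 : s <= 1 by exact: le_trans t1.
pose A k (t : R) := (e k)^-1 * \int[lebesgue_measure]_(u in `[0, t])
  (Z u * (B (Num.min (u + e k) 1) - B u)).
have lim1 : `|A k t - A k s - Z s * (B t - B s)| @[k --> \oo] -->
    `|I t - I s - Z s * (B t - B s)|.
  apply: cvg_norm; apply: cvgB; last exact: cvg_cst.
  by apply: cvgB; [exact: hI|exact: hI].
have lim2 : C * (t - s) `^ (g + b) + C * e k `^ b @[k --> \oo] -->
    C * (t - s) `^ (g + b) + C * 0.
  apply: cvgD; first exact: cvg_cst.
  by apply: cvgMr; exact: (cvg_comp _ _ he (powR_cvg0 b0)).
rewrite mulr0 addr0 in lim2.
apply: (ler_cvg_to lim1 lim2).
have ne : \forall k \near \oo, 0 < e k by exact: (he _ (nbhs_right_gt 0)).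
by near do apply: hC => //.
Unshelve. all: by end_near.
Qed.

(** The germ says nothing about the value at time 0, where the approximations
    vanish. *)
Lemma forward_limit0 Z B I (e : nat -> R) :
  ((e k)^-1 * \int[lebesgue_measure]_(u in `[0, 0])
       (Z u * (B (Num.min (u + e k) 1) - B u)) @[k --> \oo] --> I 0) ->
  I 0 = 0.
Proof.
move=> h; rewrite -(cvg_lim _ h)//.
under eq_fun do rewrite set_itv1 Rintegral_set1 mulr0.
exact: lim_cst.
Qed.

End forward_path.

(** * Orders of magnitude of increments *)

Section increments.
Context {R : realType}.
Implicit Types (F G : R -> R -> R) (f g : R -> R) (a b : R).

Definition incr_O F a := exists2 C : R, 0 <= C & forall s t : R,
  0 <= s -> s <= t -> t <= 1 -> `|F s t| <= C * (t - s) `^ a.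

Lemma incr_O_ext F G a : (forall s t : R, 0 <= s -> s <= t -> t <= 1 -> F s t = G s t) ->
  incr_O F a -> incr_O G a.
Proof.
by move=> FG [C C0 hC]; exists C => // s t s0 st t1; rewrite -FG//; exact: hC.
Qed.

Lemma incr_O_D F G a : incr_O F a -> incr_O G a ->
  incr_O (fun s t => F s t + G s t) a.
Proof.
move=> [C C0 hC] [K K0 hK]; exists (C + K); first exact: addr_ge0.
move=> s t s0 st t1; rewrite mulrDl; apply: le_trans (ler_normD _ _) _.
by apply: lerD; [exact: hC|exact: hK].
Qed.

Lemma incr_O_N F a : incr_O F a -> incr_O (fun s t => - F s t) a.
Proof. by move=> [C C0 hC]; exists C => // s t *; rewrite normrN; exact: hC. Qed.

Lemma incr_O_B F G a : incr_O F a -> incr_O G a ->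
  incr_O (fun s t => F s t - G s t) a.
Proof. by move=> hF /incr_O_N hG; exact: incr_O_D hF hG. Qed.

Lemma incr_O_M F G a b : 0 <= a -> 0 <= b -> incr_O F a -> incr_O G b ->
  incr_O (fun s t => F s t * G s t) (a + b).
Proof.
move=> a0 b0 [C C0 hC] [K K0 hK]; exists (C * K); first exact: mulr_ge0.
move=> s t s0 st t1; rewrite normrM powRD_ge0// mulrACA.
by apply: ler_pM => //; [exact: hC|exact: hK].
Qed.

Lemma incr_O_weak F a b : 0 <= b -> b <= a -> incr_O F a -> incr_O F b.
Proof.
move=> b0 ba [C C0 hC]; exists C => // s t s0 st t1.
apply: le_trans (hC s t s0 st t1) _; rewrite ler_wpM2l//.
by apply: powR_anti => //; lra.
Qed.

Lemma incr_O_bounded F C : (forall s t : R, 0 <= s -> s <= t -> t <= 1 -> `|F s t| <= C) ->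
  incr_O F 0.
Proof.
move=> h; exists C => [|s t s0 st t1]; first exact: le_trans (h 0 0 _ _ _).
by rewrite powRr0 mulr1; exact: h.
Qed.

Lemma incr_O_length : incr_O (fun s t => t - s) 1.
Proof.
by exists 1 => // s t s0 st t1; rewrite powRr1 ?subr_ge0// mul1r ger0_norm ?subr_ge0.
Qed.

Lemma incr_O_scale F G a : incr_O F 0 -> 0 <= a -> incr_O G a ->
  incr_O (fun s t => F s t * G s t) a.
Proof. by move=> hF a0 hG; rewrite -[a]add0r; exact: incr_O_M. Qed.

Lemma incr_O_holder f a : incr_O (fun s t => f t - f s) a <-> holder_on01 a f.
Proof.
split=> [[C C0 hC]|/holder_on01P[C C0 hC]]; exists C => //.
  move=> s t; rewrite !in_itv/= => /andP[s0 s1] /andP[t0 t1].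
  have [st|/ltW ts] := leP s t.
    by rewrite (ger0_norm (_ : 0 <= t - s)) ?subr_ge0//; exact: hC.
  rewrite distrC (distrC t) (ger0_norm (_ : 0 <= s - t)) ?subr_ge0//; exact: hC.
move=> s t s0 st t1; have := hC s t s0 (le_trans st t1) (le_trans s0 st) t1.
by rewrite (ger0_norm (_ : 0 <= t - s)) ?subr_ge0.
Qed.

Lemma holder_lip f g a M : 0 <= M -> (forall x y : R, `|g x - g y| <= M * `|x - y|) ->
  holder_on01 a f -> holder_on01 a (g \o f).
Proof.
move=> M0 hg /holder_on01P[C C0 hC]; exists (M * C) => s t.
rewrite !in_itv/= => /andP[s0 s1] /andP[t0 t1].
apply: le_trans (hg _ _) _; rewrite -mulrA ler_wpM2l//; exact: hC.
Qed.

Lemma holderM f g a : 0 <= a -> holder_on01 a f -> holder_on01 a g ->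
  holder_on01 a (fun s => f s * g s).
Proof.
move=> a0 hf hg; have [Cf Cf0 bf] := holder_bounded a0 hf.
have [Cg Cg0 bg] := holder_bounded a0 hg.
move: hf hg => /incr_O_holder hf /incr_O_holder hg; apply/incr_O_holder.
apply: (@incr_O_ext (fun s t => f t * (g t - g s) + g s * (f t - f s))).
  by move=> s t *; ring.
apply: incr_O_D.
- apply: (@incr_O_scale (fun s t => f t)) => //.
  by apply: (@incr_O_bounded _ Cf) => s t s0 st t1; apply: bf => //; exact: le_trans st.
- apply: (@incr_O_scale (fun s t => g s)) => //.
  by apply: (@incr_O_bounded _ Cg) => s t s0 st t1; apply: bg => //; exact: le_trans t1.
Qed.

Lemma holder_left_bounded f a : 0 <= a -> holder_on01 a f -> incr_O (fun s _ => f s) 0.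
Proof.
move=> a0 /(holder_bounded a0)[C C0 hC]; apply: (@incr_O_bounded _ C) => s t s0 st t1.
by apply: hC => //; exact: le_trans t1.
Qed.

(** Over a short interval the integral of a Hölder function is its left value
    times the length, up to one Hölder order more. *)
Lemma integral_increment f a : 0 < a -> holder_on01 a f ->
  incr_O (fun s t => \int[lebesgue_measure]_(u in `[0, t]) f u -
    \int[lebesgue_measure]_(u in `[0, s]) f u - f s * (t - s)) (1 + a).
Proof.
move=> a0 hf; have [C C0 lf] := holder_clip01 (ltW a0) hf.
have cf : continuous (f \o clip01) by exact: (holder_continuous a0 C0 lf).
have [F [dF iF]] := primitive_exists cf.
have E (t : R) : 0 <= t -> t <= 1 ->
    \int[lebesgue_measure]_(u in `[0, t]) f u = F t - F 0.
  move=> t0 t1; rewrite -iF//; apply: eq_Rintegral => u.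
  rewrite inE/= in_itv/= => /andP[u0 ut]; rewrite /= clip01_id//; exact: le_trans t1.
exists C => // s t s0 st t1; have t0 := le_trans s0 st; have s1 := le_trans st t1.
rewrite !E//; have [x /andP[sx xt] Ex] : exists2 x : R, s <= x <= t &
    F t - F s = (f \o clip01) x * (t - s).
  by apply: mean_value => // x /andP[sx _]; apply: dF; exact: le_trans sx.
have -> : F t - F 0 - (F s - F 0) - f s * (t - s) =
    (t - s) * (f (clip01 x) - f (clip01 s)).
  by rewrite (clip01_id s0 s1); transitivity (F t - F s - f s * (t - s)); [ring|rewrite Ex /=; ring].
rewrite normrM (powRD_ge0 _ ler01 (ltW a0)) powRr1 ?subr_ge0// mulrCA.
rewrite (ger0_norm (_ : 0 <= t - s)) ?subr_ge0// ler_wpM2l ?subr_ge0//.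
apply: le_trans (lf _ _) _; rewrite ler_wpM2l//; apply: powR_mono => //.
  exact: ltW.
by rewrite ger0_norm ?subr_ge0// lerD2r.
Qed.

End increments.

(** * Taylor estimates *)

Section taylor.
Context {R : realType}.
Implicit Types (f : R -> R) (M : R).

Definition lip (M : R) (f : R -> R) := forall x y : R, `|f x - f y| <= M * `|x - y|.

Lemma lip_ge0 (M : R) f : lip M f -> 0 <= M.
Proof. by move=> /(_ 1 0); rewrite subr0 normr1 mulr1; exact: le_trans. Qed.

Lemma mean_value_abs f (f1 : R -> R) (x y : R) : (forall z : R, is_derive z 1 f (f1 z)) ->
  exists2 z : R, `|z - x| <= `|y - x| & f y - f x = f1 z * (y - x).
Proof.
move=> df; have [xy|xy] := leP x y.
  have [z /andP[xz zy] E] := mean_value xy (fun z _ => df z); exists z => //.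
  by rewrite !ger0_norm ?subr_ge0// lerD2r.
have [z /andP[xz zy] E] := mean_value (ltW xy) (fun z _ => df z); exists z.
  by rewrite !ler0_norm ?subr_le0 ?(ltW xy)// lerN2 lerD2r.
by rewrite -opprB E -mulrN opprB.
Qed.

Lemma lip_of_bounded f (f1 : R -> R) M : (forall z : R, is_derive z 1 f (f1 z)) ->
  (forall z, `|f1 z| <= M) -> lip M f.
Proof.
move=> df hM x y; have [z _ ->] := mean_value_abs y x df.
by rewrite normrM ler_wpM2r.
Qed.

Lemma is_derive_addr f (f1 : R -> R) (c : R) : (forall z : R, is_derive z 1 f (f1 z)) ->
  forall z : R, is_derive z 1 (fun z : R => f (z + c)) (f1 (z + c)).
Proof.
move=> df z; have K : is_derive z 1 (fun u : R => u + c) 1.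
  have := is_deriveD (is_derive_id z (1 : R)) (is_derive_cst c z 1).
  by rewrite addr0.
by have := @is_derive1_comp _ f (fun u : R => u + c) z _ _ (df (z + c)) K; rewrite mulr1.
Qed.

Lemma taylor1 f (f1 : R -> R) M : (forall z : R, is_derive z 1 f (f1 z)) -> lip M f1 ->
  forall x d : R, `|f (x + d) - f x - f1 x * d| <= M * d ^+ 2.
Proof.
move=> df lf1 x d; have [z] := mean_value_abs x (x + d) df.
rewrite addrAC subrr add0r => zd ->; rewrite -mulrBl normrM.
have M0 := lip_ge0 lf1.
rewrite -real_normK ?num_real// expr2 mulrA ler_wpM2r//.
by apply: le_trans (lf1 _ _) _; rewrite ler_wpM2l.
Qed.

(** The increment f (x + d) - f x is Lipschitz in d, and in x with a constant
    proportional to d. *)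
Lemma increment_lip f (f1 : R -> R) M : (forall z : R, is_derive z 1 f (f1 z)) ->
  lip M f -> lip M f1 -> forall x d x' d' : R,
  `|(f (x' + d') - f x') - (f (x + d) - f x)| <= M * `|d' - d| + M * `|d| * `|x' - x|.
Proof.
move=> df lf lf1 x d x' d'.
have -> : (f (x' + d') - f x') - (f (x + d) - f x) =
  (f (x' + d') - f (x' + d)) + ((f (x' + d) - f x') - (f (x + d) - f x)) by ring.
apply: le_trans (ler_normD _ _) _; apply: lerD.
  apply: le_trans (lf _ _) _; by rewrite (_ : x' + d' - (x' + d) = d' - d)//; ring.
have dg (z : R) : is_derive z 1 (fun z : R => f (z + d) - f z) (f1 (z + d) - f1 z).
  exact: (is_deriveB (is_derive_addr d df z) (df z)).
have [z _ ->] := mean_value_abs x x' dg.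
rewrite normrM ler_wpM2r//; apply: le_trans (lf1 _ _) _.
by rewrite addrAC subrr add0r.
Qed.

(** The remainder q vanishes to second order at d = 0: a variation of d costs a
    factor |d|, and a variation of the base point a factor d^2, since q (., d) is
    differentiable with derivative the Taylor remainder of f1. *)
Lemma remainder_lip f (f1 f2 : R -> R) M : (forall z : R, is_derive z 1 f (f1 z)) ->
  (forall z : R, is_derive z 1 f1 (f2 z)) -> lip M f1 -> lip M f2 ->
  let q (x d : R) := f (x + d) - f x - f1 x * d in
  forall x d x' d' : R,
  `|q x' d' - q x d| <= 2 * M * (`|d| + `|d'|) * `|d' - d| + M * d ^+ 2 * `|x' - x|.
Proof.
move=> df df1 lf1 lf2 q x d x' d'.
have M0 := lip_ge0 lf1.
have -> : q x' d' - q x d = (q x' d' - q x' d) + (q x' d - q x d) by ring.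
apply: le_trans (ler_normD _ _) _; apply: lerD.
  have [z] := mean_value_abs (x' + d) (x' + d') df.
  have -> : x' + d' - (x' + d) = d' - d by ring.
  move=> hz E; have -> : q x' d' - q x' d = (f1 z - f1 x') * (d' - d).
    by rewrite /q mulrBl -E; ring.
  rewrite normrM ler_wpM2r//; apply: le_trans (lf1 _ _) _.
  rewrite mulrAC mulrC ler_wpM2r//.
  have -> : z - x' = (z - (x' + d)) + d by ring.
  apply: le_trans (ler_normD _ _) _.
  have := ler_normB d' d; have := normr_ge0 d'; lra.
have dg (z : R) : is_derive z 1 (fun z : R => q z d) (f1 (z + d) - f1 z - f2 z * d).
  apply: is_deriveB; first exact: (is_deriveB (is_derive_addr d df z) (df z)).
  have := is_deriveM (df1 z) (is_derive_cst d z 1).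
  by rewrite scaler0 add0r [f2 z * d]mulrC.
have [z _ ->] := mean_value_abs x x' dg.
by rewrite normrM ler_wpM2r//; exact: taylor1 df1 lf2 _ _.
Qed.

End taylor.

(** * Local expansion of the solution *)

Section expansion.
Context {R : realType}.
Variables (sg sg1 b : R -> R) (M x0 : R) (B X I : R -> R) (al be : R).
Hypothesis (dsg : forall z : R, is_derive z 1 sg (sg1 z)).
Hypotheses (lsg : lip M sg) (lsg1 : lip M sg1) (lb : lip M b).
Hypotheses (be0 : 1 / 2 < be) (be1 : be < 1) (al0 : 0 < al) (albe : 1 < al + be).
Hypotheses (hB : holder_on01 be B) (hX : holder_on01 al X).
Hypothesis hI : forall g : R, 0 < g -> 1 < g + be -> holder_on01 g (sg \o X) ->
  incr_O (fun s t => I t - I s - sg (X s) * (B t - B s)) (g + be).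
Hypothesis XE : forall t : R, 0 <= t -> t <= 1 ->
  X t = x0 + I t + \int[lebesgue_measure]_(u in `[0, t]) b (X u).

Let be_gt0 : 0 < be. Proof. by have := be0; lra. Qed.
Let be_ge0 : 0 <= be. Proof. exact: ltW. Qed.
Ltac exponents := have := be0; have := be1; have := al0; have := albe; lra.

Let M0 : 0 <= M. Proof. exact: lip_ge0 lsg. Qed.

Let XtE (s t : R) : 0 <= s -> s <= t -> t <= 1 -> X t - X s =
  (I t - I s) + (\int[lebesgue_measure]_(u in `[0, t]) b (X u) -
                 \int[lebesgue_measure]_(u in `[0, s]) b (X u)).
Proof.
move=> s0 st t1; rewrite !XE ?(le_trans s0 st) ?(le_trans st t1)//; ring.
Qed.

(** The solution inherits the regularity of the driving path: its increments
    are dominated by those of B. *)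
Lemma solution_holder : holder_on01 be X.
Proof.
apply/incr_O_holder.
have hsX : holder_on01 al (sg \o X) by exact: (holder_lip M0 lsg hX).
have hbX : holder_on01 al (b \o X) by exact: (holder_lip M0 lb hX).
apply: (incr_O_ext (F := fun s t =>
  (I t - I s - sg (X s) * (B t - B s)) + sg (X s) * (B t - B s) +
  ((\int[lebesgue_measure]_(u in `[0, t]) b (X u) -
    \int[lebesgue_measure]_(u in `[0, s]) b (X u) - b (X s) * (t - s)) +
   b (X s) * (t - s)))).
  by move=> s t s0 st t1; rewrite XtE//; ring.
apply: incr_O_D; apply: incr_O_D.
- by apply: incr_O_weak (hI al0 albe hsX); exponents.
- apply: (@incr_O_scale _ (fun s _ => sg (X s))) => //; last exact/incr_O_holder.
  exact: (holder_left_bounded (ltW al0) hsX).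
- by apply: incr_O_weak (integral_increment al0 hbX); exponents.
- apply: (@incr_O_scale _ (fun s _ => b (X s))) => //.
    exact: (holder_left_bounded (ltW al0) hbX).
  by apply: incr_O_weak (incr_O_length); exponents.
Qed.

Let hX' := solution_holder.

Let hsX : holder_on01 be (sg \o X). Proof. exact: (holder_lip M0 lsg hX'). Qed.
Let hs1X : holder_on01 be (sg1 \o X). Proof. exact: (holder_lip M0 lsg1 hX'). Qed.
Let hbX : holder_on01 be (b \o X). Proof. exact: (holder_lip M0 lb hX'). Qed.
Let hssX : holder_on01 be (fun s => sg (X s) * sg1 (X s)).
Proof. exact: holderM hsX hs1X. Qed.

Let I_2be : incr_O (fun s t => I t - I s - sg (X s) * (B t - B s)) (be + be).
Proof. apply: hI hsX => //; exponents. Qed.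

Let drift_1be : incr_O (fun s t => \int[lebesgue_measure]_(u in `[0, t]) b (X u) -
    \int[lebesgue_measure]_(u in `[0, s]) b (X u) - b (X s) * (t - s)) (1 + be).
Proof. exact: (integral_increment be_gt0 hbX). Qed.

Let X_1 : incr_O (fun s t => X t - X s - sg (X s) * (B t - B s)) 1.
Proof.
apply: (incr_O_ext (F := fun s t =>
  (I t - I s - sg (X s) * (B t - B s)) +
  ((\int[lebesgue_measure]_(u in `[0, t]) b (X u) -
    \int[lebesgue_measure]_(u in `[0, s]) b (X u) - b (X s) * (t - s)) +
   b (X s) * (t - s)))).
  by move=> s t s0 st t1; rewrite XtE//; ring.
apply: incr_O_D; first by apply: incr_O_weak I_2be => //; exponents.
apply: incr_O_D; first by apply: incr_O_weak drift_1be => //; exponents.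
apply: (@incr_O_scale _ (fun s _ => b (X s))) => //; last exact: incr_O_length.
exact: (holder_left_bounded be_ge0 hbX).
Qed.

Let sg_1 : incr_O (fun s t => sg (X t) - sg (X s) - sg (X s) * sg1 (X s) * (B t - B s)) 1.
Proof.
apply: (incr_O_ext (F := fun s t =>
  (sg (X t) - sg (X s) - sg1 (X s) * (X t - X s)) +
  sg1 (X s) * (X t - X s - sg (X s) * (B t - B s)))).
  by move=> s t *; ring.
apply: incr_O_D; last first.
  apply: (@incr_O_scale _ (fun s _ => sg1 (X s))) => //.
  exact: (holder_left_bounded be_ge0 hs1X).
apply: (@incr_O_weak _ _ (be + be)); [exponents|exponents|].
have hX2 := hX'; move/incr_O_holder: hX2 => [C C0 hC].
exists (M * C ^+ 2); first by rewrite mulr_ge0// sqr_ge0.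
move=> s t s0 st t1; have := taylor1 dsg lsg1 (X s) (X t - X s).
rewrite subrKC => /le_trans; apply; rewrite -mulrA ler_wpM2l//.
rewrite -real_normK ?num_real// powRD_ge0// -expr2 -exprMn.
by rewrite lerXn2r ?nnegrE ?mulr_ge0 ?powR_ge0//; exact: hC.
Qed.

(** Sewing applied to the second-order germ: its defect has order
    min (1 + be, 3 be) = 1 + be. *)
Let I_1be : incr_O (fun s t => I t - I s - sg (X s) * (B t - B s)
   - 2^-1 * (sg (X s) * sg1 (X s)) * (B t - B s) ^+ 2) (1 + be).
Proof.
have th1 : 1 < 1 + be by rewrite ltrDl.
have [c c0 sew] := continuous_sewing th1.
have loc : incr_O (fun s t => I t - I s - sg (X s) * (B t - B s)
   - 2^-1 * (sg (X s) * sg1 (X s)) * (B t - B s) ^+ 2) (be + be).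
  apply: incr_O_B => //.
  apply: (@incr_O_scale _ (fun s _ => 2^-1 * (sg (X s) * sg1 (X s)))); [|exponents|].
    apply: (@incr_O_scale _ (fun _ _ => 2^-1)) => //.
      by apply: (@incr_O_bounded _ _ 2^-1) => s t *; rewrite ger0_norm.
    exact: (holder_left_bounded be_ge0 hssX).
  apply: (incr_O_ext (F := fun s t => (B t - B s) * (B t - B s))).
    by move=> s t *; rewrite expr2.
  by apply: incr_O_M => //; exact/incr_O_holder.
move: loc => [C1 C10 loc].
move: sg_1 hB hssX => [C2 C20 hC2] /incr_O_holder[C3 C30 hC3] /incr_O_holder[C4 C40 hC4].
exists (c * (C2 * C3 + C4 * C3 ^+ 2)).
  by rewrite mulr_ge0// addr_ge0// mulr_ge0// sqr_ge0.
(* The germ is only of order 2 be, which suffices for sewing as 2 be > 1. *)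
apply: (sew _ _ _ _ _ _ C10 _ loc); first exponents.
  by rewrite addr_ge0// mulr_ge0// sqr_ge0.
move=> s u t s0 su ut t1; have u0 := le_trans s0 su; have u1 := le_trans ut t1.
set a := fun s => sg (X s) * sg1 (X s).
have -> : I t - I s - sg (X s) * (B t - B s) - 2^-1 * a s * (B t - B s) ^+ 2 -
  (I u - I s - sg (X s) * (B u - B s) - 2^-1 * a s * (B u - B s) ^+ 2) -
  (I t - I u - sg (X u) * (B t - B u) - 2^-1 * a u * (B t - B u) ^+ 2) =
  (sg (X u) - sg (X s) - a s * (B u - B s)) * (B t - B u) +
  2^-1 * (a u - a s) * (B t - B u) ^+ 2 by field.
have us : u - s <= t - s by rewrite lerD2r.
have tu : t - u <= t - s by rewrite lerD2l lerN2.
have us0 : 0 <= u - s by rewrite subr_ge0.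
have tu0 : 0 <= t - u by rewrite subr_ge0.
have h3 : `|B t - B u| <= C3 * (t - s) `^ be.
  by apply: le_trans (hC3 _ _ u0 ut t1) _; rewrite ler_wpM2l//; exact: powR_mono.
apply: le_trans (ler_normD _ _) _; rewrite [leRHS]mulrDl; apply: lerD.
  rewrite normrM powRD_ge0// mulrACA; apply: ler_pM => //.
  by apply: le_trans (hC2 _ _ s0 su u1) _; rewrite ler_wpM2l//; exact: powR_mono.
rewrite normrM normrX; apply: (@le_trans _ _ (C4 * C3 ^+ 2 * (t - s) `^ (be + (be + be)))).
  rewrite powRD_ge0//; last by rewrite addr_ge0.
  rewrite mulrACA; apply: ler_pM => //.
    apply: (@le_trans _ _ `|a u - a s|).
      by rewrite normrM ler_piMl// ger0_norm// invf_le1// ler1n.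
    by apply: le_trans (hC4 _ _ s0 su u1) _; rewrite ler_wpM2l//; exact: powR_mono.
  rewrite powRD_ge0// -expr2 -exprMn.
  by rewrite lerXn2r ?nnegrE ?mulr_ge0 ?powR_ge0.
rewrite ler_wpM2l ?mulr_ge0 ?sqr_ge0//; apply: powR_anti; exponents.
Qed.

(** The last term of this expansion is the one that an Euler step misses: it is
    the source of the leading error. *)
Lemma solution_expansion : incr_O (fun s t => X t - X s - sg (X s) * (B t - B s)
  - b (X s) * (t - s) - 2^-1 * (sg (X s) * sg1 (X s)) * (B t - B s) ^+ 2) (1 + be).
Proof.
apply: (incr_O_ext (F := fun s t =>
  (I t - I s - sg (X s) * (B t - B s)
   - 2^-1 * (sg (X s) * sg1 (X s)) * (B t - B s) ^+ 2) +
  (\int[lebesgue_measure]_(u in `[0, t]) b (X u) -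
    \int[lebesgue_measure]_(u in `[0, s]) b (X u) - b (X s) * (t - s)))).
  by move=> s t s0 st t1; rewrite XtE//; ring.
exact: incr_O_D.
Qed.

End expansion.

(** * A discrete Young-Gronwall estimate *)

Section young_gronwall.
Context {R : realType}.

(** A linear-growth recursion driven by a Hölder path, sampled with step 1/n
    and started from 0. [S k] stands for the increment of the diffusion
    coefficient caused by the error [d k]. *)
Record perturbed_recursion (Q be : R) (n : nat) (eta : R) (d B S : nat -> R)
    : Prop := PerturbedRecursion {
  pr_start : d 0%N = 0 ;
  pr_path : forall j k, (j <= k)%N -> (k <= n)%N ->
    `|B k - B j| <= Q * ((k - j)%:R / n%:R) `^ be ;
  pr_coef : forall j k, (j <= k)%N -> (k <= n)%N ->
    `|S k - S j| <= Q * `|d k - d j| + Q * `|d j| * ((k - j)%:R / n%:R) `^ be ;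
  pr_growth : forall k, (k <= n)%N -> `|S k| <= Q * `|d k| ;
  pr_step : forall k, (k < n)%N ->
    `|d k.+1 - d k - S k * (B k.+1 - B k)| <= Q / n%:R * (`|d k| + eta) }.

Variables (Q be : R).
Hypotheses (Q1 : 1 <= Q) (be0 : 1 / 2 < be) (be1 : be < 1).

Let Q0 : 0 < Q. Proof. by have := Q1; lra. Qed.
Let be_gt0 : 0 < be. Proof. by have := be0; lra. Qed.
Let be_ge0 : 0 <= be. Proof. exact: ltW. Qed.
Let th1 : 1 < be + be. Proof. by have := be0; lra. Qed.

(** On a block of fixed length tau the Hölder seminorm N of the error appears
    on both sides of the sewing estimate, on the right with a factor tau^be:
    for tau small this closes by induction on the length of the block. *)
Lemma block_estimate : exists tau K : R, [/\ 0 < tau, tau <= 1, 0 <= K &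
  forall n (eta : R) (d B S : nat -> R), (0 < n)%N -> 0 <= eta -> perturbed_recursion Q be n eta d B S ->
  forall a k, (a <= k)%N -> (k <= n)%N -> (k - a)%:R / n%:R <= tau ->
  forall j i, (a <= j)%N -> (j <= i)%N -> (i <= k)%N ->
    `|d i - d j| <= K * (`|d a| + eta) * ((i - j)%:R / n%:R) `^ be].
Proof.
have [c c0 sew] := discrete_sewing th1.
pose P := Q ^+ 2 + Q; pose cc := c * Q ^+ 2; pose W := P + 2 * cc.
have Q2 : 1 <= Q ^+ 2 by rewrite exprn_ege1.
have cc0 : 0 <= cc by rewrite mulr_ge0// sqr_ge0.
have PQ : Q <= P by have := Q2; rewrite /P; lra.
have W2 : 2 <= W by have := Q2; have := Q1; rewrite /W /P; lra.
have W0 : 0 < W by lra.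
pose io := (2 * W)^-1.
have io0 : 0 < io by rewrite invr_gt0; lra.
have io1 : io <= 1 by rewrite invf_le1; lra.
have Wio : W * io = 1 / 2 by rewrite /io; field; lra.
pose tau := io `^ be^-1.
have tau0 : 0 < tau by rewrite powR_gt0.
have tau1 : tau <= 1 by apply: powR_le1; rewrite ?io1 ?ltW// invr_gt0.
have tauio : tau `^ be = io.
  by rewrite /tau -powRrM mulVf ?gt_eqF// powRr1// ltW.
exists tau, (2 * W); split=> //; first lra.
move=> n eta d B S n0 eta0 [d00 dB dS gS st] a k ak kn hk.
have nR : 0 < n%:R :> R by rewrite ltr0n.
have nR0 : 0 <= n%:R^-1 :> R by rewrite invr_ge0 ltW.
set N := 2 * W * (`|d a| + eta).
have D0 := normr_ge0 (d a).
have N0 : 0 <= N by rewrite mulr_ge0 ?addr_ge0//; lra.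
elim: k ak kn hk => [|k IH] ak kn hk j i aj ji ik.
  have -> : i = j by clear -ji ik; lia.
  by rewrite subrr normr0 mulr_ge0// powR_ge0.
have [ak'|ka] := leqP a k; last first.
  have -> : i = j by clear -ji ik ka aj; lia.
  by rewrite subrr normr0 mulr_ge0// powR_ge0.
have kn' : (k <= n)%N by exact: ltnW.
have hk' : (k - a)%:R / n%:R <= tau.
  apply: le_trans hk; rewrite ler_wpM2r// ler_nat leq_sub2r//.
have {}IH := IH ak' kn' hk'.
have [|ki] := leqP i k; first exact: IH.
have {ki ik}ikE : i = k.+1 by clear -ik ki; lia.
have [->|jk] := eqVneq j k.+1.
  by rewrite ikE subrr normr0 mulr_ge0// powR_ge0.
have {}jk : (j <= k)%N by clear -jk ji ikE; lia.
rewrite ikE {ji i ikE}.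
have dm u : (a <= u)%N -> (u <= k)%N -> `|d u| <= `|d a| + N * io.
  move=> au uk; have -> : d u = d a + (d u - d a) by ring.
  apply: le_trans (ler_normD _ _) _; rewrite lerD2l.
  apply: le_trans (IH a u (leqnn _) au uk) _; rewrite ler_wpM2l// -tauio.
  apply: powR_mono => //.
  by apply: le_trans hk'; rewrite ler_wpM2r// ler_nat leq_sub2r.
pose m : R := `|d a| + N * io; rewrite -/m in dm.
have m0 : 0 <= m by rewrite addr_ge0// mulr_ge0// ltW.
have mE : m = `|d a| + N * io by [].
clearbody m.
set T := (k.+1 - j)%:R / n%:R.
have T0 : 0 <= T by rewrite mulr_ge0.
have Ttau : T <= tau by apply: le_trans hk; rewrite ler_wpM2r// ler_nat leq_sub2l.
have T1 : T <= 1 by exact: le_trans tau1.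
have hstep (u : nat) : (j <= u)%N -> (u < k.+1)%N ->
    `|d u.+1 - d u - S u * (B u.+1 - B u)| <= Q * (m + eta) / n%:R.
  move=> ju uk; have := st u (leq_trans uk kn); move/le_trans; apply.
  rewrite mulrAC ler_wpM2r// ler_wpM2l ?(ltW Q0)// lerD2r; apply: dm => //.
  exact: leq_trans ju.
have hdef (u v w : nat) : (j <= u)%N -> (u <= v)%N -> (v <= w)%N -> (w <= k.+1)%N ->
    `|(d w - d u - S u * (B w - B u)) - (d v - d u - S u * (B v - B u)) -
      (d w - d v - S v * (B w - B v))| <=
    (Q ^+ 2 * (N + m)) * ((w - u)%:R * n%:R^-1) `^ (be + be).
  move=> ju uv vw wk.
  have -> : (d w - d u - S u * (B w - B u)) - (d v - d u - S u * (B v - B u)) -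
      (d w - d v - S v * (B w - B v)) = (S v - S u) * (B w - B v) by ring.
  have [vk|kv] := leqP v k; last first.
    have -> : w = v by clear -vw wk kv; lia.
    rewrite subrr mulr0 normr0; apply: mulr_ge0; last exact: powR_ge0.
    by apply: mulr_ge0; [exact: sqr_ge0|exact: addr_ge0].
  have au := leq_trans aj ju; have uk := leq_trans uv vk.
  have le1 : (v - u <= w - u)%N by rewrite leq_sub2r.
  have le2 : (w - v <= w - u)%N by rewrite leq_sub2l.
  have p1 : ((v - u)%:R / n%:R) `^ be <= ((w - u)%:R / n%:R) `^ be.
    by apply: powR_mono => //; rewrite ler_wpM2r// ler_nat.
  have p2 : ((w - v)%:R / n%:R) `^ be <= ((w - u)%:R / n%:R) `^ be.
    by apply: powR_mono => //; rewrite ler_wpM2r// ler_nat.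
  rewrite normrM powRD_ge0//.
  set p := ((w - u)%:R / n%:R) `^ be in p1 p2 *.
  have -> : Q ^+ 2 * (N + m) * (p * p) = (Q * (N + m) * p) * (Q * p) by ring.
  apply: ler_pM => //; last first.
    by apply: le_trans (dB v w vw (leq_trans wk kn)) _; rewrite ler_wpM2l// ltW.
  apply: le_trans (dS u v uv (leq_trans vk kn')) _.
  have h1 := IH u v au uv vk; have h2 := dm u au uk.
  have -> : Q * (N + m) * p = Q * (N * p) + Q * m * p by ring.
  apply: lerD.
    rewrite ler_wpM2l ?(ltW Q0)//; apply: le_trans h1 _; by rewrite ler_wpM2l.
  apply: ler_pM; rewrite ?powR_ge0// ?mulr_ge0 ?(ltW Q0)//.
  by rewrite ler_wpM2l// ltW.
have := sew (fun u w => d w - d u - S u * (B w - B u)) _ n%:R^-1 _ j k.+1 _ nR0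
  hdef hstep j k.+1 (leqnn _) (leqW jk) (leqnn _).
have QNm : 0 <= Q ^+ 2 * (N + m) by rewrite mulr_ge0 ?sqr_ge0// addr_ge0.
move=> /(_ QNm) hg.
have {}hg : `|d k.+1 - d j - S j * (B k.+1 - B j)| <=
    cc * (N + m) * (io * T `^ be) + Q * (m + eta) * T `^ be.
  apply: le_trans hg _; apply: lerD.
    have -> : cc * (N + m) * (io * T `^ be) = c * (Q ^+ 2 * (N + m)) * (io * T `^ be).
      by rewrite /cc; ring.
    rewrite ler_wpM2l//; first exact: mulr_ge0.
    by rewrite -/T powRD_ge0// ler_wpM2r ?powR_ge0// -tauio; exact: powR_mono.
  have -> : (k.+1 - j)%:R * (Q * (m + eta) / n%:R) = Q * (m + eta) * T.
    by rewrite /T; ring.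
  rewrite ler_wpM2l//; first by apply: mulr_ge0; [exact: ltW|exact: addr_ge0].
  by rewrite -[leLHS]powRr1//; apply: powR_anti; [rewrite T0 T1|exact: be_ge0|exact: ltW be1].
have hS : `|S j * (B k.+1 - B j)| <= Q * m * (Q * T `^ be).
  rewrite normrM; apply: ler_pM => //.
    apply: le_trans (gS j (leq_trans jk kn')) _.
    by rewrite ler_wpM2l ?(ltW Q0)//; exact: dm.
  by apply: dB => //; exact: leqW.
have -> : d k.+1 - d j = (d k.+1 - d j - S j * (B k.+1 - B j)) + S j * (B k.+1 - B j).
  by rewrite subrK.
apply: le_trans (ler_normD _ _) _; apply: le_trans (lerD hg hS) _.
have -> : cc * (N + m) * (io * T `^ be) + Q * (m + eta) * T `^ be + Q * m * (Q * T `^ be) =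
  (P * m + Q * eta + cc * (N + m) * io) * T `^ be by rewrite /P; ring.
rewrite ler_wpM2r ?powR_ge0//.
(* The factor io = tau^be = 1 / (2 W) makes the terms with N add up to half of
   N; the other half is W (|d a| + eta). *)
have e1 : cc * (m * io) <= cc * m by rewrite ler_wpM2l// ler_piMr.
have e2 : (P + cc) * m = (P + cc) * `|d a| + (P + cc) * (N * io) by rewrite mE mulrDr.
have e3 : (P + 2 * cc) * (N * io) = N / 2 by rewrite -/W mulrCA Wio; field.
have e4 : Q * eta <= W * eta by rewrite ler_wpM2r// /W; have := cc0; lra.
have e5 : (P + cc) * `|d a| <= W * `|d a| by rewrite ler_wpM2r// /W; have := cc0; lra.
have e6 : N = 2 * (W * `|d a| + W * eta) by rewrite /N; ring.
lra.
Qed.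

(** Only finitely many blocks, independently of n, are needed to cover [0, 1]. *)
Lemma young_gronwall : exists2 C : R, 0 <= C &
  forall n (eta : R) (d B S : nat -> R), (0 < n)%N -> 0 <= eta -> perturbed_recursion Q be n eta d B S ->
  forall j k, (j <= k)%N -> (k <= n)%N ->
    `|d k - d j| <= C * eta * ((k - j)%:R / n%:R) `^ be.
Proof.
have [tau [K [tau0 tau1 K0 block]]] := block_estimate.
have sup (p : nat) : exists2 C : R, 0 <= C &
    forall n (eta : R) (d B S : nat -> R), (0 < n)%N -> 0 <= eta -> perturbed_recursion Q be n eta d B S ->
    forall k, (k <= n)%N -> k%:R / n%:R <= p%:R * tau -> `|d k| <= C * eta.
  elim: p => [|p [C C0 IH]].
    exists 0 => // n eta d B S n0 eta0 [d00 _ _ _ _] k kn.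
    rewrite mul0r mul0r pmulr_lle0 ?invr_gt0 ?ltr0n// lern0 => /eqP ->.
    by rewrite d00 normr0.
  (* The next block starts one step after the last time a reached by the
     induction hypothesis, as a block starting at a could be too long; that step
     is bounded by hand, with constant C1. *)
  pose C1 := (1 + Q ^+ 2 + Q) * C + Q.
  have C10 : 0 <= C1.
    by rewrite addr_ge0 ?(ltW Q0)// mulr_ge0// !addr_ge0 ?sqr_ge0 ?(ltW Q0).
  exists (C + C1 + K * (C1 + 1)).
    by have : 0 <= K * (C1 + 1); [apply: mulr_ge0 => //; lra|lra].
  move=> n eta d B S n0 eta0 pr k kn hk.
  have nR : 0 < n%:R :> R by rewrite ltr0n.
  have nR0 : 0 <= n%:R^-1 :> R by rewrite invr_ge0 ltW.
  have C1e : 0 <= C1 * eta by rewrite mulr_ge0.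
  have Ke : 0 <= K * (C1 + 1) * eta by rewrite !mulr_ge0// addr_ge0.
  have [le1|gt1] := leP (k%:R / n%:R) (p%:R * tau).
    apply: le_trans (IH n eta d B S n0 eta0 pr k kn le1) _.
    lra.
  pose a := Num.truncn (p%:R * tau * n%:R).
  have ptn : 0 <= p%:R * tau * n%:R by rewrite !mulr_ge0// ltW.
  have /andP[al au] := truncn_itv ptn; rewrite -/a in al au.
  have ak : (a < k)%N.
    by rewrite -(ltr_nat R); apply: le_lt_trans al _; rewrite -ltr_pdivlMr.
  have an : (a < n)%N by exact: leq_trans ak kn.
  have da : `|d a| <= C * eta.
    apply: (IH n eta d B S n0 eta0 pr) => //; first exact: ltnW.
    by rewrite ler_pdivrMr.
  have da1 : `|d a.+1| <= C1 * eta.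
    have -> : d a.+1 = d a + S a * (B a.+1 - B a) +
       (d a.+1 - d a - S a * (B a.+1 - B a)) by ring.
    have h1 := pr_step pr an.
    have h2 : `|S a * (B a.+1 - B a)| <= Q * `|d a| * Q.
      rewrite normrM; apply: ler_pM => //; first exact: (pr_growth pr (ltnW an)).
      apply: le_trans (pr_path pr (leqnSn a) an) _.
      rewrite ler_piMr ?(ltW Q0)//; apply: powR_le1 => //.
      by rewrite subSnn mul1r nR0/= invf_le1// ler1n.
    have h3 : Q / n%:R * (`|d a| + eta) <= Q * (`|d a| + eta).
      rewrite ler_wpM2r ?addr_ge0// ler_piMr ?(ltW Q0)//.
      by rewrite invf_le1// ler1n.
    apply: le_trans (ler_normD _ _) _; apply: le_trans (lerD (ler_normD _ _) h1) _.
    have h4 : (1 + Q ^+ 2 + Q) * `|d a| <= (1 + Q ^+ 2 + Q) * (C * eta).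
      by rewrite ler_wpM2l// !addr_ge0 ?sqr_ge0 ?(ltW Q0).
    rewrite /C1; lra.
  have hb : (k - a.+1)%:R / n%:R <= tau.
    rewrite natrB// mulrBl lerBlDr; apply: le_trans hk _.
    rewrite -natr1 mulrDl mul1r addrC lerD2l.
    by apply: ltW; rewrite ltr_pdivlMr.
  have := block n eta d B S n0 eta0 pr a.+1 k ak kn hb a.+1 k (leqnn _) ak (leqnn _).
  have tk : ((k - a.+1)%:R / n%:R) `^ be <= 1.
    by apply: powR_le1 => //; rewrite mulr_ge0//=; exact: le_trans tau1.
  have Kd : 0 <= K * (`|d a.+1| + eta) by rewrite mulr_ge0// addr_ge0.
  move=> hdk; have {}hdk : `|d k - d a.+1| <= K * (`|d a.+1| + eta).
    by apply: le_trans hdk _; rewrite ler_piMr.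
  have -> : d k = d a.+1 + (d k - d a.+1) by ring.
  apply: le_trans (ler_normD _ _) _; apply: le_trans (lerD da1 hdk) _.
  have h5 : K * `|d a.+1| <= K * (C1 * eta) by rewrite ler_wpM2l.
  have h6 : 0 <= C * eta by rewrite mulr_ge0.
  lra.
have [C C0 hC] := sup (Num.truncn tau^-1).+1.
have tb0 : 0 < tau `^ be by rewrite powR_gt0.
exists (K * (C + 1) + 2 * C / tau `^ be).
  by rewrite addr_ge0// mulr_ge0 ?addr_ge0// ?mulr_ge0// invr_ge0 ltW.
move=> n eta d B S n0 eta0 pr j k jk kn.
have nR : 0 < n%:R :> R by rewrite ltr0n.
have nR0 : 0 <= n%:R^-1 :> R by rewrite invr_ge0 ltW.
have bd i : (i <= n)%N -> `|d i| <= C * eta.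
  move=> ni; apply: (hC n eta d B S n0 eta0 pr) => //.
  apply: (@le_trans _ _ 1); first by rewrite ler_pdivrMr// mul1r ler_nat.
  by rewrite -[leLHS](mulVf (lt0r_neq0 tau0)) ler_wpM2r ?ltW// truncnS_gt.
have E0 : 0 <= K * (C + 1) * eta by rewrite !mulr_ge0// addr_ge0.
have E1 : 0 <= 2 * C / tau `^ be * eta by rewrite !mulr_ge0// invr_ge0 ltW.
set T := (k - j)%:R / n%:R; have T0 : 0 <= T by rewrite mulr_ge0.
have [Tt|tT] := leP T tau.
  apply: le_trans (block n eta d B S n0 eta0 pr j k jk kn Tt j k (leqnn _) jk (leqnn _)) _.
  rewrite ler_wpM2r ?powR_ge0//.
  have := bd j (leq_trans jk kn) => h; have : K * `|d j| <= K * (C * eta) by rewrite ler_wpM2l.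
  rewrite mulrDl; lra.
apply: (@le_trans _ _ (2 * C / tau `^ be * eta * T `^ be)); last first.
  by rewrite ler_wpM2r ?powR_ge0// [leRHS]mulrDl lerDr.
apply: (@le_trans _ _ (2 * (C * eta))).
  apply: le_trans (ler_normB _ _) _.
  have := bd k kn; have := bd j (leq_trans jk kn); lra.
have -> : 2 * C / tau `^ be * eta * T `^ be = 2 * (C * eta) * (T `^ be / tau `^ be).
  by field; rewrite gt_eqF.
rewrite ler_peMr ?mulr_ge0// ler_pdivlMr// mul1r.
by apply: powR_mono => //; exact: ltW.
Qed.

End young_gronwall.

(** * Weighted sums converging to an integral *)

Section weighted_sums.
Context {R : realType}.

Lemma cvg_sum_nat (m : nat) (f : nat -> nat -> R) (l : nat -> R) :
  (forall i, (i < m)%N -> f i n @[n --> \oo] --> l i) ->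
  \sum_(0 <= i < m) f i n @[n --> \oo] --> \sum_(0 <= i < m) l i.
Proof.
elim: m => [|m IH] h.
  by rewrite big_geq//; under eq_fun do rewrite big_geq//; exact: cvg_cst.
rewrite big_nat_recr//=; under eq_fun do rewrite big_nat_recr//=.
by apply: cvgD; [apply: IH => i im; exact/h/ltnW|exact: h].
Qed.

(** If the weights put mass q in the limit on every rational interval [0, q],
    they average Hölder functions like Lebesgue measure: cut [0, 1] into M
    blocks on which the function is nearly constant. *)
Lemma weighted_sums_cvg (v : nat -> nat -> R) (f : R -> R) (a : R) :
  0 < a -> holder_on01 a f -> (forall n k, 0 <= v n k) ->
  (forall M i : nat, (0 < M)%N -> (i <= M)%N ->
    \sum_(0 <= k < n * i %/ M) v n k @[n --> \oo] --> (i%:R / M%:R : R)) ->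
  \sum_(0 <= k < n) f (k%:R / n%:R) * v n k @[n --> \oo] -->
    (\int[lebesgue_measure]_(s in `[0, 1]) f s : R).
Proof.
move=> a0 hf v0 hv; have [C C0 lf] := holder_clip01 (ltW a0) hf.
have cf : continuous (f \o clip01) by exact: (holder_continuous a0 C0 lf).
have [F [dF iF]] := primitive_exists cf.
have -> : \int[lebesgue_measure]_(s in `[0, 1]) f s = F 1 - F 0.
  rewrite -iF//; apply: eq_Rintegral => u.
  by rewrite inE/= in_itv/= => /andP[u0 u1]; rewrite /= clip01_id.
have riemann (M : nat) : (0 < M)%N ->
    `|\sum_(0 <= i < M) f (i%:R / M%:R) * M%:R^-1 - (F 1 - F 0)| <= C * M%:R `^ (- a).
  move=> M0; have MR : 0 < M%:R :> R by rewrite ltr0n.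
  have -> : F 1 - F 0 = \sum_(0 <= i < M) (F (i.+1%:R / M%:R) - F (i%:R / M%:R)).
    by rewrite (telescope_sumr (fun i => F (i%:R / M%:R)))// mul0r divff// gt_eqF.
  rewrite -sumrB; apply: le_trans (ler_norm_sum _ _ _) _.
  apply: (@le_trans _ _ (\sum_(0 <= i < M) C * M%:R `^ (- a) * M%:R^-1)); last first.
    by rewrite sumr_const_nat subn0 -(mulr_natr (_ / _)) mulfVK// gt_eqF.
  rewrite big_nat_cond [leRHS]big_nat_cond; apply: ler_sum => i /andP[/andP[_ iM] _].
  have i0 : 0 <= i%:R / M%:R :> R by rewrite divr_ge0.
  have ii : i%:R / M%:R <= i.+1%:R / M%:R :> R by rewrite ler_pM2r ?invr_gt0// ler_nat.
  have i1 : i%:R / M%:R <= 1 :> R by rewrite ler_pdivrMr// mul1r ler_nat ltnW.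
  have [x /andP[x1 x2] ->] := mean_value ii
    (fun x hx => dF x (le_trans i0 (proj1 (andP hx)))).
  have len : i.+1%:R / M%:R - i%:R / M%:R = M%:R^-1 :> R.
    by rewrite -mulrBl -natr1 addrAC subrr add0r mul1r.
  rewrite len -mulrBl normrM (gtr0_norm (_ : 0 < M%:R^-1)) ?invr_gt0//.
  rewrite ler_wpM2r ?invr_ge0 ?(ltW MR)//= -[X in f X - _](clip01_id i0 i1).
  apply: le_trans (lf _ _) _; rewrite ler_wpM2l// -natr_invr_powR.
  apply: powR_mono => //; first exact: ltW.
  by rewrite distrC ger0_norm ?subr_ge0//; move: len x2; lra.
apply/cvgrPdist_le => e e0.
have [M [M0 hM]] : exists M : nat, (0 < M)%N /\ C * M%:R `^ (- a) <= e / 4.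
  have lim : C * M%:R `^ (- a) @[M --> \oo] --> C * 0.
    by apply: cvgMr; exact: cvg_natr_powRN.
  have e4 : 0 < e / 4 by rewrite divr_gt0.
  rewrite mulr0 in lim; move/cvgrPdist_le/(_ _ e4): lim => [N _ hN].
  exists N.+1; split=> //; have := hN N.+1 (leqnSn _) => /=.
  by rewrite sub0r normrN ger0_norm// mulr_ge0 ?powR_ge0.
have MR : 0 < M%:R :> R by rewrite ltr0n.
(* f frozen at the left end of each of the M blocks. *)
pose T n := \sum_(0 <= i < M) f (i%:R / M%:R) *
  \sum_(n * i %/ M <= k < n * i.+1 %/ M) v n k.
have Tlim : T n @[n --> \oo] --> \sum_(0 <= i < M) f (i%:R / M%:R) * M%:R^-1.
  apply: cvg_sum_nat => i iM; apply: cvgMr.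
  have mono n : (n * i %/ M <= n * i.+1 %/ M)%N by rewrite leq_div2r// leq_mul2l leqnSn orbT.
  have -> : M%:R^-1 = i.+1%:R / M%:R - i%:R / M%:R :> R.
    by rewrite -mulrBl -natr1 addrAC subrr add0r mul1r.
  under eq_fun => n.
    have -> : \sum_(n * i %/ M <= k < n * i.+1 %/ M) v n k =
        \sum_(0 <= k < n * i.+1 %/ M) v n k - \sum_(0 <= k < n * i %/ M) v n k.
      by rewrite (big_cat_nat (leq0n _) (mono n))/= addrAC subrr add0r.
    over.
  by apply: cvgB; apply: hv => //; exact: ltnW.
have Wlim : \sum_(0 <= k < n) v n k @[n --> \oo] --> (1 : R).
  have := hv 1%N 1%N isT isT; rewrite divr1.
  by under eq_fun do rewrite muln1 divn1.
have e4 : 0 < e / 4 by rewrite divr_gt0.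
near=> n.
have nM : (M <= n)%N by near: n; exists M.
have nR : 0 < n%:R :> R by rewrite ltr0n; exact: leq_trans nM.
have H1 : `|T n - \sum_(0 <= i < M) f (i%:R / M%:R) * M%:R^-1| <= e / 4.
  by rewrite distrC; near: n; move/cvgrPdist_le: Tlim; exact.
have H2 : \sum_(0 <= k < n) v n k <= 2.
  have : `|1 - \sum_(0 <= k < n) v n k| <= 1.
    by near: n; move/cvgrPdist_le: Wlim; exact.
  by rewrite ler_norml => /andP[h _]; lra.
have H3 := riemann M M0.
have split_sum (g : nat -> R) (m : nat) :
    \sum_(0 <= k < n * m %/ M) g k =
    \sum_(0 <= i < m) \sum_(n * i %/ M <= k < n * i.+1 %/ M) g k.
  elim: m => [|m IH]; first by rewrite muln0 div0n !big_geq.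
  rewrite big_nat_recr//= -IH (big_cat_nat (n := n * m %/ M))//=.
  by rewrite leq_div2r// leq_mul2l leqnSn orbT.
have nE : n = (n * M %/ M)%N by rewrite mulnK.
have H4 : `|\sum_(0 <= k < n) f (k%:R / n%:R) * v n k - T n| <= e / 4 * 2.
  rewrite [X in \sum_(0 <= k < X) _]nE split_sum -sumrB.
  apply: le_trans (ler_norm_sum _ _ _) _.
  apply: (@le_trans _ _ (e / 4 * \sum_(0 <= k < n) v n k)); last first.
    by rewrite ler_wpM2l// ltW.
  rewrite [X in \sum_(0 <= k < X) v n k]nE split_sum mulr_sumr.
  rewrite big_nat_cond [leRHS]big_nat_cond; apply: ler_sum => i /andP[/andP[_ iM] _].
  rewrite [f (i%:R / M%:R) * _]mulr_sumr -sumrB mulr_sumr.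
  apply: le_trans (ler_norm_sum _ _ _) _.
  rewrite big_nat_cond [leRHS]big_nat_cond; apply: ler_sum => k /andP[/andP[ik ki] _].
  rewrite -mulrBl normrM (ger0_norm (v0 n k)) ler_wpM2r//.
  have kn : (k <= n)%N.
    by rewrite nE ltnW// (leq_trans ki)// leq_div2r// leq_mul2l iM orbT.
  have k0 : 0 <= k%:R / n%:R :> R by rewrite divr_ge0// ltW.
  have k1 : k%:R / n%:R <= 1 :> R by rewrite ler_pdivrMr// mul1r ler_nat.
  have i0 : 0 <= i%:R / M%:R :> R by rewrite divr_ge0.
  have i1 : i%:R / M%:R <= 1 :> R by rewrite ler_pdivrMr// mul1r ler_nat ltnW.
  rewrite -[X in f X - _](clip01_id k0 k1) -[X in _ - f X](clip01_id i0 i1).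
  apply: le_trans (lf _ _) _; apply: le_trans hM; rewrite ler_wpM2l//.
  rewrite -natr_invr_powR; apply: powR_mono => //; first exact: ltW.
  have A1 : (n * i < k.+1 * M)%N by rewrite -ltn_divLR// ltnS.
  have A2 : (k * M <= n * i.+1)%N.
    by rewrite -leq_divRL// ltnW.
  have {}A1 : n%:R * i%:R <= k%:R * M%:R + M%:R :> R.
    by rewrite -!natrM -natrD ler_nat addnC -mulSn ltnW.
  have {}A2 : k%:R * M%:R <= n%:R * i%:R + n%:R :> R.
    by rewrite -!natrM -natrD ler_nat addnC -mulnS.
  have nMR : M%:R <= n%:R :> R by rewrite ler_nat.
  have -> : k%:R / n%:R - i%:R / M%:R = (k%:R * M%:R - n%:R * i%:R) / (n%:R * M%:R) :> R.
    by field; rewrite !gt_eqF.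
  have -> : M%:R^-1 = n%:R / (n%:R * M%:R) :> R by field; rewrite !gt_eqF.
  rewrite normrM (gtr0_norm (_ : 0 < (n%:R * M%:R)^-1)) ?invr_gt0 ?mulr_gt0//.
  have nM0 : 0 <= (n%:R * M%:R)^-1 :> R by rewrite invr_ge0 mulr_ge0.
  apply: ler_wpM2r nM0 _ _ _; rewrite ler_norml; apply/andP; split; lra.
rewrite distrC.
have -> : \sum_(0 <= k < n) f (k%:R / n%:R) * v n k - (F 1 - F 0) =
  (\sum_(0 <= k < n) f (k%:R / n%:R) * v n k - T n) +
  (T n - \sum_(0 <= i < M) f (i%:R / M%:R) * M%:R^-1) +
  (\sum_(0 <= i < M) f (i%:R / M%:R) * M%:R^-1 - (F 1 - F 0)) by ring.
apply: le_trans (ler_normD _ _) _.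
apply: le_trans (lerD (le_trans (ler_normD _ _) (lerD H4 H1)) (le_trans H3 hM)) _.
lra.
Unshelve. all: by end_near.
Qed.

End weighted_sums.

(** * Orders of magnitude along the grids *)

Section grid_orders.
Context {R : realType}.
Implicit Types (u v : nat -> nat -> R) (a b : R).

Definition grid_O u a := exists2 C : R, 0 <= C & forall n k,
  (k < n)%N -> `|u n k| <= C * n%:R `^ (- a).

Lemma grid_O_D u v a : grid_O u a -> grid_O v a -> grid_O (fun n k => u n k + v n k) a.
Proof.
move=> [C C0 hC] [K K0 hK]; exists (C + K); first exact: addr_ge0.
move=> n k kn; rewrite mulrDl; apply: le_trans (ler_normD _ _) _.
by apply: lerD; [exact: hC|exact: hK].
Qed.

Lemma grid_O_N u a : grid_O u a -> grid_O (fun n k => - u n k) a.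
Proof. by move=> [C C0 hC]; exists C => // n k *; rewrite normrN; exact: hC. Qed.

Lemma grid_O_B u v a : grid_O u a -> grid_O v a -> grid_O (fun n k => u n k - v n k) a.
Proof. by move=> hu /grid_O_N hv; exact: grid_O_D hu hv. Qed.

Lemma grid_O_M u v a b : grid_O u a -> grid_O v b -> grid_O (fun n k => u n k * v n k) (a + b).
Proof.
move=> [C C0 hC] [K K0 hK]; exists (C * K); first exact: mulr_ge0.
move=> n k kn; have n0 : n%:R != 0 :> R by rewrite pnatr_eq0 -lt0n; exact: leq_ltn_trans kn.
rewrite normrM opprD powRD ?n0 ?implybT// mulrACA.
by apply: ler_pM => //; [exact: hC|exact: hK].
Qed.

Lemma grid_O_weak u a b : b <= a -> grid_O u a -> grid_O u b.
Proof.
move=> ba [C C0 hC]; exists C => // n k kn; apply: le_trans (hC n k kn) _.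
rewrite ler_wpM2l//; apply: ler_powR; last by rewrite lerN2.
by rewrite ler1n; exact: leq_ltn_trans kn.
Qed.

Lemma grid_O_ext u v a : (forall n k, (k < n)%N -> u n k = v n k) ->
  grid_O u a -> grid_O v a.
Proof. by move=> uv [C C0 hC]; exists C => // n k kn; rewrite -uv//; exact: hC. Qed.

Lemma grid_O_incr (F : R -> R -> R) a : 0 <= a -> incr_O F a ->
  grid_O (fun n k => F (k%:R / n%:R) (k.+1%:R / n%:R)) a.
Proof.
move=> a0 [C C0 hC]; exists C => // n k kn.
have nR : 0 < n%:R :> R by rewrite ltr0n; exact: leq_ltn_trans kn.
have := hC (k%:R / n%:R) (k.+1%:R / n%:R).
rewrite -mulrBl -natr1 addrAC subrr add0r mul1r natr_invr_powR; apply.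
- by rewrite divr_ge0.
- by rewrite ler_pM2r ?invr_gt0// lerDl.
- by rewrite ler_pdivrMr// mul1r natr1 ler_nat.
Qed.

Lemma grid_O_const (c : R) : grid_O (fun _ _ => c) 0.
Proof. by exists `|c| => // n k _; rewrite oppr0 powRr0 mulr1. Qed.

Lemma grid_O_mesh : grid_O (fun n _ => n%:R^-1) 1.
Proof. by exists 1 => // n k _; rewrite mul1r ger0_norm// powR_inv1. Qed.

(** Bounding a sum of n terms termwise costs one order. *)
Lemma grid_O_sum u a (c : R) : c + 1 < a -> grid_O u a ->
  n%:R `^ c * \sum_(0 <= k < n) u n k @[n --> \oo] --> (0 : R).
Proof.
move=> ca [C C0 hC].
apply: (@norm_cvg0P _ _ _ _ _ _).1.
have lim : C * n%:R `^ (- (a - (c + 1))) @[n --> \oo] --> C * 0.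
  by apply: cvgMr; apply: cvg_natr_powRN; rewrite subr_gt0.
rewrite mulr0 in lim.
apply: (squeeze_cvgr _ (cvg_cst 0) lim).
near=> n; rewrite normr_ge0/=.
have n0 : (0 < n)%N by near: n; exists 1%N.
have nR : n%:R != 0 :> R by rewrite pnatr_eq0 -lt0n.
rewrite normrM (ger0_norm (powR_ge0 _ _)).
apply: (@le_trans _ _ (n%:R `^ c * \sum_(0 <= k < n) C * n%:R `^ (- a))).
  rewrite ler_wpM2l ?powR_ge0//; apply: le_trans (ler_norm_sum _ _ _) _.
  rewrite big_nat_cond [leRHS]big_nat_cond; apply: ler_sum => k /andP[/andP[_ kn] _].
  exact: hC.
rewrite sumr_const_nat subn0 -(mulr_natr (C * _)).
have -> : - (a - (c + 1)) = c + (- a + 1) by ring.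
rewrite !powRD ?nR ?implybT// powRr1//.
by have -> : n%:R `^ c * (C * n%:R `^ (- a) * n%:R) = C * (n%:R `^ c * (n%:R `^ (- a) * n%:R)) by ring.
Unshelve. all: by end_near.
Qed.

(** By sewing, a sum of increments with Hölder weights of size L is itself of
    size L: no order is lost, in contrast with a termwise bound. *)
Lemma young_sum be : 1 < be + be -> 0 <= be -> exists2 c : R, 0 <= c &
  forall (n : nat) (L K : R) (w B : nat -> R), (0 < n)%N -> 0 <= L -> 0 <= K ->
  (forall j k, (j <= k)%N -> (k <= n)%N -> `|B k - B j| <= K * ((k - j)%:R / n%:R) `^ be) ->
  (forall j k, (j <= k)%N -> (k <= n)%N -> `|w k - w j| <= L * ((k - j)%:R / n%:R) `^ be) ->
  `|w 0%N| <= L ->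
  `|\sum_(0 <= k < n) w k * (B k.+1 - B k)| <= c * L * K.
Proof.
move=> th1 be0; have [c c0 sew] := discrete_sewing th1.
exists (c + 1); first by rewrite addr_ge0.
move=> n L K w B n0 L0 K0 hB hw w0.
have nR : 0 < n%:R :> R by rewrite ltr0n.
pose g j k := \sum_(j <= i < k) w i * (B i.+1 - B i) - w j * (B k - B j).
have nR0 : 0 <= n%:R^-1 :> R by rewrite invr_ge0 ltW.
have := sew g (L * K) n%:R^-1 0 0%N n (mulr_ge0 L0 K0) nR0.
move=> /(_ _ _ 0%N n (leqnn _) (leq0n _) (leqnn _)).
rewrite subn0 divff ?gt_eqF// powR1 mulr0 addr0 mulr1 => hg.
have hB1 : `|B n - B 0%N| <= K.
  by have := hB 0%N n (leq0n _) (leqnn _); rewrite subn0 divff ?gt_eqF// powR1 mulr1.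
have -> : \sum_(0 <= k < n) w k * (B k.+1 - B k) = g 0%N n + w 0%N * (B n - B 0%N).
  by rewrite /g subrK.
apply: le_trans (ler_normD _ _) _; rewrite -mulrA mulrDl mul1r; apply: lerD.
  apply: hg.
  - move=> i j k _ ij jk kn.
    have -> : g i k - g i j - g j k = (w j - w i) * (B k - B j).
      by rewrite /g (big_cat_nat ij jk)/=; ring.
    have le1 : (j - i <= k - i)%N by rewrite leq_sub2r.
    have le2 : (k - j <= k - i)%N by rewrite leq_sub2l.
    rewrite normrM powRD_ge0// mulrACA; apply: ler_pM => //.
      apply: le_trans (hw i j ij (leq_trans jk kn)) _; rewrite ler_wpM2l//.
      by apply: powR_mono; rewrite ?mulr_ge0// ler_wpM2r// ler_nat.
    apply: le_trans (hB j k jk kn) _; rewrite ler_wpM2l//.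
    by apply: powR_mono; rewrite ?mulr_ge0// ler_wpM2r// ler_nat.
  - by move=> k _ _; rewrite /g big_nat1 subrr normr0.
by rewrite normrM; apply: ler_pM.
Qed.

End grid_orders.

(** * Asymptotics of the error along one path *)

Section exponential.
Context {R : realType}.

Lemma expR_increment (m x : R) : `|x| <= m ->
  `|expR x - 1| <= expR m * `|x| /\ `|expR x - 1 - x| <= expR m * x ^+ 2.
Proof.
have lip1 (y : R) : `|y| <= m -> `|expR y - 1| <= expR m * `|y|.
  move=> ym; have [z] := mean_value_abs 0 y (fun z => is_derive_expR z).
  rewrite expR0 !subr0 => zy ->; rewrite normrM ler_wpM2r//.
  rewrite ger0_norm ?expR_ge0// ler_expR; apply: le_trans ym.
  by apply: le_trans zy; exact: ler_norm.
move=> xm; split; first exact: lip1.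
have d (z : R) : is_derive z 1 (fun z : R => expR z - z) (expR z - 1).
  by apply: is_deriveB.
have [z] := mean_value_abs 0 x d; rewrite expR0 !subr0 => zx E.
have -> : expR x - 1 - x = (expR z - 1) * x by rewrite -E; ring.
rewrite normrM -real_normK ?num_real// expr2 mulrA ler_wpM2r//.
by apply: le_trans (lip1 z (le_trans zx xm)) _; rewrite ler_wpM2l ?expR_ge0.
Qed.

(** First-order chain rule along a rough path: the error is quadratic in the
    increment. *)
Lemma exp_path_increment (f : R -> R) (a : R) : 0 <= a -> holder_on01 a f ->
  incr_O (fun s t => expR (- f t) - expR (- f s) + expR (- f s) * (f t - f s)) (a + a)
  /\ holder_on01 a (fun s => expR (- f s)).
Proof.
move=> a0 hf; have [m m0 bf] := holder_bounded a0 hf.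
have [C C0 hC] := (incr_O_holder f a).2 hf.
have key (s t : R) : 0 <= s -> s <= t -> t <= 1 -> `|- (f t - f s)| <= 2 * m.
  move=> s0 st t1; rewrite normrN; apply: le_trans (ler_normB _ _) _.
  by have := bf s s0 (le_trans st t1); have := bf t (le_trans s0 st) t1; lra.
have Es (s t : R) : expR (- f t) = expR (- f s) * expR (- (f t - f s)).
  by rewrite -expRD; congr expR; ring.
have Eb (s : R) : 0 <= s -> s <= 1 -> `|expR (- f s)| <= expR m.
  move=> s0 s1; rewrite ger0_norm ?expR_ge0// ler_expR.
  by apply: le_trans (bf s s0 s1); rewrite -normrN ler_norm.
split.
  exists (expR m * (expR (2 * m) * C ^+ 2)).
    by rewrite !mulr_ge0 ?expR_ge0// exprn_ge0.
  move=> s t s0 st t1; have [_ h] := expR_increment (key s t s0 st t1).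
  have -> : expR (- f t) - expR (- f s) + expR (- f s) * (f t - f s) =
    expR (- f s) * (expR (- (f t - f s)) - 1 - - (f t - f s)) by rewrite (Es s t); ring.
  rewrite normrM -mulrA; apply: ler_pM => //; first exact: Eb (le_trans st t1).
  apply: le_trans h _; rewrite -mulrA ler_wpM2l ?expR_ge0//.
  rewrite sqrrN -real_normK ?num_real// powRD_ge0// -expr2 -exprMn.
  by rewrite lerXn2r ?nnegrE ?mulr_ge0 ?powR_ge0//; exact: hC.
apply/incr_O_holder; exists (expR m * (expR (2 * m) * C)).
  by rewrite !mulr_ge0 ?expR_ge0.
move=> s t s0 st t1; have [h _] := expR_increment (key s t s0 st t1).
have -> : expR (- f t) - expR (- f s) =
  expR (- f s) * (expR (- (f t - f s)) - 1) by rewrite (Es s t); ring.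
rewrite normrM -mulrA; apply: ler_pM => //; first exact: Eb (le_trans st t1).
apply: le_trans h _; rewrite -mulrA ler_wpM2l ?expR_ge0// normrN; exact: hC.
Qed.

End exponential.

Section error.
Context {R : realType}.
Variables (sg sg1 sg2 b b1 : R -> R) (M be H : R) (B X G : R -> R) (e : nat -> nat -> R).
Hypotheses (dsg : forall z : R, is_derive z 1 sg (sg1 z))
  (dsg1 : forall z : R, is_derive z 1 sg1 (sg2 z)) (db : forall z : R, is_derive z 1 b (b1 z)).
Hypotheses (lsg : lip M sg) (lsg1 : lip M sg1) (lsg2 : lip M sg2)
  (lb : lip M b) (lb1 : lip M b1).
Hypotheses (be0 : 1 / 2 < be) (be1 : be < 1) (beH : 2 * H - 1 < be) (beH' : 2 * H + 1 < 4 * be).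
Hypotheses (hB : holder_on01 be B) (hX : holder_on01 be X).
Hypothesis X_expansion : incr_O (fun s t => X t - X s - sg (X s) * (B t - B s)
  - b (X s) * (t - s) - 2^-1 * (sg (X s) * sg1 (X s)) * (B t - B s) ^+ 2) (1 + be).
Hypothesis G_expansion : incr_O (fun s t => G t - G s - sg1 (X s) * (B t - B s)
  - b1 (X s) * (t - s)) (be + be).
Local Notation pt n k := (k%:R / n%:R).
Hypothesis e0 : forall n, e n 0%N = X 0.
Hypothesis eS : forall n k, e n k.+1 = e n k +
  sg (e n k) * (B (pt n k.+1) - B (pt n k)) + b (e n k) * n%:R^-1.
Hypothesis quadratic_variation : forall N i : nat, (0 < N)%N -> (i <= N)%N ->
  \sum_(0 <= k < n * i %/ N) n%:R `^ (2 * H - 1) * (B (pt n k.+1) - B (pt n k)) ^+ 2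
    @[n --> \oo] --> (i%:R / N%:R : R).

Let M0 : 0 <= M. Proof. exact: lip_ge0 lsg. Qed.
Let be_gt0 : 0 < be. Proof. by have := be0; lra. Qed.
Let be_ge0 : 0 <= be. Proof. exact: ltW. Qed.
Ltac exponents := have := be0; have := be1; have := beH; have := beH'; lra.

Let dl n k := e n k - X (pt n k).
Let dB n k := B (pt n k.+1) - B (pt n k).
(** Each of the n steps misses a term of order 2 be, so w is the order of the
    error obtained without using the quadratic variation. *)
Let w := be + be - 1.
Let w0 : 0 < w. Proof. by rewrite /w; exponents. Qed.

Let pt_itv n k : (0 < n)%N -> (k <= n)%N -> 0 <= pt n k :> R /\ pt n k <= 1 :> R.
Proof.
move=> n0 kn; have nR : 0 < n%:R :> R by rewrite ltr0n.
by split; [rewrite divr_ge0|rewrite ler_pdivrMr// mul1r ler_nat].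
Qed.

Let pt_dist n j k : (j <= k)%N -> `|pt n k - pt n j| = (k - j)%:R / n%:R :> R.
Proof.
by move=> jk; rewrite -mulrBl -natrB// ger0_norm// mulr_ge0.
Qed.

Let pt_step n k : pt n k.+1 - pt n k = n%:R^-1 :> R.
Proof. by rewrite -mulrBl -natr1 addrAC subrr add0r mul1r. Qed.

Let hsX : holder_on01 be (sg \o X). Proof. exact: (holder_lip M0 lsg hX). Qed.
Let hs1X : holder_on01 be (sg1 \o X). Proof. exact: (holder_lip M0 lsg1 hX). Qed.
Let hb1X : holder_on01 be (b1 \o X). Proof. exact: (holder_lip M0 lb1 hX). Qed.
Let hssX : holder_on01 be (fun s => sg (X s) * sg1 (X s)).
Proof. exact: (holderM be_ge0 hsX hs1X). Qed.

Let X_first_order : incr_O (fun s t => X t - X s - sg (X s) * (B t - B s)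
  - b (X s) * (t - s)) (be + be).
Proof.
apply: (incr_O_ext (F := fun s t => (X t - X s - sg (X s) * (B t - B s)
  - b (X s) * (t - s) - 2^-1 * (sg (X s) * sg1 (X s)) * (B t - B s) ^+ 2) +
  2^-1 * (sg (X s) * sg1 (X s) * ((B t - B s) * (B t - B s))))).
  by move=> s t *; ring.
apply: incr_O_D; first by apply: incr_O_weak X_expansion; exponents.
apply: (@incr_O_scale _ (fun _ _ => 2^-1)); [|exponents|].
  by apply: (@incr_O_bounded _ _ 2^-1) => s t *; rewrite ger0_norm.
apply: (@incr_O_scale _ (fun s _ => sg (X s) * sg1 (X s))); [|exponents|].
  exact: (holder_left_bounded be_ge0 hssX).
by apply: incr_O_M => //; exact/incr_O_holder.
Qed.

(** A step of size O(n^(-2 be)) is a source of size O(n^(-w)) per unit of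
    time. *)
Let error_apriori : exists2 C : R, 0 <= C & forall n j k, (0 < n)%N ->
  (j <= k)%N -> (k <= n)%N ->
  `|dl n k - dl n j| <= C * n%:R `^ (- w) * ((k - j)%:R / n%:R) `^ be.
Proof.
have [CB CB0 hCB] := holder_on01P hB; have [CX CX0 hCX] := holder_on01P hX.
have [C2 C20 hC2] := X_first_order.
pose Q := 1 + M + CB + M * CX + C2.
have MCX : 0 <= M * CX by rewrite mulr_ge0// M0.
have [Q1 QM QB QX Q2] : [/\ 1 <= Q, M <= Q, CB <= Q, M * CX <= Q & C2 <= Q].
  by have := M0; rewrite /Q; split; lra.
clearbody Q.
have [C C0 hC] := young_gronwall Q1 be0 be1.
exists C => // n j k n0 jk kn.
have nR : 0 < n%:R :> R by rewrite ltr0n.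
have nR0 : 0 <= n%:R^-1 :> R by rewrite invr_ge0 ltW.
pose S k := sg (X (pt n k) + dl n k) - sg (X (pt n k)).
apply: (hC n (n%:R `^ (- w)) (dl n) (fun k => B (pt n k)) S n0) => //.
have pB i l : (i <= l)%N -> (l <= n)%N -> forall (f : R -> R) (c : R), 0 <= c -> c <= Q ->
    (forall s t : R, 0 <= s -> s <= 1 -> 0 <= t -> t <= 1 -> `|f t - f s| <= c * `|t - s| `^ be) ->
    `|f (pt n l) - f (pt n i)| <= Q * ((l - i)%:R / n%:R) `^ be.
  move=> il ln f c c0 cQ hf; rewrite -(pt_dist n il).
  have [? ?] := pt_itv n0 ln; have [? ?] := pt_itv n0 (leq_trans il ln).
  by apply: le_trans (hf _ _ _ _ _ _) _ => //; rewrite ler_wpM2r// powR_ge0.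
split.
- by rewrite /dl e0 mul0r subrr.
- by move=> i l il ln; apply: (pB i l il ln B CB).
- move=> i l il ln.
  apply: le_trans (increment_lip dsg lsg lsg1 _ _ _ _) _; apply: lerD.
    by rewrite ler_wpM2r.
  rewrite mulrAC [leRHS]mulrAC ler_wpM2r//.
  rewrite -(pt_dist n il).
  have [? ?] := pt_itv n0 ln; have [? ?] := pt_itv n0 (leq_trans il ln).
  apply: (@le_trans _ _ (M * (CX * `|pt n l - pt n i| `^ be))).
    by rewrite ler_wpM2l ?M0//; exact: hCX.
  by rewrite mulrA ler_wpM2r// powR_ge0.
- move=> i _; apply: le_trans (lsg _ _) _.
  by rewrite addrAC subrr add0r ler_wpM2r.
move=> i iln.
have eE : X (pt n i) + dl n i = e n i by rewrite /dl addrC subrK.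
have -> : dl n i.+1 - dl n i - S i * (B (pt n i.+1) - B (pt n i)) =
  (b (e n i) - b (X (pt n i))) * n%:R^-1 -
  (X (pt n i.+1) - X (pt n i) - sg (X (pt n i)) * (B (pt n i.+1) - B (pt n i)) -
   b (X (pt n i)) * (pt n i.+1 - pt n i)).
  by rewrite /S eE pt_step /dl eS; ring.
apply: le_trans (ler_normB _ _) _; rewrite [leRHS]mulrDr; apply: lerD.
  rewrite normrM (ger0_norm nR0) mulrAC ler_wpM2r//.
  by apply: le_trans (lb _ _) _; rewrite ler_wpM2r.
have [p0 p1] := pt_itv n0 (ltnW iln); have [p2 p3] := pt_itv n0 iln.
apply: le_trans (hC2 _ _ p0 _ p3) _; first by rewrite ler_wpM2r// ler_nat.
rewrite pt_step natr_invr_powR -mulrA; apply: ler_pM => //.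
rewrite -powR_inv1// -powRD; last by rewrite (gt_eqF nR) implybT.
by rewrite (_ : -1 + - w = - (be + be))// /w; ring.
Qed.

Let grid_point (f : R -> R) : holder_on01 be f -> grid_O (fun n k => f (pt n k)) 0.
Proof. by move=> /(holder_left_bounded be_ge0) h; exact: (grid_O_incr _ h). Qed.

Let O_dl : grid_O dl w /\ grid_O (fun n k => dl n k.+1) w.
Proof.
have [C C0 hC] := error_apriori.
have key n k : (0 < n)%N -> (k <= n)%N -> `|dl n k| <= C * n%:R `^ (- w).
  move=> n0 kn; have := hC n 0%N k n0 (leq0n _) kn.
  rewrite {2}/dl e0 mul0r subrr subr0 subn0 => /le_trans; apply.
  rewrite ler_piMr ?mulr_ge0 ?powR_ge0//; apply: powR_le1 => //.
  by have [-> ->] := pt_itv n0 kn.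
split; exists C => // n k kn; apply: key => //; try exact: ltnW.
all: exact: leq_ltn_trans kn.
Qed.

Let O_dB : grid_O dB be.
Proof. by apply: (grid_O_incr (F := fun s t => B t - B s)) => //; exact/incr_O_holder. Qed.

Let q n k := sg (X (pt n k) + dl n k) - sg (X (pt n k)) - sg1 (X (pt n k)) * dl n k.

Let O_taylor (f f1 : R -> R) : (forall z : R, is_derive z 1 f (f1 z)) -> lip M f1 ->
  grid_O (fun n k => f (X (pt n k) + dl n k) - f (X (pt n k)) - f1 (X (pt n k)) * dl n k) (w + w).
Proof.
move=> df lf1; have [dl1 _] := O_dl; have [C C0 hC] := grid_O_M dl1 dl1.
exists (M * C) => [|n k kn]; first by rewrite mulr_ge0// M0.
apply: le_trans (taylor1 df lf1 _ _) _.
rewrite -mulrA ler_wpM2l ?M0// expr2; apply: le_trans (hC n k kn).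
by rewrite ler_norm.
Qed.

(** The inverse of the flow of the linearised equation: multiplied by E, the
    error solves a recursion without linear term. *)
Let E s := expR (- G s).
Let lam n k := sg1 (X (pt n k)) * dB n k + b1 (X (pt n k)) * n%:R^-1.

Let hG : holder_on01 be G.
Proof.
apply/incr_O_holder; apply: (incr_O_ext (F := fun s t =>
  (G t - G s - sg1 (X s) * (B t - B s) - b1 (X s) * (t - s)) +
  (sg1 (X s) * (B t - B s) + b1 (X s) * (t - s)))).
  by move=> s t *; ring.
apply: incr_O_D; first by apply: incr_O_weak G_expansion; exponents.
apply: incr_O_D.
  apply: (@incr_O_scale _ (fun s _ => sg1 (X s))) => //; last exact/incr_O_holder.
  exact: (holder_left_bounded be_ge0 hs1X).
apply: (@incr_O_scale _ (fun s _ => b1 (X s))) => //.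
  exact: (holder_left_bounded be_ge0 hb1X).
by apply: incr_O_weak (incr_O_length); exponents.
Qed.

Let hE : holder_on01 be E. Proof. by have [] := exp_path_increment be_ge0 hG. Qed.

(** What E fails to invert in one step of the linearised recursion. *)
Let eps n k := E (pt n k.+1) - E (pt n k) + E (pt n k) * lam n k.

Let O_eps : grid_O eps (be + be).
Proof.
have [h _] := exp_path_increment be_ge0 hG.
have h2 : incr_O (fun s t => E s * (G t - G s - sg1 (X s) * (B t - B s)
    - b1 (X s) * (t - s))) (be + be).
  apply: (@incr_O_scale _ (fun s _ => E s)); [|exponents|exact: G_expansion].
  exact: (holder_left_bounded be_ge0 hE).
apply: (grid_O_ext _ (grid_O_incr _ (incr_O_B h h2))); last by exponents.
by move=> n k kn; rewrite /eps /lam /dB -/(E _) -/(E _) pt_step; ring.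
Qed.

Let rm n k := X (pt n k.+1) - X (pt n k) - sg (X (pt n k)) * dB n k
  - b (X (pt n k)) * n%:R^-1 - 2^-1 * (sg (X (pt n k)) * sg1 (X (pt n k))) * dB n k ^+ 2.

Let O_rm : grid_O rm (1 + be).
Proof.
apply: (grid_O_ext _ (grid_O_incr _ X_expansion)); last by exponents.
by move=> n k kn; rewrite /rm /dB pt_step.
Qed.

Let p n k := (b (X (pt n k) + dl n k) - b (X (pt n k)) - b1 (X (pt n k)) * dl n k) * n%:R^-1
  - rm n k.

(** A lower bound for the orders of all negligible terms of one step. The
    choice of be makes it larger than 2 H, so that n such terms are negligible
    after rescaling by n^(2 H - 1). *)
Let ze := Num.min (4 * be - 1) (1 + be).

Let O_p : grid_O p ze.
Proof.
apply: grid_O_B.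
  have h := grid_O_M (O_taylor db lb1) (@grid_O_mesh R).
  apply: grid_O_weak h; rewrite /ze ge_min /w; apply/orP; left; lra.
by apply: grid_O_weak O_rm; rewrite /ze ge_min lexx orbT.
Qed.

Let O_lam : grid_O lam be.
Proof.
apply: grid_O_D.
  by rewrite -[be]add0r; apply: grid_O_M => //; exact: grid_point hs1X.
apply: (@grid_O_weak _ _ (0 + 1)); first by exponents.
by apply: grid_O_M (grid_O_mesh); exact: grid_point hb1X.
Qed.

Let f s := E s * (sg (X s) * sg1 (X s)).
Let hf : holder_on01 be f. Proof. exact: holderM. Qed.

Let rho n k := (E (pt n k.+1) * dl n k.+1 - E (pt n k) * dl n k) -
  (E (pt n k) * q n k * dB n k - 2^-1 * (f (pt n k) * dB n k ^+ 2)).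

(** Among the products that appear in one step, eps dl and lam^2 dl are of order
    4 be - 1, q dB lam is of the higher order 6 be - 2 and lam a dB^2 of order
    3 be; p collects the Taylor remainder of b and that of the solution. *)
Let O_rho : grid_O rho ze.
Proof.
pose a s := sg (X s) * sg1 (X s).
have ze1 : ze <= 4 * be - 1 by rewrite /ze ge_min lexx.
have ze2 : ze <= 1 + be by rewrite /ze ge_min lexx orbT.
have [dl1 dl2] := O_dl; have OE := grid_point hE; have Oa := grid_point hssX.
have Oq := O_taylor dsg lsg1.
apply: (grid_O_ext (u := fun n k => eps n k * dl n k.+1 -
  E (pt n k) * (lam n k * lam n k * dl n k) -
  E (pt n k) * (lam n k * (q n k * dB n k)) +
  2^-1 * (E (pt n k) * (lam n k * (a (pt n k) * (dB n k * dB n k)))) +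
  E (pt n k) * (1 - lam n k) * p n k)).
  move=> n k kn.
  have -> : rho n k = rho n k + 0 * dl n k by rewrite mul0r addr0.
  have dlS : dl n k.+1 = dl n k * (1 + lam n k) + q n k * dB n k
      - 2^-1 * (a (pt n k) * dB n k ^+ 2) + p n k.
    have eE : X (pt n k) + dl n k = e n k by rewrite /dl addrC subrK.
    rewrite /p /rm /q /lam /a eE /dl eS -/(dB n k); ring.
  rewrite /rho /eps dlS /f -/(a _); ring.
have lam1 : grid_O (fun n k => 1 - lam n k) 0.
  apply: grid_O_B; first exact: grid_O_const.
  by apply: grid_O_weak O_lam.
apply: grid_O_D; [apply: grid_O_D; [apply: grid_O_B; [apply: grid_O_B|]|]|].
- apply: grid_O_weak (grid_O_M O_eps dl2); rewrite /w; move: ze1; exponents.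
- apply: grid_O_weak (grid_O_M OE (grid_O_M (grid_O_M O_lam O_lam) dl1)).
  rewrite /w; move: ze1; exponents.
- apply: grid_O_weak (grid_O_M OE (grid_O_M O_lam (grid_O_M Oq O_dB))).
  rewrite /w; move: ze1; exponents.
- apply: grid_O_weak (grid_O_M (grid_O_const _) (grid_O_M OE (grid_O_M O_lam
    (grid_O_M Oa (grid_O_M O_dB O_dB))))).
  move: ze2; exponents.
- by apply: grid_O_weak (grid_O_M (grid_O_M OE lam1) O_p); rewrite !add0r.
Qed.

(** The quadratic Taylor remainder of the diffusion coefficient is not small
    enough to be summed term by term: its cancellations are those of a Young
    integral. *)
Let young_part : n%:R `^ (2 * H - 1) * \sum_(0 <= k < n) E (pt n k) * q n k * dB n k
  @[n --> \oo] --> (0 : R).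
Proof.
have [C C0 hC] := error_apriori; have [K K0 hK] := holder_on01P hB.
have [CX CX0 hCX] := holder_on01P hX; have [CE CE0 hCE] := holder_on01P hE.
have [ME ME0 hME] := holder_bounded be_ge0 hE.
have th1 : 1 < be + be by exponents.
have [c c0 young] := young_sum th1 be_ge0.
pose L := ME * (2 * M * (C + C) * C + M * C ^+ 2 * CX) + CE * (M * C ^+ 2) + ME * (M * C ^+ 2).
have L00 : 0 <= M * C ^+ 2 by rewrite mulr_ge0 ?M0// sqr_ge0.
have L01 : 0 <= 2 * M * (C + C) * C + M * C ^+ 2 * CX.
  by rewrite addr_ge0 ?mulr_ge0 ?M0 ?addr_ge0.
have L0 : 0 <= L by rewrite !addr_ge0 ?mulr_ge0.
have bound n : (0 < n)%N ->
    `|n%:R `^ (2 * H - 1) * \sum_(0 <= k < n) E (pt n k) * q n k * dB n k| <=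
    c * L * K * n%:R `^ (- (w + w - (2 * H - 1))).
  move=> n0; have nR : 0 < n%:R :> R by rewrite ltr0n.
  pose eta : R := n%:R `^ (- w).
  have eta0 : 0 <= eta by exact: powR_ge0.
  have bdl k : (k <= n)%N -> `|dl n k| <= C * eta.
    move=> kn; have := hC n 0%N k n0 (leq0n _) kn.
    rewrite {2}/dl e0 mul0r subrr subr0 subn0 => /le_trans; apply.
    rewrite ler_piMr ?mulr_ge0//; apply: powR_le1 => //.
    by have [-> ->] := pt_itv n0 kn.
  have sqdl k : (k <= n)%N -> dl n k ^+ 2 <= C ^+ 2 * eta ^+ 2.
    move=> kn; rewrite -real_normK ?num_real// -exprMn.
    by rewrite lerXn2r ?nnegrE ?mulr_ge0//; exact: bdl.
  have bq k : (k <= n)%N -> `|q n k| <= M * C ^+ 2 * eta ^+ 2.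
    move=> kn; apply: le_trans (taylor1 dsg lsg1 _ _) _.
    by rewrite -mulrA ler_wpM2l ?M0//; exact: sqdl.
  have hol (h : R -> R) c' j k : (j <= k)%N -> (k <= n)%N ->
      (forall s t : R, 0 <= s -> s <= 1 -> 0 <= t -> t <= 1 ->
         `|h t - h s| <= c' * `|t - s| `^ be) ->
      `|h (pt n k) - h (pt n j)| <= c' * ((k - j)%:R / n%:R) `^ be.
    move=> jk kn hh; rewrite -(pt_dist n jk).
    have [? ?] := pt_itv n0 kn; have [? ?] := pt_itv n0 (leq_trans jk kn).
    exact: hh.
  have := young n (L * eta ^+ 2) K (fun k => E (pt n k) * q n k) (fun k => B (pt n k)) n0.
  move=> yb; rewrite normrM (ger0_norm (powR_ge0 _ _)).
  apply: (@le_trans _ _ (n%:R `^ (2 * H - 1) * (c * (L * eta ^+ 2) * K))); last first.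
    have -> : - (w + w - (2 * H - 1)) = (2 * H - 1) + (- w + - w) by ring.
    rewrite !powRD ?(gt_eqF nR) ?implybT// -/eta.
    by rewrite le_eqVlt; apply/orP; left; apply/eqP; ring.
  rewrite ler_wpM2l ?powR_ge0//; apply: yb => //.
  - by rewrite mulr_ge0// sqr_ge0.
  - by move=> j k jk kn; exact: hol.
  - move=> j k jk kn; set t := ((k - j)%:R / n%:R) `^ be.
    have t0 : 0 <= t by exact: powR_ge0.
    have jn := leq_trans jk kn.
    have -> : E (pt n k) * q n k - E (pt n j) * q n j =
      E (pt n k) * (q n k - q n j) + (E (pt n k) - E (pt n j)) * q n j by ring.
    have h1 : `|q n k - q n j| <= (2 * M * (C + C) * C + M * C ^+ 2 * CX) * eta ^+ 2 * t.
      apply: le_trans (remainder_lip dsg dsg1 lsg1 lsg2 _ _ _ _) _.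
      have -> : (2 * M * (C + C) * C + M * C ^+ 2 * CX) * eta ^+ 2 * t =
        2 * M * (C * eta + C * eta) * (C * eta * t) + M * (C ^+ 2 * eta ^+ 2) * (CX * t).
        by ring.
      have n1 : 0 <= 2 * M * (`|dl n j| + `|dl n k|).
        by apply: mulr_ge0; [exact: mulr_ge0|exact: addr_ge0].
      have n2 : 0 <= M * dl n j ^+ 2 by apply: mulr_ge0; [exact: M0|exact: sqr_ge0].
      apply: lerD; apply: ler_pM => //.
      + apply: ler_wpM2l; first exact: mulr_ge0.
        by apply: lerD; exact: bdl.
      + exact: hC.
      + by apply: ler_wpM2l => //; exact: sqdl.
      + exact: hol.
    have h2 : `|E (pt n k)| <= ME by have [? ?] := pt_itv n0 kn; exact: hME.
    have h3 : `|E (pt n k) - E (pt n j)| <= CE * t by exact: hol.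
    apply: le_trans (ler_normD _ _) _; rewrite !normrM.
    apply: le_trans (lerD (ler_pM _ _ h2 h1) (ler_pM _ _ h3 (bq j jn))) _ => //.
    have : 0 <= ME * (M * C ^+ 2) * eta ^+ 2 * t by rewrite !mulr_ge0// sqr_ge0.
    rewrite /L; lra.
  - rewrite normrM; have [? ?] := pt_itv n0 (leq0n n).
    apply: le_trans (ler_pM _ _ (hME _ _ _) (bq 0%N (leq0n _))) _ => //.
    rewrite mulrA ler_wpM2r ?sqr_ge0// /L lerDr addr_ge0 ?mulr_ge0//.
have lim : c * L * K * n%:R `^ (- (w + w - (2 * H - 1))) @[n --> \oo] --> c * L * K * 0.
  by apply: cvgMr; apply: cvg_natr_powRN; rewrite /w; exponents.
rewrite mulr0 in lim; apply: (@norm_cvg0P _ _ _ _ _ _).1.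
apply: (squeeze_cvgr _ (cvg_cst 0) lim).
by near=> n; rewrite normr_ge0/=; apply: bound; near: n; exists 1%N.
Unshelve. all: by end_near.
Qed.

(** The error times E telescopes: up to negligible terms, it is minus half a
    weighted sum of squared increments, which the quadratic variation turns into
    an integral. *)
Lemma error_limit : n%:R `^ (2 * H - 1) * (e n n - X 1) @[n --> \oo] -->
  - 2^-1 * \int[lebesgue_measure]_(s in `[0, 1])
     (sg1 (X s) * (sg (X s) * expR (G 1 - G s))).
Proof.
have E1 : E 1 != 0 by rewrite gt_eqF ?expR_gt0.
pose f1 s := (E 1)^-1 * f s.
have hf1 : holder_on01 be f1.
  apply: (@holder_lip _ f (fun x => (E 1)^-1 * x) _ `|(E 1)^-1|) => // x y.
  by rewrite -mulrBr normrM.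
have -> : (fun s => sg1 (X s) * (sg (X s) * expR (G 1 - G s))) = f1.
  apply/funext => s; rewrite /f1 /f /E -expRN opprK.
  by rewrite expRD; ring.
have qv := weighted_sums_cvg be_gt0 hf1
  (fun n k => mulr_ge0 (powR_ge0 _ _) (sqr_ge0 _)) quadratic_variation.
have rest : n%:R `^ (2 * H - 1) * \sum_(0 <= k < n) rho n k @[n --> \oo] --> (0 : R).
  apply: grid_O_sum O_rho; rewrite /ze lt_min; apply/andP; split; exponents.
have lim : (E 1)^-1 * (n%:R `^ (2 * H - 1) * (\sum_(0 <= k < n) E (pt n k) * q n k * dB n k) +
      n%:R `^ (2 * H - 1) * (\sum_(0 <= k < n) rho n k)) +
    - 2^-1 * (\sum_(0 <= k < n) f1 (pt n k) *
        (n%:R `^ (2 * H - 1) * (B (pt n k.+1) - B (pt n k)) ^+ 2))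
    @[n --> \oo] --> (E 1)^-1 * (0 + 0) +
    - 2^-1 * \int[lebesgue_measure]_(s in `[0, 1]) f1 s.
  apply: cvgD; apply: cvgMr; last exact: qv.
  by apply: cvgD; [exact: young_part|exact: rest].
rewrite addr0 mulr0 add0r in lim.
apply: cvg_trans lim; apply: near_eq_cvg.
near=> n; have n0 : (0 < n)%N by near: n; exists 1%N.
have nn : pt n n = 1 :> R by rewrite divff// pnatr_eq0 -lt0n.
have tele : E 1 * dl n n = \sum_(0 <= k < n) rho n k +
    \sum_(0 <= k < n) E (pt n k) * q n k * dB n k -
    2^-1 * \sum_(0 <= k < n) f (pt n k) * dB n k ^+ 2.
  rewrite mulr_sumr -big_split/= -sumrB.
  transitivity (\sum_(0 <= k < n) (E (pt n k.+1) * dl n k.+1 - E (pt n k) * dl n k)).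
    rewrite (telescope_sumr (fun k => E (pt n k) * dl n k))// nn.
    by rewrite {3}/dl e0 mul0r subrr mulr0 subr0.
  by apply: eq_bigr => k _; rewrite /rho; ring.
have -> : \sum_(0 <= k < n) f1 (pt n k) *
    (n%:R `^ (2 * H - 1) * (B (pt n k.+1) - B (pt n k)) ^+ 2) =
  (E 1)^-1 * n%:R `^ (2 * H - 1) * \sum_(0 <= k < n) f (pt n k) * dB n k ^+ 2.
  by rewrite mulr_sumr; apply: eq_bigr => k _; rewrite /f1 /dB; ring.
have -> : e n n - X 1 = (E 1)^-1 * (E 1 * dl n n) by rewrite mulKf// /dl nn.
by rewrite tele; ring.
Unshelve. all: by end_near.
Qed.

End error.

(** * Moments of Gaussian variables *)

Section normal_moments.
Context {R : realType}.
Variables (m s : R).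
Hypothesis s0 : s != 0.
Local Notation mu := (@lebesgue_measure R).
Local Notation pdf := (normal_pdf m s).

(** The density of the normal law is its Radon-Nikodym derivative almost
    everywhere, which gives the change of variables. *)
Lemma integral_normal_prob (g : measurableTypeR R -> R) : measurable_fun setT g ->
  mu.-integrable setT (EFin \o (fun x => g x * pdf x)) ->
  (normal_prob m s).-integrable setT (EFin \o g) /\
  \int[normal_prob m s]_x g x = \int[mu]_x (g x * pdf x).
Proof.
move=> mg ig; have dom := normal_prob_dominates m s.
have dens : ae_eq mu setT (Radon_Nikodym_SigmaFinite.f (normal_prob m s) mu)
    (EFin \o pdf).
  apply: integral_ae_eq => //.
  - exact: Radon_Nikodym_SigmaFinite.f_integrable.
  - by apply/measurable_EFinP; exact: measurable_normal_pdf.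
  - by move=> E _ mE; rewrite -Radon_Nikodym_SigmaFinite.f_integral.
have mf : measurable_fun setT (Radon_Nikodym_SigmaFinite.f (normal_prob m s) mu).
  exact: measurable_int (Radon_Nikodym_SigmaFinite.f_integrable dom).
have mpdf : measurable_fun setT (EFin \o pdf).
  by apply/measurable_EFinP; exact: measurable_normal_pdf.
have ge0 (h : measurableTypeR R -> R) : measurable_fun setT h -> (forall x, 0 <= h x) ->
    (\int[normal_prob m s]_x (h x)%:E = \int[mu]_x (h x * pdf x)%:E)%E.
  move=> mh h0.
  rewrite -(Radon_Nikodym_SigmaFinite.change_of_variables dom)//=; last exact/measurable_EFinP.
  under [RHS]eq_integral do rewrite EFinM.
  apply: ae_eq_integral => //.
  - by apply: emeasurable_funM => //; exact/measurable_EFinP.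
  - by apply: emeasurable_funM => //; exact/measurable_EFinP.
  - exact: ae_eqe_mul2l.
have in_ : (normal_prob m s).-integrable setT (EFin \o g).
  apply/integrableP; split; first exact/measurable_EFinP.
  under eq_integral do rewrite /=.
  rewrite (ge0 (fun x => `|g x|))//; last exact: measurableT_comp.
  have /integrableP[_] := ig; congr (_ < _)%E; apply: eq_integral => x _ /=.
  by rewrite normrM (ger0_norm (normal_pdf_ge0 m s x)).
split=> //; rewrite /Rintegral; congr fine.
rewrite -(Radon_Nikodym_change_of_variables dom)//.
under [RHS]eq_integral do rewrite EFinM.
apply: ae_eq_integral => //.
- by apply: emeasurable_funM => //; exact/measurable_EFinP.
- by apply: emeasurable_funM => //; exact/measurable_EFinP.
- apply: ae_eqe_mul2l; apply: ae_eq_trans dens; apply: ae_eq_sym.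
  exact: ae_eq_Radon_Nikodym_SigmaFinite.
Qed.

Let s' := Num.sqrt 2 * s.
Let s'0 : s' != 0. Proof. by rewrite mulf_neq0// gt_eqF// sqrtr_gt0. Qed.

(** Half of the Gaussian weight absorbs any power; the other half is the density
    of a normal law of doubled variance. *)
Lemma normal_tail (k : nat) : exists2 C : R, 0 <= C & forall x,
  `|x - m| ^+ k * pdf x <= C * normal_pdf m s' x.
Proof.
have ss : 0 < s ^+ 2 by rewrite exprn_even_gt0.
have s'2 : s' ^+ 2 = s ^+ 2 *+ 2 by rewrite /s' exprMn sqr_sqrtr// mulr2n; ring.
have [p0 p0'] : 0 < normal_peak s /\ 0 < normal_peak s'.
  by split; exact: normal_peak_gt0.
exists (normal_peak s * (1 + (4 * s ^+ 2) ^+ k * k`!%:R) / normal_peak s').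
  rewrite !mulr_ge0 ?invr_ge0 ?(ltW p0') ?(ltW p0)// addr_ge0// mulr_ge0//.
  by rewrite exprn_ge0// mulr_ge0// ltW.
move=> x; rewrite !normal_pdfE// /normal_fun.
pose u := (x - m) ^+ 2 / (4 * s ^+ 2).
have u0 : 0 <= u by rewrite divr_ge0 ?sqr_ge0// mulr_ge0// ltW.
have -> : - (x - m) ^+ 2 / (s ^+ 2 *+ 2) = - u + - u.
  by rewrite /u; field; exact: s0.
have -> : - (x - m) ^+ 2 / (s' ^+ 2 *+ 2) = - u.
  by rewrite s'2 /u; field; exact: s0.
rewrite expRD.
have key : `|x - m| ^+ k <= (1 + (4 * s ^+ 2) ^+ k * k`!%:R) * expR u.
  have h1 : `|x - m| ^+ k <= 1 + (4 * s ^+ 2) ^+ k * u ^+ k.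
    rewrite -exprMn /u mulrCA divff ?mulr1; last first.
      by rewrite mulf_neq0// gt_eqF.
    rewrite -[(x - m) ^+ 2]real_normK ?num_real// -exprM mulnC exprM.
    have := sqr_ge0 (`|x - m| ^+ k - 1); have := exprn_ge0 k (normr_ge0 (x - m)).
    by move: (_ ^+ k) => z z0 h; nra.
  have h2 : u ^+ k <= k`!%:R * expR u.
    case: k {h1} => [|k]; first by rewrite expr0 fact0 mul1r -expR0 ler_expR.
    have := expR_ge1Dxn k u0.
    have f0 : 0 < k.+1`!%:R :> R by rewrite ltr0n fact_gt0.
    by move=> h; rewrite -ler_pdivrMl// mulrC; apply: le_trans h; rewrite lerDr.
  have h3 : 1 <= expR u by rewrite -expR0 ler_expR.
  apply: (le_trans h1); rewrite [leRHS]mulrDl mul1r; apply: lerD => //.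
  by rewrite -mulrA ler_wpM2l// exprn_ge0// mulr_ge0// ltW.
rewrite [leRHS](_ : _ = normal_peak s * expR (- u) * (1 + (4 * s ^+ 2) ^+ k * k`!%:R)); last first.
  by field; rewrite gt_eqF.
have -> : `|x - m| ^+ k * (normal_peak s * (expR (- u) * expR (- u))) =
  normal_peak s * expR (- u) * (`|x - m| ^+ k * expR (- u)) by ring.
rewrite ler_wpM2l ?mulr_ge0 ?expR_ge0 ?(ltW p0)//.
by rewrite expRN ler_pdivrMr ?expR_gt0.
Qed.

Let measurable_pow (k : nat) : measurable_fun setT (fun x : R => (x - m) ^+ k).
Proof. by apply: measurable_funX; apply: measurable_funB. Qed.

Lemma integrable_pow_pdf (k : nat) :
  mu.-integrable setT (EFin \o (fun x => (x - m) ^+ k * pdf x)).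
Proof.
have [C C0 hC] := normal_tail k.
apply: (@le_integrable _ _ _ mu setT measurableT _ (fun x => (C * normal_pdf m s' x)%:E)).
- by apply/measurable_EFinP; apply: measurable_funM; [exact: measurable_pow|exact: measurable_normal_pdf].
- move=> x _ /=; rewrite lee_fin normrM normrX.
  rewrite (ger0_norm (normal_pdf_ge0 m s x)) [leRHS]ger0_norm ?mulr_ge0 ?normal_pdf_ge0//.
- by under eq_fun do rewrite EFinM; apply: integrableZl => //; exact: integrable_normal_pdf.
Qed.

Lemma is_derive_normal_pdf (x : R) : is_derive x 1 pdf (- (x - m) / s ^+ 2 * pdf x).
Proof.
have -> : pdf = fun x => normal_peak s * expR (- (x - m) ^+ 2 / (s ^+ 2 *+ 2)).
  by rewrite normal_pdfE.
have d1 : is_derive x 1 (fun x : R => - (x - m) ^+ 2 / (s ^+ 2 *+ 2)) (- (x - m) / s ^+ 2).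
  have d0 : is_derive x 1 (fun x : R => x - m) (1 - 0).
    exact: (is_deriveB (is_derive_id x (1 : R)) (is_derive_cst m x 1)).
  have := is_deriveM (is_deriveN (is_deriveM d0 d0)) (is_derive_cst ((s ^+ 2 *+ 2)^-1) x (1 : R)).
  rewrite scaler0 add0r /= => d2.
  apply: (@is_derive_eq _ _ _ (fun x : R => - (x - m) ^+ 2 / (s ^+ 2 *+ 2)) x 1 _ _ d2).
  by rewrite /cst /GRing.scale/= subr0 !mulr1; field.
have d2 := @is_derive1_comp _ expR (fun x : R => - (x - m) ^+ 2 / (s ^+ 2 *+ 2)) x _ _
  (is_derive_expR (- (x - m) ^+ 2 / (s ^+ 2 *+ 2))) d1.
have := is_deriveM (is_derive_cst (normal_peak s) x (1 : R)) d2.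
rewrite scaler0 addr0 => d3.
apply: (@is_derive_eq _ _ _ (fun x => normal_peak s * expR (- (x - m) ^+ 2 / (s ^+ 2 *+ 2))) x 1 _ _ d3).
by rewrite /cst /GRing.scale/=; ring.
Qed.

Let F (k : nat) (x : R) := (x - m) ^+ k * pdf x.

Let dF (r : nat) (x : R) : is_derive x 1 (F r) (r%:R * F r.-1 x - (s ^+ 2)^-1 * F r.+1 x).
Proof.
have d0 : is_derive x 1 (fun x : R => x - m) (1 - 0).
  exact: (is_deriveB (is_derive_id x (1 : R)) (is_derive_cst m x 1)).
have := is_deriveM (is_deriveX r d0) (is_derive_normal_pdf x) => d1.
have FE : F r = (fun x : R => x - m) ^+ r * pdf by apply/funext => y; rewrite !fctE.
rewrite FE; apply: is_derive_eq; rewrite !fctE.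
by rewrite /F /GRing.scale/= subr0 (exprS (x - m) r); field; exact: s0.
Qed.

Let cF (r : nat) : continuous (F r).
Proof.
move=> x; apply: differentiable_continuous; apply/derivable1_diffP.
by have [] := dF r x.
Qed.

Let F_decay (r : nat) : exists2 C : R, 0 <= C & forall x, `|F r x| * `|x - m| <= C.
Proof.
have [C C0 hC] := normal_tail r.+1; exists (C * normal_peak s').
  by rewrite mulr_ge0// normal_peak_ge0.
move=> x; rewrite /F normrM normrX (ger0_norm (normal_pdf_ge0 m s x)) mulrAC -exprSr.
apply: le_trans (hC x) _; rewrite ler_wpM2l//; exact: normal_pdf_ub.
Qed.

(** Integrating the derivative of (x - m)^r times the density, which vanishes
    at infinity. *)
Lemma normal_moment_rec (r : nat) :
  \int[mu]_x ((x - m) ^+ r.+1 * pdf x) = s ^+ 2 * r%:R * \int[mu]_x ((x - m) ^+ r.-1 * pdf x).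
Proof.
pose f x := r%:R * F r.-1 x - (s ^+ 2)^-1 * F r.+1 x.
have ii k : mu.-integrable setT (EFin \o F k) by exact: integrable_pow_pdf.
have iZ (c : R) k : mu.-integrable setT (EFin \o (fun x => c * F k x)).
  rewrite (_ : _ \o _ = (fun x => c%:E * (EFin \o F k) x)%E).
    exact: integrableZl.
  by apply/funext => x /=; rewrite EFinM.
have fi : mu.-integrable setT (EFin \o f).
  rewrite (_ : _ \o _ = ((EFin \o (fun x => (r%:R : R) * F r.-1 x)%R) \-
     (EFin \o (fun x => (s ^+ 2)^-1 * F r.+1 x)%R))%E).
    by apply: integrableB => //; exact: iZ.
  by apply/funext => x /=; rewrite EFinB.
suff : \int[mu]_x f x = 0.
  rewrite RintegralB//; try exact: iZ.
  rewrite !RintegralZl//; try exact: ii.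
  move/eqP; rewrite subr_eq0 => /eqP E.
  by rewrite -mulrA E mulrA divff ?mul1r// expf_neq0.
have cf : continuous f.
  move=> x; apply: cvgB; apply: cvgMr; exact: cF.
(* The integral over [-n, n] is the boundary term F r n - F r (-n), and tends to
   the integral over the line by domination. *)
have F0 : F r n%:R - F r (- n%:R) @[n --> \oo] --> (0 : R).
  have [C C0 hC] := F_decay r.
  have lim : 4 * C * n%:R `^ (- 1) @[n --> \oo] --> 4 * C * 0.
    by apply: cvgMr; exact: cvg_natr_powRN.
  rewrite mulr0 in lim; apply: (@norm_cvg0P _ _ _ _ _ _).1.
  apply: (squeeze_cvgr _ (cvg_cst 0) lim).
  near=> n; rewrite normr_ge0/=.
  have n0 : 0 < n%:R :> R by rewrite ltr0n; near: n; exists 1%N.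
  have nm : 2 * `|m| <= n%:R.
    near: n; exists (Num.truncn (2 * `|m|)).+1 => // k /= hk.
    by apply: le_trans (ltW (truncnS_gt _)) _; rewrite ler_nat.
  have half (x : R) : `|x| = n%:R -> `|F r x| <= 2 * C * n%:R `^ (- 1).
    move=> xn; rewrite powR_inv1 ?ler0n// ler_pdivlMr//.
    have h1 : n%:R / 2 <= `|x - m| by have := lerB_dist x m; rewrite xn; lra.
    have := hC x; have : `|F r x| * (n%:R / 2) <= `|F r x| * `|x - m| by rewrite ler_wpM2l.
    lra.
  apply: le_trans (ler_normB _ _) _.
  have := half n%:R (ger0_norm (ltW n0)); have := half (- n%:R).
  rewrite normrN (ger0_norm (ltW n0)) => /(_ erefl); lra.
have FTC (n : nat) : (0 < n)%N ->
    (\int[mu]_(x in `[(- n%:R : R)%R, (n%:R : R)%R]) (f x)%:E = (F r n%:R - F r (- n%:R))%:E)%E.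
  move=> n0; rewrite EFinB; apply: (@continuous_FTC2 _ f (F r)).
  - by rewrite -subr_gt0 opprK -natrD ltr0n addn_gt0 n0.
  - exact: continuous_subspaceT.
  - split.
    + by move=> x _; have [] := dF r x.
    + by apply: cvg_at_right_filter; exact: cF.
    + by apply: cvg_at_left_filter; exact: cF.
  - by move=> x _; rewrite derive1E; have [_] := dF r x.
pose fn (n : nat) := (EFin \o f) \_ `[(- n%:R : R), n%:R].
have mfn (n : nat) : measurable_fun setT (fn n).
  apply/(measurable_restrictT _ _).1; first exact: measurable_itv.
  by apply: measurable_funTS; exact: measurable_int fi.
have fcvg x : fn n x @[n --> \oo] --> (EFin \o f) x.
  apply: cvg_near_cst; exists (Num.truncn `|x|).+1 => // n /= hn.
  rewrite /fn patchE ifT// inE/= in_itv/= -ler_norml.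
  by apply: le_trans (ltW (truncnS_gt _)) _; rewrite ler_nat.
have fdom x n : (`|fn n x| <= `|(EFin \o f) x|)%E.
  by rewrite /fn patchE; case: ifP => // _; rewrite abse0.
have [_ _ cv] := @dominated_convergence _ (measurableTypeR R) _ mu _ measurableT fn
  (EFin \o f) (abse \o (EFin \o f)) mfn (measurable_int _ fi)
  (@aeW _ (measurableTypeR R) _ mu _ (fun x _ => fcvg x)) (integrable_abse fi)
  (@aeW _ (measurableTypeR R) _ mu _ (fun x n _ => fdom x n)).
have cv0 : (\int[mu]_x fn n x)%E @[n --> \oo] --> (0%R)%:E.
  have lim : (F r n%:R - F r (- n%:R))%:E @[n --> \oo] --> (0%R)%:E.
    by apply: (cvg_comp _ _ F0).
  apply: cvg_trans lim; apply: near_eq_cvg; near=> n; rewrite /= /fn -integral_mkcond FTC//.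
  by near: n; exists 1%N.
by rewrite /Rintegral (cvg_unique _ cv cv0).
Unshelve. all: by end_near.
Qed.

End normal_moments.

(** * Random variables with moments of all orders *)

Section all_moments.
Context d (T : measurableType d) {R : realType} (P : probability T R).
Implicit Types (f g : T -> R).

(** An algebra of random variables on which the expectation is linear without
    further integrability conditions. *)
Definition all_moments f := measurable_fun setT f /\
  forall k : nat, P.-integrable setT (EFin \o (fun x => f x ^+ k)).

Lemma dominated_integrable f g : measurable_fun setT f ->
  P.-integrable setT (EFin \o g) -> (forall x, `|f x| <= `|g x|) ->
  P.-integrable setT (EFin \o f).
Proof.
move=> mf ig fg; apply: (le_integrable measurableT _ _ ig).
  exact/measurable_EFinP.
by move=> x _ /=; rewrite lee_fin.
Qed.

Lemma integrable_normX f k : all_moments f ->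
  P.-integrable setT (EFin \o (fun x => `|f x| ^+ k)).
Proof.
move=> [mf hf]; apply: (dominated_integrable _ (hf k)).
  by apply: measurable_funX; exact: measurableT_comp.
by move=> x; rewrite normrX normr_id normrX.
Qed.

Lemma all_momentsD f g : all_moments f -> all_moments g ->
  all_moments (fun x => f x + g x).
Proof.
move=> hf hg; split=> [|k]; first by apply: measurable_funD; [exact: hf.1|exact: hg.1].
have h : P.-integrable setT (EFin \o (fun x => 2 ^+ k * (`|f x| ^+ k + `|g x| ^+ k))).
  rewrite (_ : _ \o _ = (fun x => (2 ^+ k)%:E * ((EFin \o (fun x => `|f x| ^+ k)%R) \+
    (EFin \o (fun x => `|g x| ^+ k)%R)) x)%E).
    by apply: integrableZl => //; apply: integrableD => //; exact: integrable_normX.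
  by apply/funext => x /=; rewrite -EFinD -EFinM.
apply: (dominated_integrable _ h).
  by apply: measurable_funX; apply: measurable_funD; [exact: hf.1|exact: hg.1].
move=> x; rewrite normrX [leRHS]ger0_norm; last by rewrite mulr_ge0 ?addr_ge0 ?exprn_ge0.
have fg : `|f x + g x| <= 2 * Num.max `|f x| `|g x|.
  apply: le_trans (ler_normD _ _) _; rewrite mulrDl mul1r; apply: lerD.
    by rewrite le_max lexx.
  by rewrite le_max lexx orbT.
apply: (@le_trans _ _ ((2 * Num.max `|f x| `|g x|) ^+ k)).
  by rewrite lerXn2r// nnegrE mulr_ge0// le_max normr_ge0.
rewrite exprMn ler_wpM2l ?exprn_ge0// /Num.max; case: ifP => _.
  by rewrite lerDr exprn_ge0.
by rewrite lerDl exprn_ge0.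
Qed.

Lemma all_momentsM f g : all_moments f -> all_moments g ->
  all_moments (fun x => f x * g x).
Proof.
move=> hf hg; split=> [|k]; first by apply: measurable_funM; [exact: hf.1|exact: hg.1].
have h := integrableD measurableT (hf.2 (k * 2)%N) (hg.2 (k * 2)%N).
apply: (@dominated_integrable _ (fun x => f x ^+ (k * 2) + g x ^+ (k * 2)) _ h).
  by apply: measurable_funX; apply: measurable_funM; [exact: hf.1|exact: hg.1].
move=> x; rewrite !exprM exprMn [leRHS]ger0_norm ?addr_ge0 ?sqr_ge0//.
move: (f x ^+ k) (g x ^+ k) => a b.
rewrite ler_norml; have := sqr_ge0 (a + b); have := sqr_ge0 (a - b).
have := sqr_ge0 a; have := sqr_ge0 b; by move=> *; apply/andP; split; nra.
Qed.

Lemma all_moments_cst (c : R) : all_moments (fun=> c).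
Proof.
split=> [|k]; first exact: measurable_cst.
by apply: finite_measure_integrable_cst.
Qed.

Lemma all_momentsZ (c : R) f : all_moments f -> all_moments (fun x => c * f x).
Proof. by move=> hf; apply: all_momentsM => //; exact: all_moments_cst. Qed.

Lemma all_momentsN f : all_moments f -> all_moments (fun x => - f x).
Proof.
move=> hf; have := all_momentsZ (-1) hf.
by congr all_moments; apply/funext => x; rewrite mulN1r.
Qed.

Lemma all_momentsX f k : all_moments f -> all_moments (fun x => f x ^+ k).
Proof.
move=> hf; elim: k => [|k IH]; first exact: all_moments_cst.
have := all_momentsM hf IH.
by congr all_moments; apply/funext => x; rewrite exprS.
Qed.

Lemma all_moments_sum (I : Type) (s : seq I) (F : I -> T -> R) :
  (forall i, all_moments (F i)) -> all_moments (fun x => \sum_(i <- s) F i x).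
Proof.
move=> hF; elim: s => [|i s IH].
  have := all_moments_cst 0.
  by congr all_moments; apply/funext => x; rewrite big_nil.
have := all_momentsD (hF i) IH.
by congr all_moments; apply/funext => x; rewrite big_cons.
Qed.

Lemma all_moments_integrable f : all_moments f -> P.-integrable setT (EFin \o f).
Proof. by move=> [_ /(_ 1%N)]. Qed.

Lemma ExD f g : all_moments f -> all_moments g ->
  \int[P]_x (f x + g x) = \int[P]_x f x + \int[P]_x g x.
Proof. by move=> hf hg; rewrite RintegralD//; exact: all_moments_integrable. Qed.

Lemma ExZ (c : R) f : all_moments f -> \int[P]_x (c * f x) = c * \int[P]_x f x.
Proof. by move=> hf; rewrite RintegralZl//; exact: all_moments_integrable. Qed.

Lemma Ex_cst (c : R) : \int[P]_x c = c.
Proof. by rewrite Rintegral_cst//= probability_setT mulr1. Qed.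

Lemma Ex_sum (I : Type) (s : seq I) (F : I -> T -> R) : (forall i, all_moments (F i)) ->
  \int[P]_x (\sum_(i <- s) F i x) = \sum_(i <- s) \int[P]_x F i x.
Proof.
move=> hF; elim: s => [|i s IH].
  by rewrite big_nil; under eq_Rintegral do rewrite big_nil; exact: Ex_cst.
rewrite big_cons -IH -ExD//; last exact: all_moments_sum.
by apply: eq_Rintegral => x _; rewrite big_cons.
Qed.

Lemma Ex_le f g : all_moments f -> all_moments g -> (forall x, f x <= g x) ->
  \int[P]_x f x <= \int[P]_x g x.
Proof.
by move=> hf hg fg; apply: le_Rintegral => //; exact: all_moments_integrable.
Qed.

Lemma integral_law (Y : T -> measurableTypeR R)
    (nu : {measure set (measurableTypeR R) -> \bar R}) :
  measurable_fun setT Y -> (forall A, measurable A -> P (Y @^-1` A) = nu A) ->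
  forall g : measurableTypeR R -> R, measurable_fun setT g ->
  nu.-integrable setT (EFin \o g) ->
  P.-integrable setT (EFin \o (g \o Y)) /\ \int[P]_x g (Y x) = \int[nu]_y g y.
Proof.
move=> mY hY g mg /integrableP[mEg ig].
have eqm (f : measurableTypeR R -> \bar R) :
    (\int[pushforward P Y]_y f y = \int[nu]_y f y)%E.
  by apply: eq_measure_integral => A mA _; exact: hY.
have iP : P.-integrable setT (EFin \o (g \o Y)).
  apply/integrableP; split; first by apply/measurable_EFinP; exact: measurableT_comp.
  have := ge0_integral_pushforward mY P measurableT
    (f := fun y => `|(g y)%:E|%E).
  rewrite preimage_setT => <- //=.
  - by rewrite eqm.
  - by apply/measurable_EFinP; exact: measurableT_comp.
split=> //; rewrite /Rintegral -eqm (integral_pushforward mY)//.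
Qed.

(** For a normal law this is the integration by parts of its moments, and a
    Dirac mass satisfies the same relation with variance 0. The relation of
    order 0 identifies the parameter m with the mean. *)
Lemma gaussian_moments (Y : T -> R) : measurable_fun setT Y -> gaussian_rv P Y ->
  (\int[P]_x (Y x)%:E = 0)%E ->
  all_moments Y /\ (forall r : nat,
    \int[P]_x (Y x ^+ r.+2) = r.+1%:R * \int[P]_x (Y x ^+ 2) * \int[P]_x (Y x ^+ r)).
Proof.
move=> mY [m [s hY]] Y0.
have mpow k : measurable_fun setT (fun x : measurableTypeR R => (x - m) ^+ k).
  by apply: measurable_funX; apply: measurable_funB.
have [v [mom rec]] : exists v : R,
    (forall k, P.-integrable setT (EFin \o (fun x => (Y x - m) ^+ k))) /\
    (forall r, \int[P]_x ((Y x - m) ^+ r.+1) = v * r%:R * \int[P]_x ((Y x - m) ^+ r.-1)).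
  have [s0|s0] := eqVneq s 0.
    have law (A : set (measurableTypeR R)) : measurable A ->
        P (Y @^-1` A) = \d_(m : measurableTypeR R) A.
      by move=> mA; have := hY A mA; rewrite s0 eqxx.
    have h k : P.-integrable setT (EFin \o (fun x => (Y x - m) ^+ k)) /\
        \int[P]_x ((Y x - m) ^+ k) = (m - m) ^+ k.
      have [|i E] := integral_law mY law (mpow k).
      - apply/integrableP; split; first exact/measurable_EFinP.
        rewrite integral_dirac//; first by rewrite diracT mul1e ltry.
        by apply: measurableT_comp => //; exact/measurable_EFinP.
      - split=> //; rewrite E /Rintegral integral_dirac//; last exact/measurable_EFinP.
        by rewrite diracT mul1e.
    exists 0; split=> [k|r]; first by have [] := h k.
    by have [_ ->] := h r.+1; rewrite subrr expr0n !mul0r.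
  have law (A : set (measurableTypeR R)) : measurable A ->
      P (Y @^-1` A) = normal_prob m s A.
    by move=> mA; have := hY A mA; rewrite (negbTE s0).
  have h k : P.-integrable setT (EFin \o (fun x => (Y x - m) ^+ k)) /\
      \int[P]_x ((Y x - m) ^+ k) = \int[lebesgue_measure]_x ((x - m) ^+ k * normal_pdf m s x).
    have [i1 E1] := integral_normal_prob (mpow k) (integrable_pow_pdf m s0 k).
    by have [i2 E2] := integral_law mY law (mpow k) i1; rewrite -E1.
  exists (s ^+ 2); split=> [k|r]; first by have [] := h k.
  by have [_ ->] := h r.+1; have [_ ->] := h r.-1; exact: normal_moment_rec.
have m0 : m = 0.
  have := rec 0%N; rewrite mulr0 mul0r => E.
  have iY : P.-integrable setT (EFin \o Y).
    have := integrableD measurableT (mom 1%N) (finite_measure_integrable_cst P m measurableT).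
    congr (_.-integrable _); apply/funext => x /=.
    by rewrite -EFinD expr1 subrK.
  have := RintegralB measurableT iY (finite_measure_integrable_cst P m measurableT).
  rewrite Ex_cst {2}/Rintegral Y0 /= sub0r => E2.
  by apply/eqP; rewrite -oppr_eq0 -E2 -E.
subst m.
have YE k : (fun x => (Y x - 0) ^+ k) = (fun x => Y x ^+ k).
  by apply/funext => x; rewrite subr0.
split; first by split=> // k; rewrite -YE.
have {}rec r : \int[P]_x (Y x ^+ r.+1) = v * r%:R * \int[P]_x (Y x ^+ r.-1).
  by have := rec r; rewrite !YE.
have vE : v = \int[P]_x (Y x ^+ 2).
  by rewrite rec /= mulr1; under eq_Rintegral do rewrite expr0; rewrite Ex_cst mulr1.
by move=> r; rewrite -vE rec /=; ring.
Qed.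

End all_moments.

(** * Gaussian integration by parts *)

(** A field of characteristic 0 is infinite. *)
Lemma eq_poly_horner (R : numFieldType) (p q : {poly R}) :
  (forall t, p.[t] = q.[t]) -> p = q.
Proof.
move=> pq; apply/eqP; rewrite -subr_eq0; apply/negPn/negP => d0.
pose rs := [seq (i%:R : R) | i <- iota 0 (size (p - q))].
have := @max_poly_roots _ (p - q) rs d0.
rewrite size_map size_iota ltnn => h; suff : false by [].
apply: h; first by apply/allP => x _; rewrite rootE hornerD hornerN pq subrr.
rewrite map_inj_uniq ?iota_uniq// => i j /eqP; rewrite eqr_nat => /eqP.
exact.
Qed.

Lemma coef1M (R : nzRingType) (p q : {poly R}) :
  (p * q)`_1 = p`_0 * q`_1 + p`_1 * q`_0.
Proof. by rewrite coefM big_ord_recr big_ord1. Qed.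

Section integration_by_parts.
Context d (T : measurableType d) {R : realType} (P : probability T R).
Variables (N : nat) (Z : 'I_N -> T -> R).
Hypothesis hZ : forall i, all_moments P (Z i).

Definition linear_form (a : 'I_N -> R) (x : T) : R := \sum_(i < N) a i * Z i x.

(** The moments of all linear forms characterise a centred Gaussian vector, and
    are the form in which the Gaussian property is convenient here. *)
Hypothesis mean0 : forall a, \int[P]_x linear_form a x = 0.
Hypothesis gauss : forall a (r : nat), \int[P]_x (linear_form a x ^+ r.+2) =
  r.+1%:R * \int[P]_x (linear_form a x ^+ 2) * \int[P]_x (linear_form a x ^+ r).

Let lin_moments a : all_moments P (linear_form a).
Proof. by apply: all_moments_sum => i; exact: all_momentsZ. Qed.

Let shift (a : 'I_N -> R) i t j := a j + t * (j == i)%:R.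

Let linear_form_shift a i t x :
  linear_form (shift a i t) x = linear_form a x + t * Z i x.
Proof.
rewrite /linear_form /shift (eq_bigr (fun j => a j * Z j x + t * ((j == i)%:R * Z j x))).
  rewrite big_split/=; congr (_ + _); rewrite -mulr_sumr; congr (_ * _).
  rewrite (bigD1 i)//= eqxx mul1r big1 ?addr0// => j /negbTE ->.
  by rewrite mul0r.
by move=> j _; rewrite mulrDl mulrA.
Qed.

Let linear_form1 i x : linear_form (fun j => (j == i)%:R) x = Z i x.
Proof.
by rewrite /linear_form (bigD1 i)//= eqxx mul1r big1 ?addr0// => j /negbTE ->; rewrite mul0r.
Qed.

(** The expectation of F (l + t Z)^r as a polynomial in t. *)
Let pl (F : T -> R) (a : 'I_N -> R) (i : 'I_N) (r : nat) : {poly R} :=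
  \sum_(j < r.+1) ('C(r, j)%:R * \int[P]_x (F x * linear_form a x ^+ (r - j) * Z i x ^+ j)) *: 'X^j.

Let pl_term F a i (u v : nat) : all_moments P F ->
  all_moments P (fun x => F x * linear_form a x ^+ u * Z i x ^+ v).
Proof.
move=> hF; apply: all_momentsM; last exact: all_momentsX.
by apply: all_momentsM => //; exact: all_momentsX.
Qed.

Let pl_horner F a i r t : all_moments P F ->
  (pl F a i r).[t] = \int[P]_x (F x * linear_form (shift a i t) x ^+ r).
Proof.
move=> hF; rewrite /pl horner_sum.
transitivity (\int[P]_x (\sum_(j < r.+1)
    ('C(r, j)%:R * t ^+ j) * (F x * linear_form a x ^+ (r - j) * Z i x ^+ j))).
  rewrite Ex_sum; last by move=> j; apply: all_momentsZ; exact: pl_term.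
  apply: eq_bigr => j _; rewrite hornerZ hornerXn ExZ; last exact: pl_term.
  by rewrite mulrAC.
apply: eq_Rintegral => x _; rewrite linear_form_shift exprDn mulr_sumr.
apply: eq_bigr => j _; rewrite exprMn -mulr_natl; ring.
Qed.

Let pl_coef1 F a i r : (pl F a i r)`_1 =
  r%:R * \int[P]_x (F x * linear_form a x ^+ r.-1 * Z i x).
Proof.
rewrite /pl coef_sum; case: r => [|r].
  rewrite big_ord1 coefZ coefXn mulr0 mul0r//.
rewrite big_ord_recl/= big_ord_recl/= !coefZ !coefXn/= mulr0 add0r mulr1.
rewrite big1; last by move=> j _; rewrite coefZ coefXn /= mulr0.
by rewrite addr0 /bump/= bin1 subn1 /=; congr (_ * _).
Qed.

Let cov k a := \int[P]_x (Z k x * linear_form a x).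
Let C k j := \int[P]_x (Z k x * Z j x).

Let cov_shift k a i t : cov k (shift a i t) = cov k a + t * C k i.
Proof.
rewrite /cov /C -ExZ; last exact: all_momentsM.
rewrite -ExD; [|exact: all_momentsM|by apply: all_momentsZ; exact: all_momentsM].
by apply: eq_Rintegral => x _; rewrite linear_form_shift; ring.
Qed.

Let one_moments : all_moments P (fun=> 1). Proof. exact: all_moments_cst. Qed.

(** Polarisation: the moment relation for l + t Z_k is an identity between
    polynomials in t, whose coefficients of degree one give the claim. *)
Let ibp_power k a r : \int[P]_x (Z k x * linear_form a x ^+ r) =
  r%:R * cov k a * \int[P]_x (linear_form a x ^+ r.-1).
Proof.
have [n] := ubnP r; elim: n r => // n IH [|[|r]] rn.
- rewrite mul0r mul0r -(mean0 (fun j => (j == k)%:R)).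
  by apply: eq_Rintegral => x _; rewrite expr0 mulr1 linear_form1.
- rewrite /= mul1r; under [X in _ * X]eq_Rintegral do rewrite expr0.
  by rewrite Ex_cst mulr1 /cov; apply: eq_Rintegral => x _; rewrite expr1.
have {}IH := IH r (ltn_trans (ltnSn r) rn).
have E1 s b : \int[P]_x (1 * linear_form b x ^+ s) = \int[P]_x (linear_form b x ^+ s).
  by apply: eq_Rintegral => x _; rewrite mul1r.
have Zl s : \int[P]_x (1 * linear_form a x ^+ s * Z k x) = \int[P]_x (Z k x * linear_form a x ^+ s).
  by apply: eq_Rintegral => x _; ring.
have E : pl (fun=> 1) a k r.+3 = r.+2%:R *: (pl (fun=> 1) a k 2 * pl (fun=> 1) a k r.+1).
  apply: eq_poly_horner => t; rewrite hornerZ hornerM !pl_horner//.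
  by rewrite !E1 gauss mulrA.
have := congr1 (fun p : {poly R} => p`_1) E.
rewrite coefZ coef1M !pl_coef1.
have p0 s : (pl (fun=> 1) a k s)`_0 = \int[P]_x (linear_form a x ^+ s).
  rewrite -horner_coef0 pl_horner//; apply: eq_Rintegral => x _.
  by rewrite linear_form_shift mul0r addr0 mul1r.
rewrite !p0 /= !Zl.
have -> : \int[P]_x (Z k x * linear_form a x ^+ 1) = cov k a.
  by apply: eq_Rintegral => x _; rewrite expr1.
rewrite IH => {}E.
have hr : \int[P]_x (linear_form a x ^+ 2) * (r%:R * \int[P]_x (linear_form a x ^+ r.-1)) =
    \int[P]_x (linear_form a x ^+ r.+1).
  case: r {rn IH E} => [|r].
    rewrite mul0r mulr0 -(mean0 a); apply: eq_Rintegral => x _; by rewrite expr1.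
  by rewrite (gauss a r) /=; ring.
have r3 : r.+3%:R != 0 :> R by rewrite pnatr_eq0.
apply: (mulfI r3); rewrite E.
have -> : \int[P]_x (linear_form a x ^+ 2) *
   (r.+1%:R * (r%:R * cov k a * \int[P]_x (linear_form a x ^+ r.-1))) =
   r.+1%:R * cov k a * \int[P]_x (linear_form a x ^+ r.+1) by rewrite -hr; ring.
rewrite -!natr1; ring.
Qed.

(** Gaussian integration by parts for G l^r: [D j] plays the part of the j-th
    partial derivative of the polynomial G in the variables Z. The power of an
    arbitrary linear form l is what makes the class closed under multiplication
    by the variables. *)
Definition by_parts (G : T -> R) (D : 'I_N -> T -> R) :=
  [/\ all_moments P G, forall j, all_moments P (D j) & forall k a r,
    \int[P]_x (Z k x * G x * linear_form a x ^+ r) =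
    \sum_(j < N) C k j * \int[P]_x (D j x * linear_form a x ^+ r) +
    r%:R * cov k a * \int[P]_x (G x * linear_form a x ^+ r.-1)].

Let by_parts1 : by_parts (fun=> 1) (fun _ _ => 0).
Proof.
split=> // [j|k a r]; first exact: all_moments_cst.
rewrite big1 ?add0r => [|j _]; last first.
  by under eq_Rintegral do rewrite mul0r; rewrite Ex_cst mulr0.
under eq_Rintegral do rewrite mulr1; rewrite ibp_power; congr (_ * _).
by apply: eq_Rintegral => x _; rewrite mul1r.
Qed.

Let by_partsZ (c : R) G D : by_parts G D ->
  by_parts (fun x => c * G x) (fun j x => c * D j x).
Proof.
move=> [hG hD h]; split=> [|j|k a r]; [exact: all_momentsZ|exact: all_momentsZ|].
have hl s F : all_moments P F -> all_moments P (fun x => F x * linear_form a x ^+ s).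
  by move=> hF; apply: all_momentsM => //; exact: all_momentsX.
transitivity (c * \int[P]_x (Z k x * G x * linear_form a x ^+ r)).
  rewrite -ExZ; last by apply: hl; exact: all_momentsM.
  by apply: eq_Rintegral => x _; ring.
rewrite h mulrDr mulr_sumr; congr (_ + _).
  apply: eq_bigr => j _; rewrite mulrCA -(ExZ c (hl _ _ (hD j))).
  by congr (_ * _); apply: eq_Rintegral => x _; rewrite mulrA.
rewrite mulrCA -(ExZ c (hl _ _ hG)).
by congr (_ * _); apply: eq_Rintegral => x _; rewrite mulrA.
Qed.

Let by_partsD G D G' D' : by_parts G D -> by_parts G' D' ->
  by_parts (fun x => G x + G' x) (fun j x => D j x + D' j x).
Proof.
move=> [hG hD h] [hG' hD' h']; split=> [|j|k a r]; [exact: all_momentsD|exact: all_momentsD|].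
have hl s F : all_moments P F -> all_moments P (fun x => F x * linear_form a x ^+ s).
  by move=> hF; apply: all_momentsM => //; exact: all_momentsX.
transitivity (\int[P]_x (Z k x * G x * linear_form a x ^+ r) +
    \int[P]_x (Z k x * G' x * linear_form a x ^+ r)).
  rewrite -ExD; [|by apply: hl; exact: all_momentsM..].
  by apply: eq_Rintegral => x _; ring.
have split_ F F' s : all_moments P F -> all_moments P F' ->
    \int[P]_x ((F x + F' x) * linear_form a x ^+ s) =
    \int[P]_x (F x * linear_form a x ^+ s) + \int[P]_x (F' x * linear_form a x ^+ s).
  move=> hF hF'; rewrite -ExD; [|exact: hl..].
  by apply: eq_Rintegral => x _; rewrite mulrDl.
rewrite h h' split_// addrACA -big_split/= mulrDr; congr (_ + _).
by apply: eq_bigr => j _; rewrite split_// mulrDr.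
Qed.

Let by_parts_sum (I : Type) (s : seq I) (G : I -> T -> R) (D : I -> 'I_N -> T -> R) :
  (forall i, by_parts (G i) (D i)) ->
  by_parts (fun x => \sum_(i <- s) G i x) (fun j x => \sum_(i <- s) D i j x).
Proof.
move=> h; elim: s => [|i s IH].
  have := by_partsZ 0 by_parts1; congr by_parts.
    by apply/funext => x; rewrite big_nil mul0r.
  by apply/funext => j; apply/funext => x; rewrite big_nil mul0r.
have := by_partsD (h i) IH; congr by_parts.
  by apply/funext => x; rewrite big_cons.
by apply/funext => j; apply/funext => x; rewrite big_cons.
Qed.

(** Comparing the coefficients of t in the identity for the linear form
    l + t Z_i. *)
Let by_partsM i G D : by_parts G D ->
  by_parts (fun x => G x * Z i x) (fun j x => D j x * Z i x + (j == i)%:R * G x).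
Proof.
move=> [hG hD h]; split=> [|j|k a r]; first exact: all_momentsM.
  by apply: all_momentsD; [exact: all_momentsM|exact: all_momentsZ].
have hZG : all_moments P (fun x => Z k x * G x) by exact: all_momentsM.
have E : pl (fun x => Z k x * G x) a i r.+1 =
    \sum_(j < N) C k j *: pl (D j) a i r.+1 +
    (r.+1%:R *: (((cov k a)%:P + C k i *: 'X) * pl G a i r)).
  apply: eq_poly_horner => t; rewrite pl_horner// h cov_shift.
  rewrite [RHS]hornerD [X in _ = _ + X]hornerZ hornerM (pl_horner _ _ _ _ hG).
  rewrite hornerD hornerC hornerZ hornerX [X in _ = X + _]horner_sum mulrA.
  rewrite [C k i * t]mulrC; congr (_ + _); apply: eq_bigr => j _.
  by rewrite [RHS]hornerZ pl_horner.
have := congr1 (fun p : {poly R} => p`_1) E.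
have p0 s : (pl G a i s)`_0 = \int[P]_x (G x * linear_form a x ^+ s).
  rewrite -horner_coef0 pl_horner//; apply: eq_Rintegral => x _.
  by rewrite linear_form_shift mul0r addr0.
have -> : (\sum_(j < N) C k j *: pl (D j) a i r.+1 +
    (r.+1%:R *: (((cov k a)%:P + C k i *: 'X) * pl G a i r)))`_1 =
    \sum_(j < N) C k j * (r.+1%:R * \int[P]_x (D j x * linear_form a x ^+ r * Z i x)) +
    r.+1%:R * (cov k a * (r%:R * \int[P]_x (G x * linear_form a x ^+ r.-1 * Z i x)) +
     C k i * \int[P]_x (G x * linear_form a x ^+ r)).
  rewrite coefD coef_sum coefZ coef1M !coefD !coefC !coefZ !coefX /= p0 pl_coef1.
  rewrite mulr0 addr0 add0r mulr1; congr (_ + _).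
  by apply: eq_bigr => j _; rewrite coefZ pl_coef1.
rewrite pl_coef1 /= => {}E.
have r1 : r.+1%:R != 0 :> R by rewrite pnatr_eq0.
apply: (mulfI r1).
have hl s F : all_moments P F -> all_moments P (fun x => F x * linear_form a x ^+ s).
  by move=> hF; apply: all_momentsM => //; exact: all_momentsX.
transitivity (r.+1%:R * \int[P]_x (Z k x * G x * linear_form a x ^+ r * Z i x)).
  by congr (_ * _); apply: eq_Rintegral => x _; ring.
rewrite E {E}.
have -> : \sum_(j < N) C k j * \int[P]_x ((D j x * Z i x + (j == i)%:R * G x) *
      linear_form a x ^+ r) =
    \sum_(j < N) C k j * \int[P]_x (D j x * linear_form a x ^+ r * Z i x) +
    C k i * \int[P]_x (G x * linear_form a x ^+ r).
  rewrite [X in _ = _ + X](_ : _ = \sum_(j < N) C k j * ((j == i)%:R *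
      \int[P]_x (G x * linear_form a x ^+ r))); last first.
    rewrite (bigD1 i)//= eqxx mul1r big1 ?addr0// => j /negbTE ->.
    by rewrite mul0r mulr0.
  rewrite -big_split/=; apply: eq_bigr => j _; rewrite -mulrDr; congr (_ * _).
  rewrite -(ExZ _ (hl _ _ hG)) -ExD; last 2 first.
  - by apply: all_momentsM => //; exact: hl.
  - by apply: all_momentsZ; exact: hl.
  by apply: eq_Rintegral => x _; ring.
have -> : \int[P]_x (G x * Z i x * linear_form a x ^+ r.-1) =
    \int[P]_x (G x * linear_form a x ^+ r.-1 * Z i x).
  by apply: eq_Rintegral => x _; ring.
have -> : \sum_(j < N) C k j * (r.+1%:R * \int[P]_x (D j x * linear_form a x ^+ r * Z i x)) =
    r.+1%:R * \sum_(j < N) C k j * \int[P]_x (D j x * linear_form a x ^+ r * Z i x).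
  by rewrite mulr_sumr; apply: eq_bigr => j _; rewrite mulrCA.
ring.
Qed.

Let c := \sum_(i < N) C i i.
Let U x := \sum_(i < N) Z i x ^+ 2 - c.

(** The Leibniz rule for the product with U, whose j-th derivative is 2 Z_j. *)
Let by_partsU G D : by_parts G D ->
  by_parts (fun x => G x * U x) (fun j x => D j x * U x + G x * (2 * Z j x)).
Proof.
move=> h; have := by_partsD (by_parts_sum (index_enum 'I_N)
  (fun i => by_partsM i (by_partsM i h))) (by_partsZ (- c) h); congr by_parts.
  apply/funext => x; rewrite /U mulrBr mulr_sumr mulNr (mulrC c).
  by congr (_ - _); apply: eq_bigr => i _; ring.
apply/funext => j; apply/funext => x; rewrite /U.
have -> : G x * (2 * Z j x) = \sum_(i < N) (j == i)%:R * (G x * (2 * Z i x)).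
  rewrite (bigD1 j)//= eqxx mul1r big1 ?addr0// => i /negbTE.
  by rewrite eq_sym => ->; rewrite mul0r.
rewrite mulrBr mulr_sumr [in RHS]addrAC -big_split/= mulNr (mulrC c); congr (_ - _).
by apply: eq_bigr => i _; ring.
Qed.

Let by_parts_power q : by_parts (fun x => U x ^+ q)
  (fun j x => q%:R * U x ^+ q.-1 * (2 * Z j x)).
Proof.
elim: q => [|q IH].
  have := by_parts1; congr by_parts.
  by apply/funext => j; apply/funext => x; rewrite !mul0r.
have := by_partsU IH; congr by_parts.
  by apply/funext => x; rewrite exprSr.
apply/funext => j; apply/funext => x; rewrite /=; case: q {IH} => [|q].
  by ring.
by rewrite -[in RHS]natr1 exprSr /=; ring.
Qed.

Let U_moments : all_moments P U.
Proof.
apply: all_momentsD; last exact: all_moments_cst.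
by apply: all_moments_sum => i; exact: all_momentsX.
Qed.

(** E[Z_k (Z_k U^q)] integrated by parts in its first factor; the derivative of
    the second factor Z_k gives the variances, which cancel with c. *)
Let quadratic_recursion q : \int[P]_x (U x ^+ q.+1) =
  \int[P]_x (2 * q%:R * (U x ^+ q.-1 * \sum_(k < N) \sum_(j < N) C k j * (Z j x * Z k x))).
Proof.
have hk k : \int[P]_x (Z k x ^+ 2 * U x ^+ q) = C k k * \int[P]_x (U x ^+ q) +
    \int[P]_x (2 * q%:R * (U x ^+ q.-1 * \sum_(j < N) C k j * (Z j x * Z k x))).
  have [_ _ /(_ k (fun j => (j == k)%:R) 1%N)] := by_parts_power q.
  have -> : cov k (fun j => (j == k)%:R) = C k k.
    by apply: eq_Rintegral => x _; rewrite linear_form1.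
  rewrite mul1r.
  under [X in _ + _ * X]eq_Rintegral do rewrite expr0 mulr1.
  under [X in X = _]eq_Rintegral do rewrite expr1 linear_form1 mulrAC -expr2.
  move=> ->; rewrite addrC; congr (_ + _).
  rewrite (eq_bigr (fun j => \int[P]_x (C k j * (q%:R * U x ^+ q.-1 * (2 * Z j x) * Z k x)))).
    rewrite -Ex_sum.
      apply: eq_Rintegral => x _; rewrite !mulr_sumr; apply: eq_bigr => j _; ring.
    move=> j; apply/all_momentsZ/all_momentsM => //; apply: all_momentsM; last exact: all_momentsZ.
    by apply/all_momentsZ/all_momentsX.
  move=> j _; rewrite -ExZ; last first.
    apply: all_momentsM; last exact: all_momentsX.
    by apply: all_momentsM; [exact/all_momentsZ/all_momentsX|exact: all_momentsZ].
  by apply: eq_Rintegral => x _; rewrite expr1 linear_form1.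
transitivity (\sum_(k < N) \int[P]_x (Z k x ^+ 2 * U x ^+ q) - c * \int[P]_x (U x ^+ q)).
  rewrite -ExZ; last exact: all_momentsX.
  rewrite -Ex_sum; last by move=> k; apply: all_momentsM; exact: all_momentsX.
  rewrite -RintegralB//; last 2 first.
  - apply/all_moments_integrable/all_moments_sum => k.
    by apply: all_momentsM; exact: all_momentsX.
  - exact/all_moments_integrable/all_momentsZ/all_momentsX.
  by apply: eq_Rintegral => x _; rewrite exprS {1}/U mulrBl mulr_suml.
rewrite (eq_bigr _ (fun k _ => hk k)) big_split/= -mulr_suml -/c.
rewrite [X in X - _]addrC addrK -Ex_sum.
  by apply: eq_Rintegral => x _; rewrite !mulr_sumr.
move=> k; apply/all_momentsZ/all_momentsM; first exact: all_momentsX.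
by apply: all_moments_sum => j; apply/all_momentsZ/all_momentsM.
Qed.

(** Moments of a centred quadratic form in nonnegatively correlated variables:
    the recursion bounds the moment of order 2p + 2 by the previous even one,
    since the quadratic form of the covariance matrix is at most [rho] times the
    sum of squares. *)
Lemma quadratic_moments (rho : R) (p : nat) : (forall k j, 0 <= C k j) ->
  (forall k, \sum_(j < N) C k j <= rho) -> 0 <= rho ->
  \int[P]_x (U x ^+ (2 * p)) <=
    (\prod_(j < p) (4 * (2 * j%:R + 1) ^+ 2)) * (rho * (rho + c)) ^+ p.
Proof.
move=> C0 row rho0.
have c0 : 0 <= c by exact: sumr_ge0.
have form x : \sum_(k < N) \sum_(j < N) C k j * (Z j x * Z k x) <= rho * (U x + c).
  have -> : U x + c = \sum_(k < N) Z k x ^+ 2 by rewrite /U subrK.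
  have half k j : C k j * (Z j x * Z k x) <=
      2^-1 * (C k j * Z k x ^+ 2) + 2^-1 * (C j k * Z j x ^+ 2).
    have -> : C j k = C k j by apply: eq_Rintegral => y _; rewrite mulrC.
    have := C0 k j; have := sqr_ge0 (Z k x - Z j x); nra.
  apply: le_trans (ler_sum _ (fun k _ => ler_sum _ (fun j _ => half k j))) _.
  under eq_bigr do rewrite big_split/=.
  rewrite big_split/= [X in _ + X]exchange_big/= -mulr2n -[leLHS]mulr_natl.
  rewrite [leLHS]mulr_sumr [leRHS]mulr_sumr; apply: ler_sum => k _.
  rewrite -mulr_sumr mulrA divff ?mul1r// -mulr_suml ler_wpM2r ?sqr_ge0//.
elim: p => [|p IH].
  by rewrite muln0 big_ord0 !expr0 mul1r; under eq_Rintegral do rewrite expr0; rewrite Ex_cst.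
pose A : R := 2 * (2 * p%:R + 1) * rho.
have A0 : 0 <= A by rewrite mulr_ge0// mulr_ge0// addr_ge0// mulr_ge0// ler0n.
have hU q : all_moments P (fun x => U x ^+ q) by exact: all_momentsX.
have step : \int[P]_x (U x ^+ (2 * p).+2) <=
    \int[P]_x (2^-1 * U x ^+ (2 * p).+2 + (2^-1 * A ^+ 2 + A * c) * U x ^+ (2 * p)).
  rewrite [leLHS]quadratic_recursion; apply: Ex_le.
  - apply/all_momentsZ/all_momentsM => //.
    apply: all_moments_sum => k; apply: all_moments_sum => j.
    exact/all_momentsZ/all_momentsM.
  - by apply: all_momentsD; exact: all_momentsZ.
  move=> x; rewrite /= [U x ^+ (2 * p).+2]exprSr [U x ^+ (2 * p).+1]exprSr.
  have -> : ((2 * p).+1%:R : R) = 2 * p%:R + 1 by rewrite -natr1 natrM.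
  have V0 : 0 <= U x ^+ (2 * p) by rewrite exprM exprn_ge0// sqr_ge0.
  move: (U x ^+ (2 * p)) V0 (form x) => V V0 h.
  apply: (@le_trans _ _ (V * (A * (U x + c)))).
    rewrite mulrCA ler_wpM2l// /A -[leRHS]mulrA ler_wpM2l//.
  (* A U is at most (U^2 + A^2) / 2: half of the moment of order 2p + 2 is
     absorbed on the left. *)
  have -> : 2^-1 * (V * U x * U x) + (2^-1 * A ^+ 2 + A * c) * V =
    V * (2^-1 * (U x * U x) + (2^-1 * A ^+ 2 + A * c)) by ring.
  rewrite ler_wpM2l//; have := sqr_ge0 (U x - A); nra.
rewrite ExD in step; [|exact: all_momentsZ..].
rewrite !ExZ// in step.
have {}step : \int[P]_x (U x ^+ (2 * p).+2) <= (A ^+ 2 + 2 * A * c) * \int[P]_x (U x ^+ (2 * p)).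
  move: step; set u := \int[P]_x (U x ^+ (2 * p).+2); set v := \int[P]_x _ => step.
  have -> : (A ^+ 2 + 2 * A * c) * v = 2 * ((2^-1 * A ^+ 2 + A * c) * v) by field.
  lra.
rewrite (_ : 2 * p.+1 = (2 * p).+2)%N; last by lia.
apply: (le_trans step); rewrite big_ord_recr/= [_ ^+ p.+1]exprSr.
rewrite [leRHS]mulrACA [leRHS]mulrC.
have AA0 : 0 <= A ^+ 2 + 2 * A * c by rewrite addr_ge0 ?sqr_ge0// !mulr_ge0.
apply: le_trans (ler_wpM2l AA0 IH) _; rewrite ler_wpM2r//.
  by rewrite mulr_ge0 ?exprn_ge0 ?mulr_ge0 ?addr_ge0//; apply: prodr_ge0 => j _; rewrite mulr_ge0// sqr_ge0.
rewrite /A; have : 0 <= p%:R :> R by exact: ler0n.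
move: (p%:R : R) => q q0.
have -> : (2 * (2 * q + 1) * rho) ^+ 2 + 2 * (2 * (2 * q + 1) * rho) * c =
  4 * (2 * q + 1) * (rho * ((2 * q + 1) * rho + c)) by ring.
have -> : 4 * (2 * q + 1) ^+ 2 * (rho * (rho + c)) =
  4 * (2 * q + 1) * (rho * ((2 * q + 1) * rho + (2 * q + 1) * c)) by ring.
rewrite ler_wpM2l//; first by lra.
by rewrite ler_wpM2l// lerD2l; nra.
Qed.

End integration_by_parts.

(** * Almost sure convergence from summable expectations *)

Section almost_sure.
Context d (T : measurableType d) {R : realType} (P : probability T R).

(** The sum of the series has finite expectation, hence is almost surely
    finite. *)
Lemma ae_cvg0 (f : nat -> T -> R) (a : nat -> R) (A : R) :
  (forall n, measurable_fun setT (f n)) -> (forall n x, 0 <= f n x) ->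
  (forall n, \int[P]_x (f n x)%:E <= (a n)%:E)%E ->
  (forall N, \sum_(0 <= n < N) a n <= A) ->
  {ae P, forall w, f n w @[n --> \oo] --> 0}.
Proof.
move=> mf f0 fa aA.
pose S (x : T) : \bar R := \big[+%E/0%E]_(0 <= n <oo) (f n x)%:E.
have mS : measurable_fun setT S.
  apply: (ge0_emeasurable_sum (P := xpredT)) => [n x _ _|n _].
    by rewrite lee_fin.
  exact/measurable_EFinP.
have S0 x : (0 <= S x)%E by apply: nneseries_ge0 => n _ _; rewrite lee_fin.
have iS : P.-integrable setT S.
  apply/integrableP; split=> //.
  under eq_integral do rewrite gee0_abs//.
  rewrite integral_nneseries//; last 2 first.
  - by move=> n; exact/measurable_EFinP.
  - by move=> n x _; rewrite lee_fin.
  apply: (@le_lt_trans _ _ A%:E); last exact: ltry.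
  have int0 n : (0 <= \int[P]_x (f n x)%:E)%E.
    by apply: integral_ge0 => x _; rewrite lee_fin.
  apply: lime_le; first exact: is_cvg_nneseries.
  near=> N; apply: (@le_trans _ _ (\sum_(0 <= n < N) (a n)%:E)%E).
    exact: lee_sum.
  by rewrite sumEFin lee_fin.
have := integrable_ae measurableT iS; apply: filterS => w /(_ I) fin.
apply: cvg_series_cvg_0; apply: nondecreasing_is_cvgn.
  apply/nondecreasing_seqP => n; rewrite /series/= big_nat_recr//=.
  by rewrite lerDl.
exists (fine (S w)) => _ [n _ <-]; rewrite -lee_fin fineK// /series/= -sumEFin.
by apply: nneseries_lim_ge => k _ _; rewrite lee_fin.
Unshelve. all: by end_near.
Qed.

Lemma ae_and (A1 A2 : T -> Prop) : {ae P, forall w, A1 w} -> {ae P, forall w, A2 w} ->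
  {ae P, forall w, A1 w /\ A2 w}.
Proof. by apply: filterS2. Qed.

Lemma outer_cover (S : set T) (x : \bar R) : ((P^*)%mu S < x)%E ->
  exists2 E, measurable E & S `<=` E /\ (P E < x)%E.
Proof.
move=> /ereal_inf_lt[_ [F hF <-]] Fx.
have mF := cover_measurable hF.
have mE : measurable (\bigcup_k F k) by exact: bigcup_measurable.
exists (\bigcup_k F k) => //; split; first exact: (cover_subset hF).
by apply: le_lt_trans Fx; exact: measure_sigma_subadditive.
Qed.

Lemma sum_geometric_half (N : nat) : \sum_(0 <= n < N) (2^-1 : R) ^+ n <= 2.
Proof.
suff -> : \sum_(0 <= n < N) (2^-1 : R) ^+ n = 2 - 2 * 2^-1 ^+ N.
  by rewrite gerBl mulr_ge0// exprn_ge0.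
elim: N => [|N IH]; first by rewrite big_geq// expr0 mulr1 subrr.
by rewrite big_nat_recr//= IH exprS; field.
Qed.

(** Along a suitable sequence of widths, uniform convergence in probability of
    the forward approximations improves to almost sure convergence, by the
    Borel-Cantelli argument. *)
Lemma forward_subsequence (Z : R -> T -> R) (B I : R -> {RV P >-> R}) :
  forward_integral Z B I ->
  exists2 e : nat -> R, e k @[k --> \oo] --> 0^'+ &
    {ae P, forall w, forall t : R, 0 <= t -> t <= 1 ->
      forward_approx Z B (e k) t w @[k --> \oo] --> I t w}.
Proof.
move=> h; pose q k : R := 2^-1 ^+ k.
have q0 k : 0 < q k by rewrite exprn_gt0// invr_gt0.
pose S k eps := [set w | exists2 t, t \in `[0, 1] &
  q k < `|forward_approx Z B eps t w - I t w|].
have /choice[e he] : forall k, exists eps : R,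
    [/\ 0 < eps, eps < q k & ((P^*)%mu (S k eps) < (q k)%:E)%E].
  move=> k; have := h _ (q0 k).
  move=> /(_ [set x | (x < (q k)%:E)%E]) [].
    apply: open_nbhs_nbhs; split; last by rewrite /= lte_fin.
    exact: open_ereal_lt_ereal.
  move=> r /= r0 hr.
  pose eps := Num.min (r / 2) (q k / 2).
  have eps0 : 0 < eps by rewrite lt_min !divr_gt0.
  exists eps; split=> //.
    rewrite /eps gt_min; apply/orP; right; have := q0 k; lra.
  apply: hr => //=; rewrite sub0r normrN gtr0_norm// /eps gt_min.
  by apply/orP; left; lra.
have q_cvg : q k @[k --> \oo] --> 0.
  by apply: cvg_expr; rewrite ger0_norm ?invr_ge0// invf_lt1 ?ltr1n.
exists e.
  move=> A [r /= r0 hr].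
  have /cvgr0Pnorm_lt/(_ r r0) := q_cvg.
  apply: filterS => k; have [e0 eq _] := he k => qr.
  by apply: hr => //=; rewrite sub0r normrN gtr0_norm//; apply: lt_trans eq (le_lt_trans (ler_norm _) qr).
have /choice[E hE] : forall k, exists E, measurable E /\ S k (e k) `<=` E /\ (P E < (q k)%:E)%E.
  by move=> k; have [_ _ /outer_cover[E mE hE]] := he k; exists E.
have : {ae P, forall w, \1_(E k) w @[k --> \oo] --> (0 : R)}.
  apply: (ae_cvg0 _ _ _ sum_geometric_half).
  - by move=> k; apply: measurable_indic; have [] := hE k.
  - by move=> k x; rewrite indicE ler0n.
  - move=> k; rewrite integral_indic//; last by have [] := hE k.
    by rewrite setIT; have [_ [_ /ltW]] := hE k.
apply: filterS => w fw t t0 t1.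
apply/cvgrPdist_lt => eps eps0.
have /cvgr0Pnorm_lt/(_ _ eps0) := q_cvg.
have /cvgr0Pnorm_lt/(_ 1 ltr01) := fw.
apply: filterS2 => k Ek qk.
rewrite ltNge distrC; apply/negP => le_eps.
have : E k w.
  have [_ [+ _]] := hE k; apply; exists t; first by rewrite in_itv/= t0 t1.
  by apply: lt_le_trans le_eps; apply: le_lt_trans qk; exact: ler_norm.
by move=> Ew; move: Ek; rewrite indicE mem_set//= normr1 ltxx.
Qed.

End almost_sure.

(** * Increments of the fractional Brownian motion *)

(** Comparison of the power p with the square of the ratio x / y. *)
Lemma powR_sub_le {R : realType} (p x y : R) : 1 <= p -> p <= 2 -> 0 <= x -> x <= y -> y <= 1 ->
  y `^ p - x `^ p <= 2 * (y - x).
Proof.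
move=> p1 p2 x0 xy y1.
have [y0|y0] := leP y 0.
  have -> : x = y by lra.
  by rewrite !subrr mulr0.
have r01 : 0 <= x / y <= 1.
  apply/andP; split; last by rewrite ler_pdivrMr// mul1r.
  by apply: divr_ge0 => //; exact: ltW.
have -> : x `^ p = (x / y) `^ p * y `^ p.
  by rewrite -powRM ?divfK ?gt_eqF//; [case/andP: r01|exact: ltW].
have h : (x / y) ^+ 2 <= (x / y) `^ p.
  rewrite -powR_mulrn; last by case/andP: r01.
  by apply: powR_anti => //; lra.
have yp : y `^ p <= y.
  
  apply: (@le_trans _ _ (y `^ 1)); last by rewrite powRr1 ?(ltW y0).
  by apply: powR_anti; [apply/andP; split; lra|lra|lra].
set z := x / y in r01 h *.
have -> : x = z * y by rewrite /z divfK// gt_eqF.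
case/andP: r01 => z0 z1; have := powR_ge0 y p; move: (y `^ p) (z `^ p) yp h => a c *.
have : 0 <= (1 - z) * (1 - z) * a by rewrite !mulr_ge0//; lra.
have : 0 <= (y - a) * (1 - z) by rewrite mulr_ge0//; lra.
have : 0 <= a * (c - z ^+ 2) by rewrite mulr_ge0//; lra.
nra.
Qed.

(** By convexity of the power. This is what makes disjoint increments of the
    process nonnegatively correlated. *)
Lemma powR_second_difference {R : realType} (p x h : R) : 1 <= p ->
  2 * `|x| `^ p <= `|x + h| `^ p + `|x - h| `^ p.
Proof.
move=> p1.
have mid : `|x| <= (`|x + h| + `|x - h|) / 2.
  have := ler_normD (x + h) (x - h); rewrite (_ : x + h + (x - h) = 2 * x); last by ring.
  by rewrite normrM ger0_norm//; lra.
rewrite (_ : _ / 2 = 2^-1 * `|x + h| + (1 - 2^-1) * `|x - h|) in mid; last by field.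
have le : `|x| `^ p <= (2^-1 * `|x + h| + (1 - 2^-1) * `|x - h|) `^ p.
  have := normr_ge0 (x + h); have := normr_ge0 (x - h) => ? ?.
  by apply: ge0_ler_powR; rewrite ?nnegrE//; lra.
have half01 : 0 <= (2^-1 : R) <= 1 by rewrite invr_ge0 ler0n invf_le1// ler1n.
have := convex_powR p1 (Itv01 (proj1 (andP half01)) (proj2 (andP half01))).
move=> /(_ (`|x + h|) (`|x - h|)).
rewrite !inE/= !in_itv/= !andbT !normr_ge0 => /(_ isT isT).
move=> h1.
have {}h1 : (2^-1 * `|x + h| + (1 - 2^-1) * `|x - h|) `^ p <=
  2^-1 * `|x + h| `^ p + (1 - 2^-1) * `|x - h| `^ p by exact: h1.
lra.
Qed.

Section fbm_increments.
Context d (T : measurableType d) {R : realType} (P : probability T R).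
Variables (H : R) (B : R -> {RV P >-> R}).
Hypothesis hH : 2^-1 < H < 1.
Hypothesis hB : fbm H B.

Let linear_gaussian (m : nat) (t a : 'I_m -> R) : (forall i, t i \in `[0, 1]) ->
  (\int[P]_w (\sum_(i < m) a i * B (t i) w)%:E = 0)%E ->
  all_moments P (fun w => \sum_(i < m) a i * B (t i) w) /\
  (forall r : nat, \int[P]_w ((\sum_(i < m) a i * B (t i) w) ^+ r.+2) =
    r.+1%:R * \int[P]_w ((\sum_(i < m) a i * B (t i) w) ^+ 2) *
    \int[P]_w ((\sum_(i < m) a i * B (t i) w) ^+ r)).
Proof.
move=> ht; apply: gaussian_moments; last exact: (fbm_gaussian hB).
by apply: measurable_sum => i; apply: measurable_funM.
Qed.

Let fbm_moments (t : R) : t \in `[0, 1] -> all_moments P (B t) /\ \int[P]_w B t w = 0.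
Proof.
move=> ht; have E : (fun w => \sum_(i < 1) 1 * B t w) = B t.
  by apply/funext => w; rewrite big_ord1 mul1r.
have B0 : (\int[P]_w (B t w)%:E = 0)%E.
  by have := fbm_centered hB ht; rewrite expectation_def.
split; last by rewrite /Rintegral B0.
rewrite -E; apply: (proj1 (@linear_gaussian 1 (fun=> t) (fun=> 1) _ _)) => //.
by under eq_integral do rewrite big_ord1 mul1r.
Qed.

Lemma fbm_product (s t : R) : s \in `[0, 1] -> t \in `[0, 1] ->
  \int[P]_w (B s w * B t w) = fbm_cov H s t.
Proof.
move=> hs ht; have [ms s0] := fbm_moments hs; have [mt t0] := fbm_moments ht.
have := fbm_covariance hB hs ht; rewrite covarianceE; last 3 first.
- exact/Lfun1_integrable/all_moments_integrable.
- exact/Lfun1_integrable/all_moments_integrable.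
- exact/Lfun1_integrable/all_moments_integrable/all_momentsM.
rewrite (fbm_centered hB hs) mul0e sube0 unlock /Rintegral => E.
by rewrite -[RHS]/(fine (fbm_cov H s t)%:E) -E.
Qed.

Variables (N : nat) (u v : 'I_N -> R).
Hypothesis u01 : forall i, u i \in `[0, 1].
Hypothesis v01 : forall i, v i \in `[0, 1].

Definition increment (i : 'I_N) (w : T) : R := B (v i) w - B (u i) w.

Lemma increment_moments i : all_moments P (increment i).
Proof.
apply: all_momentsD; first exact: (fbm_moments (v01 i)).1.
by apply: all_momentsN; exact: (fbm_moments (u01 i)).1.
Qed.

Lemma increment_mean (a : 'I_N -> R) : \int[P]_w linear_form increment a w = 0.
Proof.
rewrite Ex_sum; last by move=> i; apply/all_momentsZ/increment_moments.
rewrite big1// => i _; rewrite ExZ; last exact: increment_moments.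
have [mv v0] := fbm_moments (v01 i); have [mu u0] := fbm_moments (u01 i).
rewrite /increment RintegralB//; last 2 first.
- exact: all_moments_integrable.
- exact: all_moments_integrable.
by rewrite v0 u0 subrr mulr0.
Qed.

Lemma increment_gauss (a : 'I_N -> R) (r : nat) :
  \int[P]_w (linear_form increment a w ^+ r.+2) =
  r.+1%:R * \int[P]_w (linear_form increment a w ^+ 2) *
  \int[P]_w (linear_form increment a w ^+ r).
Proof.
(* A linear form in N increments is one in 2 N values of the process. *)
pose t (j : 'I_(N + N)) := match fintype.split j with inl i => v i | inr i => u i end.
pose c (j : 'I_(N + N)) := match fintype.split j with inl i => a i | inr i => - a i end.
have ht j : t j \in `[0, 1] by rewrite /t; case: fintype.split.
have E : (fun w => \sum_(j < N + N) c j * B (t j) w) = linear_form increment a.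
  apply/funext => w; rewrite big_split_ord/= -big_split/=; apply: eq_bigr => i _.
  rewrite /c /t (unsplitK (inl i)) (unsplitK (inr i)) /increment; ring.
have int0 : (\int[P]_w (linear_form increment a w)%:E = 0)%E.
  rewrite -[LHS]fineK; first by rewrite -/(Rintegral _ _ _) increment_mean.
  apply: integrable_fin_num => //; apply/all_moments_integrable/all_moments_sum => i.
  exact/all_momentsZ/increment_moments.
have h0 : (\int[P]_w (\sum_(j < N + N) c j * B (t j) w)%:E = 0)%E.
  by rewrite -[RHS]int0; apply: eq_integral => w _; rewrite -[in RHS]E.
by rewrite -E; exact: (linear_gaussian ht h0).2 r.
Qed.

Lemma increment_cov i j : \int[P]_w (increment i w * increment j w) =
  (`|v j - u i| `^ (2 * H) + `|u j - v i| `^ (2 * H)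
   - `|v j - v i| `^ (2 * H) - `|u j - u i| `^ (2 * H)) / 2.
Proof.
have mB t : t \in `[0, 1] -> all_moments P (B t) by move=> /fbm_moments[].
transitivity (\int[P]_w ((B (v i) w * B (v j) w + - 1 * (B (v i) w * B (u j) w)) +
   (- 1 * (B (u i) w * B (v j) w) + B (u i) w * B (u j) w))).
  by apply: eq_Rintegral => w _; rewrite /increment; ring.
have mBB s t : s \in `[0, 1] -> t \in `[0, 1] -> all_moments P (fun w => B s w * B t w).
  by move=> ? ?; apply: all_momentsM; exact: mB.
rewrite ExD; last 2 first.
- by apply: all_momentsD; last apply: all_momentsZ; exact: mBB.
- by apply: all_momentsD; first apply: all_momentsZ; exact: mBB.
rewrite ExD; [|exact: mBB|by apply: all_momentsZ; exact: mBB].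
rewrite ExD; [|by apply: all_momentsZ; exact: mBB|exact: mBB].
rewrite !ExZ; [|exact: mBB|exact: mBB].
by rewrite !fbm_product// /fbm_cov; field.
Qed.

End fbm_increments.

(** * Almost sure quadratic variation *)

Lemma sum_inv_squares {R : realType} (N : nat) : \sum_(0 <= n < N) (n.+1%:R^-1 : R) ^+ 2 <= 2.
Proof.
case: N => [|N]; first by rewrite big_geq.
suff h : \sum_(0 <= n < N.+1) (n.+1%:R^-1 : R) ^+ 2 <= 2 - N.+1%:R^-1.
  by apply: le_trans h _; rewrite gerBl invr_ge0.
elim: N => [|N IH]; first by rewrite big_nat1 invr1 expr1n; lra.
rewrite big_nat_recr//=; apply: le_trans (lerD IH (lexx _)) _.
have a0 : 0 < N.+1%:R :> R by rewrite ltr0n.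
rewrite -(natr1 N.+1); move: (N.+1%:R : R) a0 => a a0.
have a1 : 0 < a + 1 by lra.
rewrite -subr_ge0 (_ : _ - _ = (a * (a + 1) ^+ 2)^-1).
  by rewrite invr_ge0 mulr_ge0 ?sqr_ge0// ltW.
by field; rewrite !gt_eqF.
Qed.

Section quadratic_variation.
Context d (T : measurableType d) {R : realType} (P : probability T R).
Variables (H : R) (B : R -> {RV P >-> R}).
Hypothesis hH : 2^-1 < H < 1.
Hypothesis hB : fbm H B.

Section grid.
Variables (n m : nat).
Hypotheses (n0 : (0 < n)%N) (mn : (m <= n)%N).

Let h : R := n%:R^-1.
Let u (i : 'I_m) : R := i%:R / n%:R.
Let v (i : 'I_m) : R := i.+1%:R / n%:R.

Let n0R : 0 < n%:R :> R. Proof. by rewrite ltr0n. Qed.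

Let grid01 (k : nat) : (k <= n)%N -> (k%:R / n%:R : R) \in `[0, 1].
Proof.
by move=> kn; rewrite in_itv/= divr_ge0//= ler_pdivrMr// mul1r ler_nat.
Qed.

Let u01 i : u i \in `[0, 1].
Proof. by apply: grid01; have := ltn_ord i; lia. Qed.

Let v01 i : v i \in `[0, 1].
Proof. by apply: grid01; have := ltn_ord i; lia. Qed.

Let uv i : v i = u i + h.
Proof. by rewrite /v /u /h -natr1 mulrDl mul1r. Qed.

Let cov := increment_cov hB u01 v01.

Let cov_ge0 i j : 0 <= \int[P]_x (increment B u v i x * increment B u v j x).
Proof.
rewrite cov; apply: divr_ge0 => //.
have := @powR_second_difference R (2 * H) (u j - u i) h; rewrite !uv.
rewrite (_ : u j + h - u i = u j - u i + h); last by ring.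
rewrite (_ : u j - (u i + h) = u j - u i - h); last by ring.
rewrite (_ : u j + h - (u i + h) = u j - u i); last by ring.
move=> hh; have /hh : 1 <= 2 * H by have := hH; lra.
by lra.
Qed.

Let cov_diag i : \int[P]_x (increment B u v i x * increment B u v i x) = h `^ (2 * H).
Proof.
have h0 : 0 <= h by rewrite invr_ge0.
have hh := hH.
rewrite cov uv !subrr normr0 powR0; last by rewrite gt_eqF//; lra.
rewrite (_ : u i + h - u i = h); last by ring.
rewrite (_ : u i - (u i + h) = - h); last by ring.
by rewrite normrN ger0_norm//; field.
Qed.

Let cov_row i : \sum_(j < m) \int[P]_x (increment B u v i x * increment B u v j x) <= 2 * h.
Proof.
(* The sum over j telescopes: it is the covariance of the i-th increment with
   the value at time m / n. *)
pose F (j : nat) : R := `|j%:R / n%:R - u i| `^ (2 * H) - `|j%:R / n%:R - v i| `^ (2 * H).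
rewrite (eq_bigr (fun j : 'I_m => (F j.+1 - F j) / 2)); last first.
  by move=> j _; rewrite cov /F -/(v j) -/(u j); congr (_ / 2); ring.
rewrite -mulr_suml -(big_mkord xpredT (fun j => F j.+1 - F j)) telescope_sumr//.
have im := ltn_ord i; have hh := hH.
have uh := uv i.
have h0 : 0 <= h by rewrite invr_ge0.
have uv0 : 0 <= u i by rewrite /u divr_ge0.
have mv : v i <= m%:R / n%:R by rewrite /v ler_pM2r ?invr_gt0// ler_nat.
have m1 : m%:R / n%:R <= 1 :> R by have := grid01 mn; rewrite in_itv/= => /andP[].
have Fm : F m <= 2 * h.
  rewrite /F !ger0_norm ?subr_ge0//; last by lra.
  have := @powR_sub_le R (2 * H) (m%:R / n%:R - v i) (m%:R / n%:R - u i).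
  move=> k; apply: le_trans (k _ _ _ _ _) _; lra.
have F0 : - F 0%N <= 2 * h.
  rewrite /F mul0r !sub0r !normrN !ger0_norm//; last by lra.
  have := @powR_sub_le R (2 * H) (u i) (v i).
  rewrite opprB => k; apply: le_trans (k _ _ _ _ _) _; lra.
lra.
Qed.

(** The covariance matrix of the increments has row sums at most 2 / n, and the
    variances add up to at most n^(1 - 2 H): the centred sum of squares is of
    order n^(-H), hence of order n^(H - 1) after rescaling. *)
Lemma quadratic_variation_moment (p : nat) :
  let V w := n%:R `^ (2 * H - 1) * (\sum_(0 <= k < m) (B (k.+1%:R / n%:R) w - B (k%:R / n%:R) w) ^+ 2)
             - m%:R / n%:R in
  all_moments P V /\
  \int[P]_w (V w ^+ (2 * p)) <=
    (\prod_(j < p) (4 * (2 * j%:R + 1) ^+ 2)) * (6 * n%:R^-1 `^ (2 - 2 * H)) ^+ p.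
Proof.
move=> V; have hh := hH.
have h0 : 0 < h by rewrite invr_gt0.
have h1 : h <= 1 by rewrite invf_le1// ler1n.
pose c := \sum_(i < m) \int[P]_x (increment B u v i x * increment B u v i x).
have cE : c = m%:R * h `^ (2 * H).
  rewrite /c; under eq_bigr do rewrite cov_diag.
  by rewrite sumr_const card_ord [RHS]mulr_natl.
have nE : n%:R `^ (2 * H - 1) = h `^ (1 - 2 * H).
  by rewrite /h natr_invr_powR opprB.
pose U w := \sum_(i < m) increment B u v i w ^+ 2 - c.
have VU w : V w = n%:R `^ (2 * H - 1) * U w.
  rewrite /V /U big_mkord mulrBr; congr (_ - _).
  rewrite cE nE mulrCA -powRD; last by rewrite (gt_eqF h0) implybT.
  by rewrite (_ : 1 - 2 * H + 2 * H = 1) ?powRr1 ?(ltW h0)//; ring.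
have mU : all_moments P U.
  apply: all_momentsD; last exact: all_moments_cst.
  apply: all_moments_sum => i; apply: all_momentsX.
  exact: (increment_moments hB u01 v01).
split.
  have := all_momentsZ (n%:R `^ (2 * H - 1)) mU.
  by congr all_moments; apply/funext => w; rewrite VU.
have -> : \int[P]_w (V w ^+ (2 * p)) =
    n%:R `^ (2 * H - 1) ^+ (2 * p) * \int[P]_w (U w ^+ (2 * p)).
  by rewrite -ExZ; [apply: eq_Rintegral => w _; rewrite VU exprMn|exact: all_momentsX].
have hm : \int[P]_w (U w ^+ (2 * p)) <=
    (\prod_(j < p) (4 * (2 * j%:R + 1) ^+ 2)) * (2 * h * (2 * h + c)) ^+ p.
  apply: (quadratic_moments (increment_moments hB u01 v01) (increment_mean hB u01 v01)
    (increment_gauss hB u01 v01) p cov_ge0 cov_row).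
  by rewrite mulr_ge0// ltW.
apply: le_trans (ler_wpM2l (exprn_ge0 _ (powR_ge0 _ _)) hm) _.
rewrite mulrCA ler_wpM2l//.
  by apply: prodr_ge0 => j _; rewrite mulr_ge0// sqr_ge0.
rewrite exprM -exprMn; apply: lerXn2r.
- have c0 : 0 <= c by rewrite cE mulr_ge0 ?powR_ge0.
  rewrite nnegrE; apply: mulr_ge0; [exact: sqr_ge0|apply: mulr_ge0; lra].
- by rewrite nnegrE mulr_ge0 ?powR_ge0.
have pw x y : h `^ x * h `^ y = h `^ (x + y) by rewrite powRD// (gt_eqF h0) implybT.
have hE : h = h `^ 1 by rewrite powRr1 ?(ltW h0).
have c1 : c <= h `^ (2 * H - 1).
  rewrite cE; apply: (@le_trans _ _ (h^-1 * h `^ (2 * H))).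
    by rewrite ler_wpM2r ?powR_ge0// /h invrK ler_nat.
  by rewrite -powR_inv1 ?(ltW h0)// pw addrC.
have h2 : h <= h `^ (2 * H - 1).
  by rewrite {1}hE; apply: powR_anti; [apply/andP; split; [exact: ltW|]|lra|lra].
rewrite nE expr2 pw.
apply: (@le_trans _ _ (h `^ (1 - 2 * H + (1 - 2 * H)) * (2 * h * (3 * h `^ (2 * H - 1))))).
  by rewrite ler_wpM2l ?powR_ge0// ler_wpM2l ?mulr_ge0 ?(ltW h0)//; lra.
rewrite (_ : _ * (2 * h * _) = 6 * (h `^ (1 - 2 * H + (1 - 2 * H)) * (h * h `^ (2 * H - 1)))); last by ring.
rewrite ler_wpM2l// {2}hE !pw le_eqVlt; apply/orP; left; apply/eqP; congr (_ `^ _); ring.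
Qed.

End grid.

(** The even moments of order at least 2 / (1 - H) of the centred, rescaled sum
    are summable in n. *)
Lemma quadratic_variation_block (M i : nat) : (0 < M)%N -> (i <= M)%N ->
  {ae P, forall w, \sum_(0 <= k < n * i %/ M)
      n%:R `^ (2 * H - 1) * (B (k.+1%:R / n%:R) w - B (k%:R / n%:R) w) ^+ 2
    @[n --> \oo] --> (i%:R / M%:R : R)}.
Proof.
move=> M0 iM; have hh := hH.
have [p hp] : exists p : nat, 2 <= p%:R * (2 - 2 * H).
  have q0 : 0 < 2 - 2 * H by lra.
  exists (Num.truncn (2 / (2 - 2 * H))).+1; rewrite -ler_pdivrMr//.
  by apply/ltW; have := real_truncnS_gt (num_real (2 / (2 - 2 * H))).
pose m n := (n.+1 * i %/ M)%N.
have mn n : (m n <= n.+1)%N.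
  by rewrite /m -[leqRHS](mulnK n.+1 M0); apply: leq_div2r; rewrite leq_mul2l iM orbT.
pose V n w := n.+1%:R `^ (2 * H - 1) *
  (\sum_(0 <= k < m n) (B (k.+1%:R / n.+1%:R) w - B (k%:R / n.+1%:R) w) ^+ 2) - (m n)%:R / n.+1%:R.
pose K : R := (\prod_(j < p) (4 * (2 * j%:R + 1) ^+ 2)) * 6 ^+ p.
have K0 : 0 <= K.
  by rewrite mulr_ge0 ?exprn_ge0//; apply: prodr_ge0 => j _; rewrite mulr_ge0// sqr_ge0.
have hV n : all_moments P (V n) /\ \int[P]_w (V n w ^+ (2 * p)) <= K * n.+1%:R^-1 ^+ 2.
  have [mV hm] := quadratic_variation_moment (ltn0Sn n) (mn n) p; split=> //.
  apply: le_trans hm _; rewrite exprMn mulrA ler_wpM2l//.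
  have n01 : 0 <= (n.+1%:R^-1 : R) <= 1 by rewrite invr_ge0 ler0n invf_le1 ?ltr0n// ler1n.
  rewrite -powR_mulrn; last by rewrite powR_ge0.
  rewrite -powRrM -[leRHS]powR_mulrn; last by case/andP: n01.
  by apply: powR_anti => //; lra.
have : {ae P, forall w, V n w ^+ (2 * p) @[n --> \oo] --> 0}.
  apply: (@ae_cvg0 _ _ _ _ _ (fun n => K * n.+1%:R^-1 ^+ 2) (K * 2)).
  - by move=> n; exact: (all_momentsX (2 * p) (hV n).1).1.
  - by move=> n w; rewrite exprM exprn_ge0// sqr_ge0.
  - move=> n; rewrite -[leLHS]fineK; first by rewrite lee_fin; exact: (hV n).2.
    apply: integrable_fin_num => //; exact/all_moments_integrable/all_momentsX/(hV n).1.
  - by move=> N; rewrite -mulr_sumr ler_wpM2l// sum_inv_squares.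
apply: filterS => w Vw.
have {}Vw : V n w @[n --> \oo] --> 0.
  apply/cvgr0Pnorm_lt => e e0.
  have p0 : (0 < 2 * p)%N.
    by rewrite muln_gt0/= lt0n; apply: contraTneq hp => ->; rewrite mul0r -ltNge.
  have /cvgr0Pnorm_lt/(_ _ (exprn_gt0 (2 * p) e0)) := Vw.
  by apply: filterS => n; rewrite normrX ltr_pXn2r// nnegrE// ltW.
have mlim : ((m n)%:R / n.+1%:R : R) @[n --> \oo] --> (i%:R / M%:R : R).
  have inv0 : (n.+1%:R^-1 : R) @[n --> \oo] --> 0 by exact: cvg_harmonic.
  have lo : (i%:R / M%:R - n.+1%:R^-1 : R) @[n --> \oo] --> (i%:R / M%:R : R).
    by rewrite -[X in _ --> X]subr0; apply: cvgB => //; exact: cvg_cst.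
  apply: (squeeze_cvgr _ lo (cvg_cst _)); apply: nearW => n.
  have M0R : 0 < M%:R :> R by rewrite ltr0n.
  have N0R : 0 < n.+1%:R :> R by rewrite ltr0n.
  have h1 : ((m n)%:R * M%:R : R) <= n.+1%:R * i%:R by rewrite -!natrM ler_nat leq_divM.
  have h2 : (n.+1%:R * i%:R : R) <= (m n).+1%:R * M%:R.
    by rewrite -!natrM ler_nat ltnW// ltn_ceil.
  apply/andP; split; last by rewrite ler_pdivrMr// mulrAC ler_pdivlMr// [leRHS]mulrC.
  rewrite lerBlDr -[X in _ <= _ + X]mul1r -mulrDl natr1 ler_pdivrMr// mulrAC ler_pdivlMr// mulrC//.
pose F n := \sum_(0 <= k < n * i %/ M)
  n%:R `^ (2 * H - 1) * (B (k.+1%:R / n%:R) w - B (k%:R / n%:R) w) ^+ 2.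
suff : (fun n => F n.+1) @ \oo --> (i%:R / M%:R : R) by rewrite (cvg_shiftS F).
have -> : (fun n => F n.+1) = (fun n => V n w + (m n)%:R / n.+1%:R).
  by apply/funext => n; rewrite /F /V subrK mulr_sumr.
by rewrite -[X in _ --> X]add0r; exact: cvgD.
Qed.

Lemma quadratic_variation_ae :
  {ae P, forall w, forall M i : nat, (0 < M)%N -> (i <= M)%N ->
    \sum_(0 <= k < n * i %/ M)
      n%:R `^ (2 * H - 1) * (B (k.+1%:R / n%:R) w - B (k%:R / n%:R) w) ^+ 2
    @[n --> \oo] --> (i%:R / M%:R : R)}.
Proof.
apply: ae_foralln => M; apply: ae_foralln => i.
have [M0|M0] := boolP (0 < M)%N; last exact: aeW.
have [iM|iM] := boolP (i <= M)%N; last exact: aeW.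
by have := quadratic_variation_block M0 iM; apply: filterS.
Qed.

End quadratic_variation.

(** * Hölder continuity of the paths *)

Lemma nat_between (a b : nat) : (b.*2 <= a)%N -> (a < b.*2.+2)%N -> a != b.*2 -> a = b.*2.+1.
Proof. by lia. Qed.

Section dyadic.
Context {R : realType}.
Variables (f : R -> R) (C be : R).
Hypothesis be0 : 0 < be.
Hypothesis cf : {within `[0, 1], continuous f}.

Let q : R := 2^-1 `^ be.
Let pw (n : nat) : R := 2 ^+ n.

Hypothesis dyadic : forall n k : nat, (k < 2 ^ n)%N ->
  `|f (k.+1%:R / pw n) - f (k%:R / pw n)| <= C * q ^+ n.

Let pw0 n : 0 < pw n. Proof. by rewrite exprn_gt0. Qed.

Let pwE n : pw n = (2 ^ n)%N%:R. Proof. by rewrite natrX. Qed.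

Let q01 : 0 < q < 1.
Proof.
have one : (1 : R) `^ be = 1 by rewrite powR1.
rewrite powR_gt0 ?invr_gt0//= -[ltRHS]one.
by apply: gt0_ltr_powR; rewrite // ?nnegrE ?invr_ge0// invf_lt1// ltr1n.
Qed.

Let C0 : 0 <= C.
Proof.
have := @dyadic 0 0 (ltn0Sn 0); rewrite expr0 mulr1.
exact: le_trans.
Qed.

Let fl (n : nat) (t : R) : nat := Num.truncn (pw n * t).
Let pt (n : nat) (t : R) : R := (fl n t)%:R / pw n.

Let flP n t : 0 <= t -> (fl n t)%:R <= pw n * t < (fl n t).+1%:R.
Proof. by move=> t0; apply: truncn_itv; rewrite mulr_ge0// ltW. Qed.

Let ptP n t : 0 <= t -> 0 <= t - pt n t <= (pw n)^-1.
Proof.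
move=> t0; have /andP[h1 h2] := flP n t0.
rewrite subr_ge0 /pt ler_pdivrMr// [t * _]mulrC h1/=.
rewrite -(ler_pM2l (pw0 n)) mulrBr [pw n * (_ / _)]mulrC divfK ?gt_eqF//.
rewrite mulfV ?gt_eqF// lerBlDr addrC natr1; exact: ltW.
Qed.

(** The approximation moves by 0 or 1 cell of the finer level. *)
Let step1 n t : 0 <= t -> t <= 1 -> `|f (pt n.+1 t) - f (pt n t)| <= C * q ^+ n.+1.
Proof.
move=> t0 t1; have /andP[h1 h2] := flP n t0; have /andP[h3 h4] := flP n.+1 t0.
have p2 : pw n.+1 = 2 * pw n by rewrite /pw exprS.
have h5 : (fl n.+1 t < (fl n t).*2.+2)%N.
  rewrite -(ltr_nat R); apply: le_lt_trans h3 _.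
  rewrite p2 -mulrA -doubleS -muln2 natrM mulrC ltr_pM2r//.
have h6 : ((fl n t).*2 <= fl n.+1 t)%N.
  rewrite -ltnS -(ltr_nat R); apply: le_lt_trans h4.
  by rewrite p2 -mulrA -muln2 natrM mulrC ler_pM2l.
have E : pt n t = (fl n t).*2%:R / pw n.+1.
  by rewrite /pt p2 -muln2 natrM [_%:R * 2]mulrC -mulf_div divff// mul1r.
have [eq|lt] := eqVneq (fl n.+1 t) (fl n t).*2.
  rewrite E /pt eq subrr normr0 mulr_ge0// exprn_ge0//; have := q01; lra.
have -> : pt n.+1 t = (fl n t).*2.+1%:R / pw n.+1.
  rewrite /pt; congr (_%:R / _); exact: nat_between.
rewrite E; apply: dyadic; rewrite (_ : _.*2 = (fl n.+1 t).-1); last by rewrite (nat_between h6 h5 lt).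
have : (fl n.+1 t <= 2 ^ n.+1)%N.
  by rewrite -(ler_nat R) -pwE; apply: le_trans h3 _; rewrite ger_pMr.
by rewrite (nat_between h6 h5 lt).
Qed.

Let D := C * q / (1 - q).

Let chain n m t : 0 <= t -> t <= 1 ->
  `|f (pt (n + m) t) - f (pt n t)| <= D * (q ^+ n - q ^+ (n + m)).
Proof.
move=> t0 t1; have hq := q01; elim: m => [|m IH].
  by rewrite addn0 !subrr normr0 mulr0.
rewrite addnS -(subrK (f (pt (n + m) t)) (f (pt (n + m).+1 t))) -addrA.
apply: le_trans (ler_normD _ _) _; apply: le_trans (lerD (step1 _ t0 t1) IH) _.
rewrite exprS /D le_eqVlt; apply/orP; left; apply/eqP; field.
by rewrite subr_eq0 gt_eqF//; lra.
Qed.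

Let continuity_at (t e : R) : 0 <= t -> t <= 1 -> 0 < e -> exists2 r : R, 0 < r &
  forall s : R, 0 <= s -> s <= 1 -> `|t - s| < r -> `|f t - f s| < e.
Proof.
move=> t0 t1 e0; have tI : `[0, 1]%classic t by rewrite /= in_itv/= t0 t1.
have /subspace_continuousP/(_ t tI)/cvgrPdist_lt/(_ _ e0)[r /= r0 hr] := cf.
by exists r => // s s0 s1 ts; apply: hr => //=; rewrite in_itv/= s0 s1.
Qed.

(** Continuity at t is what allows the finer level to go to infinity in the
    telescoping bound. *)
Let approx n t : 0 <= t -> t <= 1 -> `|f t - f (pt n t)| <= D * q ^+ n.
Proof.
move=> t0 t1; have hq := q01; have hC := C0; apply/ler_addgt0Pr => e e0.
have [r r0 hr] := continuity_at t0 t1 e0.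
have [m hm] : exists m, (pw (n + m))^-1 < r.
  have : (2^-1 : R) ^+ k @[k --> \oo] --> 0.
    by apply: cvg_expr; rewrite ger0_norm ?invr_ge0// invf_lt1 ?ltr1n.
  move=> /cvgr0Pnorm_lt/(_ _ r0)[m _ /(_ (n + m)%N)] /=.
  by rewrite leq_addl => /(_ isT) h; exists m; rewrite -exprVn; apply: le_lt_trans (ler_norm _) h.
have pt01 : 0 <= pt (n + m) t <= 1.
  have /andP[h1 h2] := ptP (n + m) t0.
  by rewrite /pt divr_ge0 ?(ltW (pw0 _))//= -/(pt _ _); lra.
have /andP[p0 p1] := pt01.
have /andP[h1 h2] := ptP (n + m) t0.
have h3 : `|f t - f (pt (n + m) t)| < e by apply: hr => //; rewrite ger0_norm//; lra.
rewrite -(subrK (f (pt (n + m) t)) (f t)) -addrA.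
apply: le_trans (ler_normD _ _) _; rewrite [leRHS]addrC.
apply: lerD; first exact: ltW.
apply: le_trans (chain _ _ t0 t1) _; rewrite ler_wpM2l//.
  by rewrite /D divr_ge0 ?mulr_ge0//; lra.
by rewrite gerBl exprn_ge0//; lra.
Qed.

(** A continuous path is Hölder as soon as its increments over the dyadic grids
    are: two points at distance about 1/2^n are joined through their dyadic
    approximations of the successive levels. *)
Lemma dyadic_holder : holder_on01 be f.
Proof.
have hq := q01; have hC := C0.
have D0 : 0 <= D by rewrite /D divr_ge0 ?mulr_ge0//; lra.
have key s t : 0 <= s -> s < t -> t <= 1 -> `|f t - f s| <= (2 * D + C) / q * (t - s) `^ be.
  move=> s0 st t1; have ts0 : 0 < t - s by lra.
  have [n [hn1 hn2]] : exists n, (pw n.+1)^-1 < t - s /\ t - s <= (pw n)^-1.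
    have ex : exists k, (pw k)^-1 < t - s.
      have : (2^-1 : R) ^+ k @[k --> \oo] --> 0.
        by apply: cvg_expr; rewrite ger0_norm ?invr_ge0// invf_lt1 ?ltr1n.
      move=> /cvgr0Pnorm_lt/(_ _ ts0)[m _ /(_ m (leqnn m))]/=.
      by exists m; rewrite -exprVn; apply: le_lt_trans (ler_norm _) _.
    case: (ex_minnP ex) => -[|k] hk kmin.
      by move: hk; rewrite /pw expr0 invr1; lra.
    exists k; split=> //; rewrite leNgt; apply/negP => /kmin.
    by rewrite ltnn.
  have t0 : 0 <= t by lra.
  have s1 : s <= 1 by lra.
  have /andP[a1 a2] := flP n s0; have /andP[b1 b2] := flP n t0.
  have pts : pw n * (t - s) <= 1.
    by rewrite -[leRHS](@mulfV _ (pw n)) ?gt_eqF// ler_pM2l.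
  have st1 : (fl n s < (fl n t).+1)%N.
    rewrite -(ltr_nat R); apply: le_lt_trans a1 (le_lt_trans _ b2).
    by rewrite ler_pM2l// ltW.
  have st2 : (fl n t < (fl n s).+2)%N.
    by rewrite -(ltr_nat R) -(natr1 (fl n s).+1); apply: le_lt_trans b1 _; lra.
  have ft : (fl n t <= 2 ^ n)%N.
    by rewrite -(ler_nat R) -pwE; apply: le_trans b1 _; rewrite ger_pMr.
  have mid : `|f (pt n t) - f (pt n s)| <= C * q ^+ n.
    have [eq|lt] := eqVneq (fl n t) (fl n s).
      by rewrite /pt eq subrr normr0 mulr_ge0// exprn_ge0//; lra.
    have E : fl n t = (fl n s).+1.
      by apply/eqP; rewrite eqn_leq -ltnS st2/= ltn_neqAle eq_sym lt -ltnS.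
    by rewrite /pt E; apply: dyadic; rewrite -E.
  have At := approx n t0 t1; have As := approx n s0 s1.
  have tot : `|f t - f s| <= (2 * D + C) * q ^+ n.
    rewrite (_ : f t - f s = (f t - f (pt n t)) + (f (pt n t) - f (pt n s)) -
      (f s - f (pt n s))); last by ring.
    apply: le_trans (ler_normB _ _) _; apply: le_trans (lerD (ler_normD _ _) (lexx _)) _.
    by rewrite mulrDl; lra.
  apply: (le_trans tot); rewrite -mulrA; apply: ler_wpM2l; first by lra.
  rewrite ler_pdivlMl; last by lra.
  rewrite -exprS -powR_mulrn; last by lra.
  rewrite /q powRAC powR_mulrn ?invr_ge0// exprVn.
  apply: powR_mono; [exact: ltW|by rewrite invr_ge0 ltW|exact: ltW].
exists ((2 * D + C) / q) => s t; rewrite !in_itv/= => /andP[s0 s1] /andP[t0 t1].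
have [lt|lt|->] := ltgtP s t.
- by rewrite [`|t - s|]ger0_norm ?subr_ge0 ?(ltW lt)//; exact: key.
- by rewrite distrC [`|t - s|]distrC [`|s - t|]ger0_norm ?subr_ge0 ?(ltW lt)//; exact: key.
- by rewrite !subrr normr0 mulr_ge0 ?powR_ge0// divr_ge0//; lra.
Qed.

End dyadic.

Section fbm_paths.
Context d (T : measurableType d) {R : realType} (P : probability T R).
Variables (H : R) (B : R -> {RV P >-> R}).
Hypothesis hH : 2^-1 < H < 1.
Hypothesis hB : fbm H B.

Lemma fbm_even_moments (s t : R) (p : nat) : s \in `[0, 1] -> t \in `[0, 1] ->
  all_moments P (fun w => B t w - B s w) /\
  \int[P]_w ((B t w - B s w) ^+ (2 * p)) =
    (\prod_(j < p) (2 * j%:R + 1)) * (`|t - s| `^ (2 * H)) ^+ p.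
Proof.
move=> hs ht.
pose u (i : 'I_1) := s; pose v (i : 'I_1) := t.
have hu i : u i \in `[0, 1] by []. have hv i : v i \in `[0, 1] by [].
have lf w : linear_form (increment B u v) (fun=> 1) w = B t w - B s w.
  by rewrite /linear_form big_ord1 mul1r.
split; first exact: (increment_moments hB hu hv ord0).
have g r := increment_gauss hB hu hv (fun=> 1) r.
have lE r : \int[P]_w (linear_form (increment B u v) (fun=> 1) w ^+ r) =
    \int[P]_w ((B t w - B s w) ^+ r).
  by apply: eq_Rintegral => w _; rewrite lf.
have v2 : \int[P]_w ((B t w - B s w) ^+ 2) = `|t - s| `^ (2 * H).
  have := increment_cov hB hu hv ord0 ord0; rewrite /increment/u/v => h.
  have h0 : (0 : R) `^ (2 * H) = 0 by rewrite powR0// gt_eqF//; have := hH; lra.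
  rewrite !subrr normr0 h0 [`|s - t|]distrC in h.
  rewrite (_ : \int[P]_w _ = \int[P]_w ((B t w - B s w) * (B t w - B s w))) ; last first.
    by apply: eq_Rintegral => w _; rewrite expr2.
  by rewrite h; field.
elim: p => [|p IH].
  rewrite muln0 big_ord0 expr0 mulr1; under eq_Rintegral do rewrite expr0.
  exact: Ex_cst.
rewrite (_ : 2 * p.+1 = (2 * p).+2)%N; last by lia.
rewrite -lE g !lE IH v2 big_ord_recr/= exprS -natr1 natrM; ring.
Qed.

(** Kolmogorov's criterion: for moments of high order, the 2^n increments of the
    dyadic grid of level n, rescaled, have summable expectations. *)
Lemma fbm_holder (be : R) : 0 < be -> be < H ->
  {ae P, forall w, holder_on01 be (fun t => B t w)}.
Proof.
move=> be0 beH; have hh := hH.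
pose g : R := 2^-1; have g0 : 0 < g by rewrite invr_gt0.
have g01 : 0 <= g <= 1 by rewrite (ltW g0)/= invf_le1// ler1n.
pose q := g `^ be; have q0 : 0 < q by exact: powR_gt0.
have [p hp] : exists p : nat, 2 <= p%:R * (2 * (H - be)).
  have x0 : 0 < 2 * (H - be) by lra.
  exists (Num.truncn (2 / (2 * (H - be)))).+1; rewrite -ler_pdivrMr//.
  by apply/ltW; have := real_truncnS_gt (num_real (2 / (2 * (H - be)))).
pose D n k w := B (k.+1%:R / 2 ^+ n) w - B (k%:R / 2 ^+ n) w.
pose f n w := \sum_(k < 2 ^ n) (D n k w / q ^+ n) ^+ (2 * p).
pose c : R := \prod_(j < p) (2 * j%:R + 1).
have c0 : 0 <= c by apply: prodr_ge0 => j _; rewrite addr_ge0// mulr_ge0.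
have pn0 n : 0 < 2 ^+ n :> R by rewrite exprn_gt0.
have D01 n k : (k <= 2 ^ n)%N -> (k%:R / 2 ^+ n : R) \in `[0, 1].
  by move=> kn; rewrite in_itv/= divr_ge0 ?(ltW (pn0 n))//= ler_pdivrMr// mul1r -natrX ler_nat.
have mD n k : (k < 2 ^ n)%N -> all_moments P (D n k) /\
    \int[P]_w (D n k w ^+ (2 * p)) = c * ((g ^+ n) `^ (2 * H)) ^+ p.
  move=> kn; have [h1 h2] := fbm_even_moments p (D01 n k (ltnW kn)) (D01 n k.+1 kn).
  split=> //; rewrite /D h2 -mulrBl -natrB// subSnn mul1r ger0_norm ?invr_ge0 ?(ltW (pn0 n))//.
  by rewrite /g exprVn.
have mterm n (k : 'I_(2 ^ n)) : all_moments P (fun w => (D n k w / q ^+ n) ^+ (2 * p)).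
  apply: all_momentsX; have := all_momentsZ (q ^+ n)^-1 (mD n k (ltn_ord k)).1.
  by congr all_moments; apply/funext => w; rewrite mulrC.
have mf n : all_moments P (f n) by exact: all_moments_sum.
have intf n : \int[P]_w f n w <= c * g ^+ n.
  have E (k : 'I_(2 ^ n)) : \int[P]_w ((D n k w / q ^+ n) ^+ (2 * p)) =
      c * (g `^ (2 * H) ^+ p / q ^+ (2 * p)) ^+ n.
    have [m1 m2] := mD n k (ltn_ord k).
    transitivity ((q ^+ n) ^- (2 * p) * \int[P]_w (D n k w ^+ (2 * p))).
      rewrite -ExZ; last exact: all_momentsX.
      by apply: eq_Rintegral => w _; rewrite exprMn exprVn mulrC.
    rewrite m2 mulrCA -(powR_mulrn n (ltW g0)) powRAC powR_mulrn ?powR_ge0//.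
    by congr (_ * _); rewrite expr_div_n -!exprM mulrC [(n * p)%N]mulnC [(n * _)%N]mulnC.
  rewrite Ex_sum// (eq_bigr _ (fun k _ => E k)) sumr_const card_ord -[leLHS]mulr_natl.
  rewrite mulrCA ler_wpM2l// natrX -exprMn.
  apply: lerXn2r; rewrite ?nnegrE ?(ltW g0)//.
    by rewrite mulr_ge0// divr_ge0 ?exprn_ge0 ?powR_ge0.
  rewrite /q -!powR_mulrn ?powR_ge0// -!powRrM -powRB; last by rewrite (gt_eqF g0) implybT.
  rewrite [X in X * _ <= _](_ : (2 : R) = g `^ (-1)); last by rewrite powR_inv1 ?(ltW g0)// invrK.
  rewrite -powRD; last by rewrite (gt_eqF g0) implybT.
  rewrite -[leRHS](powRr1 (ltW g0)); apply: powR_anti => //.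
  by rewrite natrM; lra.
have : {ae P, forall w, f n w @[n --> \oo] --> 0}.
  apply: (@ae_cvg0 _ _ _ _ _ (fun n => c * g ^+ n) (c * 2)).
  - by move=> n; exact: (mf n).1.
  - move=> n w; apply: sumr_ge0 => k _.
    by rewrite exprM exprn_ge0// sqr_ge0.
  - move=> n; rewrite -[leLHS]fineK; first by rewrite lee_fin; exact: intf.
    by apply: integrable_fin_num => //; exact/all_moments_integrable/mf.
  - by move=> N; rewrite -mulr_sumr ler_wpM2l// sum_geometric_half.
move=> fae; have := fbm_continuous hB; move: fae; apply: filterS2 => w fw cw.
have [K K0 hK] : exists2 K : R, 0 <= K & forall n, f n w <= K.
  have /cvg_seq_bounded/pinfty_ex_gt0[K K0 hK] : cvgn (f ^~ w) by apply/cvg_ex; exists 0.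
  by exists K => [|n]; [exact: ltW|apply: le_trans (ler_norm _) (hK n I)].
apply: (@dyadic_holder _ _ (1 + K)) => // n k kn.
have p0 : (0 < 2 * p)%N.
  by rewrite muln_gt0/= lt0n; apply: contraTneq hp => ->; rewrite mul0r -ltNge.
rewrite -ler_pdivrMr ?exprn_gt0//.
have : (`|D n k w| / q ^+ n) ^+ (2 * p) <= K.
  apply: le_trans (hK n); rewrite /f (bigD1 (Ordinal kn))//=.
  rewrite exprM [(_ / _) ^+ 2]exprMn real_normK ?num_real// -exprMn -exprM lerDl.
  by apply: sumr_ge0 => j _; rewrite exprM exprn_ge0// sqr_ge0.
move: (`|D n k w| / _) => x xK; have [x1|x1] := leP x 1; first by lra.
apply: (@le_trans _ _ K); last by lra.
by apply: le_trans xK; apply: ler_eXnr => //; exact: ltW.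
Qed.

End fbm_paths.

(** * The asymptotic error of the Euler scheme *)

Section regularity.
Context {R : realType}.
Implicit Types g f : R -> R.

Lemma Ckb_is_derive k g j (z : R) : Ckb k g -> (j < k)%N ->
  is_derive z 1 (derive1n j g) (derive1n j.+1 g z).
Proof. by move=> [dg _ _] jk; rewrite derive1nS derive1E; apply/derivableP/dg. Qed.

Lemma Ckb_lip k g j : Ckb k g -> (j < k)%N -> exists M, lip M (derive1n j g).
Proof.
move=> hg jk; have [_ _ /(_ j.+1 jk)[M hM]] := hg; exists M.
by apply: lip_of_bounded hM => z; exact: Ckb_is_derive hg jk.
Qed.

Lemma lip_weaken (M N : R) f : M <= N -> lip M f -> lip N f.
Proof. by move=> MN h x y; apply: le_trans (h x y) _; rewrite ler_wpM2r. Qed.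

Lemma integral_split f (a s t : R) : 0 < a -> holder_on01 a f ->
  0 <= s -> s <= t -> t <= 1 -> \int[lebesgue_measure]_(u in `[s, t]) f u =
  \int[lebesgue_measure]_(u in `[0, t]) f u - \int[lebesgue_measure]_(u in `[0, s]) f u.
Proof.
move=> a0 hf s0 st t1; have [C C0 lf] := holder_clip01 (ltW a0) hf.
have [F [_ iF]] := primitive_exists (holder_continuous a0 C0 lf).
have E (u v : R) : 0 <= u -> u <= v -> v <= 1 ->
    \int[lebesgue_measure]_(x in `[u, v]) f x = F v - F u.
  move=> u0 uv v1; rewrite -iF//; apply: eq_Rintegral => x.
  rewrite inE/= in_itv/= => /andP[ux xv]; rewrite /= clip01_id//; lra.
rewrite !E//; lra.
Qed.

End regularity.

Section pathwise.
Context {R : realType}.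
Variables (H al be x0 : R) (b sigma : R -> R) (B X I J D : R -> R) (eI eJ : nat -> R).
Hypotheses (hb : Ckb 2 b) (hsigma : Ckb 3 sigma).
Hypotheses (be0 : 1 / 2 < be) (be1 : be < 1) (beH : 2 * H - 1 < be)
  (beH' : 2 * H + 1 < 4 * be) (al0 : 0 < al) (albe : 1 < al + be).
Hypotheses (hB : holder_on01 be B) (hX : holder_on01 al X).

Let forward_limit (Z I : R -> R) (e : nat -> R) := e k @[k --> \oo] --> 0^'+ /\
  forall t : R, 0 <= t -> t <= 1 -> (e k)^-1 *
    \int[lebesgue_measure]_(u in `[0, t]) (Z u * (B (Num.min (u + e k) 1) - B u))
    @[k --> \oo] --> I t.

Hypothesis hI : forward_limit (sigma \o X) I eI.
Hypothesis hJ : forward_limit (derive1 sigma \o X) J eJ.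
Hypothesis XE : forall t : R, t \in `[0, 1] ->
  X t = x0 + I t + \int[lebesgue_measure]_(s in `[0, t]) b (X s).
Hypothesis DE : forall s : R, s \in `[0, 1] -> D s = sigma (X s) *
  expR ((\int[lebesgue_measure]_(u in `[s, 1]) derive1 b (X u)) + (J 1 - J s)).
Hypothesis quadratic_variation : forall N i : nat, (0 < N)%N -> (i <= N)%N ->
  \sum_(0 <= k < n * i %/ N)
    n%:R `^ (2 * H - 1) * (B (k.+1%:R / n%:R) - B (k%:R / n%:R)) ^+ 2
  @[n --> \oo] --> (i%:R / N%:R : R).
Variable e : nat -> nat -> R.
Hypothesis e0 : forall n, e n 0%N = x0.
Hypothesis eS : forall n k, e n k.+1 = e n k +
  sigma (e n k) * (B (k.+1%:R / n%:R) - B (k%:R / n%:R)) + b (e n k) / n%:R.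

(** The randomness enters only through three almost sure properties of the
    paths: Hölder continuity, convergence of the forward approximations along
    some sequences of widths, and quadratic variation. *)
Lemma pathwise_error :
  n%:R `^ (2 * H - 1) * (e n n - X 1) @[n --> \oo] -->
    - 2^-1 * \int[lebesgue_measure]_(s in `[0, 1]) (derive1 sigma (X s) * D s).
Proof.
have hbe0 := be0; have hbe1 := be1; have hal0 := al0; have halbe := albe.
have [M0 l0] := Ckb_lip hsigma (isT : (0 < 3)%N).
have [M1 l1] := Ckb_lip hsigma (isT : (1 < 3)%N).
have [M2 l2] := Ckb_lip hsigma (isT : (2 < 3)%N).
have [M3 l3] := Ckb_lip hb (isT : (0 < 2)%N).
have [M4 l4] := Ckb_lip hb (isT : (1 < 2)%N).
have m0 := lip_ge0 l0; have m1 := lip_ge0 l1; have m2 := lip_ge0 l2.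
have m3 := lip_ge0 l3; have m4 := lip_ge0 l4.
pose M := M0 + M1 + M2 + M3 + M4.
have lsg : lip M sigma by apply: lip_weaken l0; rewrite /M; lra.
have lsg1 : lip M (derive1 sigma) by apply: lip_weaken l1; rewrite /M; lra.
have lsg2 : lip M (derive1n 2 sigma) by apply: lip_weaken l2; rewrite /M; lra.
have lb : lip M b by apply: lip_weaken l3; rewrite /M; lra.
have lb1 : lip M (derive1 b) by apply: lip_weaken l4; rewrite /M; lra.
have hM : 0 <= M by rewrite /M; lra.
have dsg (z : R) : is_derive z 1 sigma (derive1 sigma z) by exact: (Ckb_is_derive z hsigma (isT : (0 < 3)%N)).
have dsg1 (z : R) : is_derive z 1 (derive1 sigma) (derive1n 2 sigma z).
  exact: (Ckb_is_derive z hsigma (isT : (1 < 3)%N)).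
have db (z : R) : is_derive z 1 b (derive1 b z) by exact: (Ckb_is_derive z hb (isT : (0 < 2)%N)).
have XE' t : 0 <= t -> t <= 1 -> X t = x0 + I t + \int[lebesgue_measure]_(u in `[0, t]) b (X u).
  by move=> t0 t1; apply: XE; rewrite in_itv/= t0 t1.
have [eI0 limI] := hI; have [eJ0 limJ] := hJ.
have I_incr g : 0 < g -> 1 < g + be -> holder_on01 g (sigma \o X) ->
    incr_O (fun s t => I t - I s - sigma (X s) * (B t - B s)) (g + be).
  move=> g0 gbe hg; apply: (forward_limit_increment g0 _ gbe hg hB eI0 limI); lra.
have hXb : holder_on01 be X by exact: (solution_holder lsg lb be0 be1 al0 albe hB hX I_incr XE').
have X_exp := solution_expansion dsg lsg lsg1 lb be0 be1 al0 albe hB hX I_incr XE'.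
have J_incr : incr_O (fun s t => J t - J s - derive1 sigma (X s) * (B t - B s)) (be + be).
  apply: (forward_limit_increment _ _ _ _ hB eJ0 limJ); [lra|lra|lra|].
  exact: (holder_lip hM lsg1 hXb).
have hb1 : holder_on01 be (derive1 b \o X) by exact: (holder_lip hM lb1 hXb).
pose G t := \int[lebesgue_measure]_(u in `[0, t]) derive1 b (X u) + J t.
have be_gt0 : 0 < be by lra.
have G_exp : incr_O (fun s t => G t - G s - derive1 sigma (X s) * (B t - B s)
    - derive1 b (X s) * (t - s)) (be + be).
  apply: incr_O_ext (incr_O_D J_incr (incr_O_weak _ _ (integral_increment be_gt0 hb1))).
  - by move=> s t _ _ _; rewrite /G /=; ring.
  - lra.
  - lra.
have X0 : X 0 = x0.
  rewrite XE' // (forward_limit0 (limI 0 (lexx _) ler01)).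
  by rewrite set_itv1 Rintegral_set1 !addr0.
have e0' n : e n 0%N = X 0 by rewrite X0.
have := error_limit dsg dsg1 db lsg lsg1 lsg2 lb lb1 be0 be1 beH beH' hB hXb X_exp
  G_exp e0' eS quadratic_variation.
congr (_ --> _); congr (_ * _); apply: eq_Rintegral => s; rewrite inE/= in_itv/=.
move=> /andP[s0 s1]; rewrite DE ?in_itv/= ?s0//.
rewrite (integral_split be_gt0 hb1 s0 s1)//.
by congr (_ * (_ * expR _)); rewrite /G; ring.
Qed.

End pathwise.

Theorem theorem1 (d : measure_display) (T : measurableType d) (R : realType)
    (P : probability T R) (H : R) (B : R -> {RV P >-> R})
    (b sigma : R -> R) (x0 : R) (X : R -> {RV P >-> R}) (D : R -> T -> R)
    (hH : 2^-1 < H < 1) (hB : fbm H B)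
    (hb : Ckb 2 b) (hsigma : Ckb 3 sigma)
    (hX : sde_solution H B b sigma x0 X)
    (hD : malliavin_derivative H B (X 1) D)
    (hDX : malliavin_formula B b sigma X 1 D) :
  {ae P, forall w,
    n%:R `^ (2 * H - 1) * (euler B b sigma x0 n 1 w - X 1 w) @[n --> \oo] -->
    - 2^-1 * \int[lebesgue_measure]_(s in `[0, 1])
               (derive1 sigma (X s w) * D s w)}.
Proof.
have [[al hal al_holder] [I /forward_subsequence[eI eI0 limI] XE]] := hX.
have [J /forward_subsequence[eJ eJ0 limJ] DE] := hDX.
(* Every bound required from be is below H: 1 / 2 and 1 - al for sewing, the two
   others for the remainders to vanish after rescaling by n^(2 H - 1). *)
have [be [be_half be_H be_al be_2H be_4]] : exists be : R,
    [/\ 1 / 2 < be, be < H, 1 < al + be, 2 * H - 1 < be & 2 * H + 1 < 4 * be].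
  have [m [m1 m2 m3 m4 mH]] : exists m : R,
      [/\ 1 / 2 <= m, 1 - al <= m, 2 * H - 1 <= m, (2 * H + 1) / 4 <= m & m < H].
    exists (Num.max (Num.max (1 / 2) (1 - al)) (Num.max (2 * H - 1) ((2 * H + 1) / 4))).
    split; rewrite ?le_max ?lexx ?orbT// !gt_max; do !(apply/andP; split); lra.
  by exists ((H + m) / 2); split; lra.
have B_holder : {ae P, forall w, holder_on01 be (fun t => B t w)}.
  by apply: (fbm_holder hH hB) => //; lra.
have qv := quadratic_variation_ae hH hB.
have := ae_and al_holder (ae_and limI (ae_and XE (ae_and limJ (ae_and DE
  (ae_and B_holder qv))))).
apply: filterS => w [Xal [lI [XEw [lJ [DEw [Bbe qvw]]]]]].
under eq_fun do rewrite /euler mulr1 natrK.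
apply: (@pathwise_error R H al be x0 b sigma (fun t => B t w) (fun t => X t w)
  (fun t => I t w) (fun t => J t w) (fun t => D t w) eI eJ hb hsigma _ _ _ _ _ _
  Bbe Xal (conj eI0 lI) (conj eJ0 lJ) XEw DEw qvw (fun n k => euler_grid B b sigma x0 n k w)) => //; lra.
Qed.
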